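(* Let $\Omega\subset\mathbb{R}^2$ be a bounded convex set with nonempty interior, let $\mathcal{U}_\Omega$ be the set of continuous concave functions $u$ on $\Omega$ with bounded gradient that vanish on $\partial\Omega$, let $f:\mathbb{R}^2\to\mathbb{R}$ be a continuous function that is twice differentiable at $(0,0)$, and let $$F(u)=\int_\Omega f(\nabla u(x,y))\,dx\,dy,\qquad u\in\mathcal{U}_\Omega .$$ Consider the problem of minimizing $F$ over $\mathcal{U}_\Omega$, with local minima understood in the $C^1$ norm. (a) If the quadratic form $f''(0,0)$ is positive definite, then $u\equiv 0$ is a local minimum of $F$ in $\mathcal{U}_\Omega$. (b) If $f''(0,0)$ is negative definite, then $u\equiv 0$ is not a local minimum of $F$ in $\mathcal{U}_\Omega$. (c) Let $f''(0,0)$ be indefinite, with eigenvalues $-a<0<b$, and let $e_-$, $e_+$ be corresponding orthonormal eigenvectors (for $-a$ and $b$ respectively). (i) If at least one of the two lines of support to $\Omega$ parallel to $e_+$ is not angular, then $u\equiv 0$ is not a local minimum of $F$ in $\mathcal{U}_\Omega$. (ii) If both lines of support to $\Omega$ parallel to $e_+$ are angular, set $$K=\sup_{u\in\mathcal{U}_\Omega,\ u\not\equiv 0}\ \frac{\int_\Omega (\nabla u\cdot e_-)^2\,dx\,dy}{\int_\Omega (\nabla u\cdot e_+)^2\,dx\,dy}.$$ Then for $b/a<K$ the function $u\equiv 0$ is not a local minimum of $F$ in $\mathcal{U}_\Omega$, and for $b/a>K$ the function $u\equiv 0$ is a local minimum of $F$ in $\mathcal{U}_\Omega$.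
   Context: Functions in $\mathcal{U}_\Omega$ are understood as continuous concave functions $u:\overline{\Omega}\to\mathbb{R}$ with $u=0$ on $\partial\Omega$. Such a function is differentiable almost everywhere, and ''bounded gradient'' means that $|\nabla u|$ is bounded over all points of differentiability. The $C^1$ norm is $$\|u\|_{C^1}=\sup_{\Omega}|u|+\sup_{\Omega}|u_x|+\sup_{\Omega}|u_y|,$$ where the second and third suprema are taken over points where $u_x$, respectively $u_y$, exists. The function $u\equiv 0$ is a local minimum of $F$ in $\mathcal{U}_\Omega$ if there is $\delta>0$ such that $F(u)\ge F(0)$ for all $u\in\mathcal{U}_\Omega$ with $\|u\|_{C^1}<\delta$. $f''(0,0)$ denotes the second derivative (Hessian quadratic form) of $f$ at the origin; ''indefinite'' means it has one positive and one negative eigenvalue. A point $\xi\in\partial\Omega$ is regular if there is exactly one line of support to $\Omega$ at $\xi$, and singular otherwise. The tangent cone to $\Omega$ at $\xi\in\partial\Omega$ is the closure of $\{\xi+t(p-\xi): p\in\Omega,\ t\ge 0\}$. A line of support $l$ to $\Omega$ is called angular if there is a singular point $\xi\in\partial\Omega$ such that $l$ meets the tangent cone to $\Omega$ at $\xi$ only at the vertex $\xi$. (Thus a line of support that is tangent at a regular point, or that contains a side of the tangent cone at a singular point, is not angular.) *)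

(* Defs.v *)
(* Points and vectors of the plane are pairs in R * R. *)
From HB Require Import structures.
From mathcomp Require Export all_boot all_order all_algebra.
From mathcomp Require Export all_classical all_reals all_analysis.
Export Order.TTheory GRing.Theory Num.Theory.
Export numFieldNormedType.Exports.

Set Implicit Arguments.
Unset Strict Implicit.
Unset Printing Implicit Defensive.

Global Open Scope classical_set_scope.
Global Open Scope ring_scope.

Section plane.
Variable R : realType.
Implicit Types (p q v e n : R * R) (A l : set (R * R)) (u f : R * R -> R).

Definition dot v e : R := v.1 * e.1 + v.2 * e.2.

(* The norm of the library on R * R is the maximum norm. *)
Definition enorm v : R := Num.sqrt (dot v v).

Definition boundary A : set (R * R) := closure A `\` A°.

Definition dirx : R * R := (1, 0).
Definition diry : R * R := (0, 1).

(* Where a partial derivative does not exist, 'D takes the default value of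
   the library's limit operator. *)
Definition grad u p : R * R := ('D_dirx u p, 'D_diry u p).

Definition twice_differentiable f p :=
  (\forall q \near p, differentiable f q) /\ differentiable (grad f) p.

(* The Hessian of f at p as a linear operator on the plane; the second
   derivative of f at p is the associated quadratic form [hess_form]. *)
Definition hess f p : R * R -> R * R := 'd (grad f) p.

Definition hess_form f p v : R := dot (hess f p v) v.

Definition positive_definite (Q : R * R -> R) := forall v, v != 0 -> 0 < Q v.

Definition negative_definite (Q : R * R -> R) := forall v, v != 0 -> Q v < 0.

Definition orthonormal_pair v e := [/\ dot v v = 1, dot e e = 1 & dot v e = 0].

Local Notation area := (@lebesgue_measure R \x @lebesgue_measure R)%E.

(* The elements of the class are functions on closure A; they are encoded by
   total functions, whose values outside closure A play no role: derivatives
   are only considered at interior points of A, and the boundary of a bounded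
   convex set is a null set. *)
Definition in_class A u :=
  [/\ {within closure A, continuous u},
      convex_function (closure A) (fun p => - u p),
      (forall p, boundary A p -> u p = 0) &
      exists M : R, forall p, A° p -> differentiable u p ->
        enorm (grad u p) <= M].

(* A convex set A need not be Borel.  The library's integral of a nonnegative
   function over A is the supremum of the integrals of the Borel simple
   functions below its restriction to A.  As the boundary of a bounded convex
   set lies in a Borel null set, this agrees with the integral with respect to
   the completed Lebesgue measure. *)
Definition functional A f u : R := (\int[area]_(p in A) f (grad u p))%R.

Definition dir_energy A e u : R :=
  (\int[area]_(p in A) (dot (grad u p) e) ^+ 2)%R.

Definition C1norm A u : \bar R :=
  (ereal_sup [set `|u p|%:E | p in A]
   + ereal_sup [set `|'D_dirx u p|%:E | p in [set p | A° p /\ derivable u p dirx]]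
   + ereal_sup [set `|'D_diry u p|%:E | p in [set p | A° p /\ derivable u p diry]]
  )%E.

Definition zero_local_min A f :=
  exists2 delta : R, 0 < delta &
    forall u, in_class A u -> (C1norm A u < delta%:E)%E ->
      functional A f (cst 0) <= functional A f u.

Definition line_through p v : set (R * R) := [set p + t *: v | t in [set: R]].

Definition parallel l v := exists p, l = line_through p v.

Definition support_line A l := exists n, exists c : R,
  [/\ n != 0, l = [set q | dot n q = c], (forall p, A p -> dot n p <= c) &
      exists2 q, boundary A q & l q].

Definition regular_point A q :=
  boundary A q /\ exists! l, support_line A l /\ l q.

Definition singular_point A q := boundary A q /\ ~ regular_point A q.

Definition tangent_cone A q : set (R * R) :=
  closure [set r | exists p t, [/\ A p, 0 <= t & r = q + t *: (p - q)]].

Definition angular A l := support_line A l /\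
  exists2 q, singular_point A q & l `&` tangent_cone A q = [set q].

(* The denominator is positive: a function of the class that is constant
   along the lines parallel to ep is zero. *)
Definition Kconst A em ep : \bar R :=
  ereal_sup [set (dir_energy A em u / dir_energy A ep u)%:E | u in
    [set u | in_class A u /\ exists2 p, A p & u p != 0]].

End plane.

(* Main.v *)
From HB Require Import structures.
Require Import Defs.
From mathcomp Require Import measurable_realfun interval_inference ring lra.

(* Since u vanishes on the boundary, the integral of grad u over Omega is 0.
   Hence F (u) - F (0) is, up to an error o(|grad u|_2^2), half the integral of
   the Hessian form of f at grad u.  This gives (a), (b) and (c)(ii); for the
   last point one needs that a function of the class whose derivative along
   one direction vanishes almost everywhere is 0.

   Differentiability almost everywhere and the vanishing of the integral of
   grad u come from the same argument.  Extend u by 0 to a Lipschitz function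
   w on the plane.  The difference quotients of w have integral 0, because
   area is invariant under translations, and so have, by dominated convergence,
   both one-sided derivatives of u along e.  As u is concave, these are ordered;
   so they agree almost everywhere.

   For (c)(i), let l be a line of support parallel to e_+ which is not angular,
   and xi a boundary point on l.  For all eps > 0 there is a point B of Omega
   seen from xi under an angle less than eps with l, and there is a boundary
   point P0 below the middle of the segment from xi to B.  Consider the function
   u whose graph is a cone with an apex of height 1 above a point P close to P0.
   The condition that grad u . (q - P) >= -1 for q = xi and for q = B bounds
   |grad u . e_+| by a constant plus O(eps) |grad u . e_-|.  On the other hand
   the Dirichlet energy of u tends to infinity as P tends to P0: all the dyadic
   scales between |P - P0| and 1 contribute at least a fixed amount. *)

Set Implicit Arguments.
Unset Strict Implicit.
Unset Printing Implicit Defensive.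

(** * Area *)

(** The gradient bound of the class is available only at points of differentiability, while the
    argument with difference quotients needs a Lipschitz function to start from. So points of
    differentiability have to be found without measure theory: [dense_diff] gives a dense set of
    them, and the supergradient inequality at these points turns the gradient bound into a Lipschitz
    bound.

    All integrals are moved to the whole plane ([Int]) and to bounded measurable functions with
    bounded support ([nice]), with the field [G] of [weak_grad] in place of the gradient;
    [integral_null] permits this even if Omega is not Borel.

    In (c)(i) the order of choices matters: eps depends on a and b only, then B, and with it the
    distance r from xi to B along e_+, is fixed, and only then does P approach P0. The apex P has xi
    and B on different sides along e_+, each at distance at least r/4, which bounds grad u . e_+
    from both sides. The constant part of this bound is of order 1/r and may be huge, but it is
    fixed before the energy is made to diverge. The divergence rests on the invariance of the
    Dirichlet energy of the plane under scaling: u falls from 1/2 to 0 across a box of every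
    scale. *)

Section measure.
Variable R : realType.
Implicit Types (p q v e : R * R).
Local Notation mu := (@lebesgue_measure R).
Local Notation area := (mu \x mu)%E.

(** Countably many squares, with rational centre and half-side 1/(n+1), lie in [U]; they cover it,
    and each is a product of intervals. *)
Lemma open_measurable_plane (U : set (R * R)) : open U ->
  measurable (U : set (measurableTypeR R * measurableTypeR R)).
Proof.
move=> oU.
pose B (i : rat * rat * nat) : set (R * R) :=
  `]ratr i.1.1 - i.2.+1%:R^-1, ratr i.1.1 + i.2.+1%:R^-1[%classic `*`
  `]ratr i.1.2 - i.2.+1%:R^-1, ratr i.1.2 + i.2.+1%:R^-1[%classic.
pose C i := if `[< B i `<=` U >] then B i else set0.
have -> : U = \bigcup_i C i.
  apply/seteqP; split => [p Up|p [i _]]; last first.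
    by rewrite /C; case: asboolP => // BU /BU.
  have /nbhs_ballP[r /= r0 rU] : nbhs p U by exact: open_nbhs_nbhs.
  have [n nr] : exists n : nat, n.+1%:R^-1 < r / 2 :> R.
    have /= := @near_infty_natSinv_lt R (PosNum (divr_gt0 r0 (ltr0Sn R 1))).
    by move=> [n _ /(_ n (leqnn n)) ?]; exists n.
  have n0 : 0 < n.+1%:R^-1 :> R by rewrite invr_gt0.
  set d := n.+1%:R^-1 in n0 nr.
  have rat_near (x : R) : exists a : rat, `|x - ratr a| < d.
    have : x - d < x + d by lra.
    move=> /rat_in_itvoo[a]; rewrite in_itv/= => /andP[a1 a2]; exists a.
    by rewrite ltr_norml; lra.
  have [a pa] := rat_near p.1; have [b pb] := rat_near p.2.
  exists (a, b, n) => //; rewrite /C; case: asboolP => /=.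
    move=> _; rewrite /B /= -/d.
    by move: pa pb; rewrite !ltr_norml /= !in_itv /= => ? ?; split; lra.
  case=> q [] /=; rewrite -/d !in_itv/= => q1 q2; apply: rU; split; rewrite /ball/=.
    by move: pa; rewrite !ltr_norml; lra.
  by move: pb; rewrite !ltr_norml; lra.
apply: countable_bigcupT_measurable; first exact: countableP.
move=> i; rewrite /C; case: ifP => // _.
by apply: measurableX; exact: measurable_itv.
Qed.

Lemma continuous_measurable_plane (f : R * R -> R) : continuous f ->
  measurable_fun [set: measurableTypeR R * measurableTypeR R] f.
Proof.
move=> /continuousP cf; apply: (measurability _ (RGenOpens.measurableE R)).
move=> _ [_ [a [b ->] <-]]; rewrite setTI.
by apply: open_measurable_plane; exact/cf/interval_open.
Qed.

Lemma measurable_shift (a : R) : measurable_fun [set: measurableTypeR R]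
  (fun x : measurableTypeR R => (x + a : measurableTypeR R)).
Proof. exact: measurable_funD. Qed.

(** The pushforward of [mu] under the translation agrees with [mu] on half-open intervals, and these
    determine the measure. *)
Lemma lebesgue_translation (a : R) (A : set R) : measurable (A : set (measurableTypeR R)) ->
  mu [set x | A (x + a)] = mu A.
Proof.
move=> mA.
pose m' : {measure set (measurableTypeR R) -> \bar R} :=
  measure_function_pushforward__canonical__measure_function_Measure mu (measurable_shift a).
suff : mu A = m' A by [].
apply: lebesgue_measure_unique => //= _ [[x y] /= _ <-].
rewrite /m' /= /pushforward.
rewrite (_ : _ @^-1` _ = `]x - a, y - a]%classic); last first.
  by apply/seteqP; split => z /=; rewrite !in_itv/=; lra.
rewrite !lebesgue_measure_itv/= !lte_fin ltrD2r.
by case: ifP => // _; rewrite -!EFinD; congr EFin; ring.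
Qed.

Lemma measurable_translation v :
  measurable_fun [set: measurableTypeR R * measurableTypeR R]
    (fun p => (p + v : measurableTypeR R * measurableTypeR R)).
Proof.
apply/measurable_fun_pairP; split.
  rewrite (_ : fst \o _ = (fun p : measurableTypeR R * measurableTypeR R => p.1 + v.1))//.
  by apply: measurable_funD => //; exact: measurable_fst.
rewrite (_ : snd \o _ = (fun p : measurableTypeR R * measurableTypeR R => p.2 + v.2))//.
by apply: measurable_funD => //; exact: measurable_snd.
Qed.

(** A product measure is determined by its values on rectangles, and there the translation acts on
    each factor separately. *)
Lemma area_translation v (A : set (measurableTypeR R * measurableTypeR R)) :
  measurable A -> area [set p | A (p + v)] = area A.
Proof.
move=> mA; apply/esym.
pose m' : {measure set (measurableTypeR R * measurableTypeR R) -> \bar R} :=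
  measure_function_pushforward__canonical__measure_function_Measure area (measurable_translation v).
suff : area A = m' A by [].
apply: product_measure_unique => // X Y mX mY; rewrite /m' /= /pushforward.
rewrite (_ : _ @^-1` _ = [set x | X (x + v.1)] `*` [set y | Y (y + v.2)])//.
have mt (Z : set (measurableTypeR R)) (a : R) : measurable Z ->
    measurable ([set x | Z (x + a)] : set (measurableTypeR R)).
  by move=> mZ; rewrite -[X in measurable X]setTI; exact: (@measurable_shift a measurableT Z mZ).
rewrite [LHS](product_measure1E mu mu (mt _ _ mX) (mt _ _ mY)).
by congr (_ * _)%E; exact: lebesgue_translation.
Qed.

Lemma area_box (a b c d : R) (i j k l : bool) : a <= b -> c <= d ->
  area ([set` Interval (BSide i a) (BSide j b)] `*`
        [set` Interval (BSide k c) (BSide l d)]) = ((b - a) * (d - c))%:E.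
Proof.
move=> ab cd; rewrite [LHS](product_measure1E mu mu (measurable_itv _) (measurable_itv _)).
have len (x y : R) m n : x <= y ->
    mu [set` Interval (BSide m x) (BSide n y)] = (y - x)%:E.
  move=> xy; rewrite lebesgue_measure_itv/= lte_fin.
  case: ltP => yx; first by rewrite EFinB.
  by rewrite (_ : y = x) ?subrr//; apply/eqP; rewrite eq_le yx.
by rewrite EFinM; congr (_ * _)%E; exact: len.
Qed.

(** One constant bounds both the values and the support. The class is stable under sums, products
    and translations and consists of integrable functions, so integrability is settled once for all
    later integrals. *)
Definition nice (h : R * R -> R) :=
  measurable_fun [set: measurableTypeR R * measurableTypeR R] h /\
  exists C, (forall p, `|h p| <= C) /\ forall p, C < `|p| -> h p = 0.

Definition Int (h : R * R -> R) : R := (\int[area]_p h p)%R.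

Lemma integrable_indic_plane (A : set (measurableTypeR R * measurableTypeR R)) :
  measurable A -> (area A < +oo)%E -> area.-integrable setT (EFin \o \1_A).
Proof.
move=> mA Aoo; apply/integrableP; split; first exact/measurable_EFinP.
rewrite (eq_integral (EFin \o \1_A)) => [|p _]; last first.
  by rewrite /= ger0_norm// indicE.
by rewrite integral_indic// setIT.
Qed.

Lemma norm_pairE p : `|p| = Num.max `|p.1| `|p.2|.
Proof. by []. Qed.

Lemma nice_integrable h : nice h -> area.-integrable setT (EFin \o h).
Proof.
move=> [mh [C [hC h0]]].
have C0 : 0 <= C by rewrite (le_trans _ (hC 0)).
pose A : set (R * R) := `[- C, C]%classic `*` `[- C, C]%classic.
apply: (@le_integrable _ _ _ area setT measurableT _ (fun p => (C%:E * (\1_A p)%:E)%E)).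
- exact/measurable_EFinP.
- move=> p _; rewrite -EFinM /= lee_fin normrM (ger0_norm C0) indicE.
  case: (boolP (p \in A)) => [_|pA] /=; first by rewrite normr1 mulr1.
  rewrite normr0 mulr0 h0 ?normr0// norm_pairE ltNge; apply: contra pA.
  rewrite ge_max => /andP[]; rewrite !ler_norml => p1 p2.
  by rewrite inE /A; split; rewrite /= in_itv.
- apply: integrableZl => //; apply: integrable_indic_plane.
    by apply: measurableX; exact: measurable_itv.
  by rewrite area_box ?ltry; lra.
Qed.
End measure.

(** * Integrals of bounded functions with bounded support *)

Section nice.
Variable R : realType.
Implicit Types (p q v e : R * R) (h g : R * R -> R).
Local Notation mu := (@lebesgue_measure R).
Local Notation area := (mu \x mu)%E.
Local Notation plane := (measurableTypeR R * measurableTypeR R)%type.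
Local Notation meas h := (measurable_fun [set: plane] h).

(** The bounds of [nice] with the constant exposed, so that a single one can serve a whole sequence
    in dominated convergence. *)
Definition bounded_with (C : R) h :=
  (forall p, `|h p| <= C) /\ forall p, C < `|p| -> h p = 0.

Lemma niceD h g : nice h -> nice g -> nice (fun p => h p + g p).
Proof.
move=> [mh [C [hC h0]]] [mg [D [gD g0]]]; split; first exact: measurable_funD.
have C0 : 0 <= C by rewrite (le_trans _ (hC 0)).
have D0 : 0 <= D by rewrite (le_trans _ (gD 0)).
exists (C + D); split => p.
  by rewrite (le_trans (ler_normD _ _))// lerD.
move=> CDp; rewrite h0 ?g0 ?addr0//; lra.
Qed.

Lemma nice_mull (k : R * R -> R) (K : R) h : meas k -> (forall p, `|k p| <= K) ->
  nice h -> nice (fun p => k p * h p).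
Proof.
move=> mk kK [mh [C [hC h0]]]; split; first exact: measurable_funM.
have C0 : 0 <= C by rewrite (le_trans _ (hC 0)).
have K0 : 0 <= K by rewrite (le_trans _ (kK 0)).
(* [K * C] bounds the values and [C] the support; the sum does both. *)
exists (K * C + C); split => p.
  by rewrite normrM (@le_trans _ _ (K * C)) ?ler_pM// lerDl.
move=> Cp; rewrite h0 ?mulr0//.
by rewrite (le_lt_trans _ Cp)// lerDr mulr_ge0.
Qed.

Lemma niceM h g : nice h -> nice g -> nice (fun p => h p * g p).
Proof. by move=> [mh [C [hC h0]]]; apply: nice_mull hC. Qed.

Lemma niceZ c h : nice h -> nice (fun p => c * h p).
Proof. by apply: (@nice_mull (cst c) `|c|) => //; exact: measurable_cst. Qed.

Lemma niceB h g : nice h -> nice g -> nice (fun p => h p - g p).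
Proof.
move=> nh ng; rewrite (_ : (fun p => _) = fun p => h p + (- 1) * g p).
  by apply: niceD => //; exact: niceZ.
by apply/funext => p; rewrite mulN1r.
Qed.

Lemma nice_indic (A : set plane) C : measurable A ->
  (forall p, A p -> `|p : R * R| <= C) -> nice (\1_A : R * R -> R).
Proof.
move=> mA AC; split=> //; exists (Num.max 1 C); split => p.
  by rewrite indicE normr_nat le_max; case: (p \in A); rewrite /= ?lexx ?ler01.
rewrite gt_max => /andP[_ Cp]; rewrite indicE memNset// => /AC.
by rewrite leNgt Cp.
Qed.

Lemma nice_translation v h : nice h -> nice (fun p => h (p + v)).
Proof.
move=> [mh [C [hC h0]]]; split.
  exact: (measurableT_comp mh (measurable_translation v)).
exists (C + `|v|); split => p; first by rewrite (le_trans (hC _))// lerDl.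
move=> Cp; apply: h0.
have : `|p| <= `|p + v| + `|v| by rewrite -{1}(addrK v p) ler_normB.
lra.
Qed.

Lemma IntD h g : nice h -> nice g -> Int (fun p => h p + g p) = Int h + Int g.
Proof. by move=> nh ng; apply: RintegralD => //; exact: nice_integrable. Qed.

Lemma IntZ c h : nice h -> Int (fun p => c * h p) = c * Int h.
Proof. by move=> nh; apply: RintegralZl => //; exact: nice_integrable. Qed.

Lemma IntB h g : nice h -> nice g -> Int (fun p => h p - g p) = Int h - Int g.
Proof. by move=> nh ng; apply: RintegralB => //; exact: nice_integrable. Qed.

Lemma le_Int h g : nice h -> nice g -> (forall p, h p <= g p) -> Int h <= Int g.
Proof.
by move=> nh ng hg; apply: le_Rintegral => //; exact: nice_integrable.
Qed.

Lemma Int_ge0 h : (forall p, 0 <= h p) -> 0 <= Int h.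
Proof. by move=> h0; exact: Rintegral_ge0. Qed.

Lemma Int_indic (A : set plane) : measurable A -> Int \1_A = fine (area A).
Proof. by move=> mA; rewrite /Int /Rintegral integral_indic// setIT. Qed.

Lemma Int_translation v h : nice h -> Int (fun p => h (p + v)) = Int h.
Proof.
move=> nh; have /nice_integrable ih := nice_translation v nh.
have mh := nh.1; congr fine.
have /esym -> := @integral_pushforward _ _ _ _ R _ (measurable_translation v)
  area setT (EFin \o h) (proj2 (measurable_EFinP _ _) mh) ih measurableT.
apply: eq_measure_integral => [|mv A mA _]; first exact: measurable_translation.
exact: (area_translation v mA).
Qed.

Definition null (N : set (R * R)) := measurable (N : set plane) /\ area N = 0%E.

Lemma nullU N M : null N -> null M -> null (N `|` M).
Proof.
move=> [mN N0] [mM M0]; split; first exact: measurableU.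
exact: null_set_setU.
Qed.

Lemma Int_ae_eq h g N : nice h -> nice g -> null N ->
  (forall p, ~ N p -> h p = g p) -> Int h = Int g.
Proof.
move=> nh ng [mN N0] hg; congr fine; apply: ae_eq_integral => //.
- by apply/measurable_EFinP; exact: (proj1 nh).
- by apply/measurable_EFinP; exact: (proj1 ng).
- exists N; split => // p /= hgp; apply: contrapT => Np; apply: hgp => _.
  by rewrite hg.
Qed.

Lemma Int_eq0 h : nice h -> (forall p, 0 <= h p) -> Int h = 0 ->
  exists2 N, null N & forall p, ~ N p -> h p = 0.
Proof.
move=> nh h0 Ih.
have ih := nice_integrable nh.
have : (\int[area]_p `|(h p)%:E| = 0)%E.
  under eq_integral do rewrite gee0_abs ?lee_fin ?h0//.
  have := integrable_fin_num measurableT ih.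
  by move=> /fineK <-; rewrite [X in X%:E]Ih.
move=> /(ae_eq_integral_abs area measurableT (proj2 (measurable_EFinP _ _) nh.1)).
case=> N [mN N0 sN]; exists N => // p Np.
apply: contrapT => hp; apply: Np; apply: sN => /= /(_ Logic.I) [].
exact: hp.
Qed.

Lemma Int_dominated (h_ : nat -> R * R -> R) h C N :
  (forall n, meas (h_ n)) -> (forall n, bounded_with C (h_ n)) -> nice h ->
  null N -> (forall p, ~ N p -> h_ ^~ p @ \oo --> h p) ->
  (fun n => Int (h_ n)) @ \oo --> Int h.
Proof.
move=> mh_ hC nh [mN N0] cvh.
have C0 : 0 <= C by rewrite (le_trans _ ((hC 0%N).1 0)).
pose A : set plane := `[- C, C]%classic `*` `[- C, C]%classic.
have mA : measurable A by apply: measurableX; exact: measurable_itv.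
have AC p : A p -> `|p : R * R| <= C.
  by case; rewrite /= !in_itv/= -!ler_norml norm_pairE ge_max => -> ->.
have nA := niceZ C (nice_indic mA AC).
have [] := @dominated_convergence _ _ R area setT measurableT
   (fun n => EFin \o h_ n) (EFin \o h) (EFin \o (fun p => C * \1_A p)).
- by move=> n; exact/measurable_EFinP.
- by apply/measurable_EFinP; exact: (proj1 nh).
- exists N; split => // p /= cp; apply: contrapT => Np; apply: cp => _.
  by apply: cvg_EFin; [exact: nearW|exact: cvh].
- exact: nice_integrable.
- apply: aeW => p n _ /=; rewrite lee_fin indicE.
  case: (boolP (p \in A)) => [_|pA]; first by rewrite mulr1 (hC n).1.
  rewrite mulr0 (hC n).2 ?normr0// norm_pairE ltNge; apply: contra pA.
  rewrite ge_max => /andP[]; rewrite !ler_norml => p1 p2.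
  by rewrite inE /A; split; rewrite /= in_itv.
- move=> ih _ /= cv.
  by apply: fine_cvg; rewrite fineK//; exact: integrable_fin_num.
Qed.

Import HBNNSimple.

(** The restriction of [k] to [A] may fail to be measurable. Its integral is still a supremum over
    simple functions: such a function, multiplied by the indicator of the complement of [N], keeps
    its integral and lies below any function that agrees with the given one off [N]. Positive and
    negative parts are compared in this way. *)
Lemma integral_null (A : set plane) (k : R * R -> R) h N : null N ->
  (forall p, ~ N p -> (k \_ A) p = h p) -> (\int[area]_(p in A) k p)%R = Int h.
Proof.
move=> [mN N0] kh.
rewrite Rintegral_mkcond; set g := k \_ A in kh *; rewrite /Int /Rintegral.
suff nnle (a b : R * R -> \bar R) : (forall p, 0 <= a p)%E ->
    (forall p, 0 <= b p)%E -> (forall p, ~ N p -> a p = b p) ->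
    (\int[area]_p a p <= \int[area]_p b p)%E.
  have nneq (a b : R * R -> \bar R) : (forall p, 0 <= a p)%E ->
      (forall p, 0 <= b p)%E -> (forall p, ~ N p -> a p = b p) ->
      (\int[area]_p a p = \int[area]_p b p)%E.
    by move=> a0 b0 ab; apply/eqP; rewrite eq_le !nnle// => p /ab.
  rewrite integralE [in RHS]integralE; congr (fine (_ - _)%E); apply: nneq => //.
  - by move=> p /kh; rewrite /= !funeposE /= => ->.
  - by move=> p /kh; rewrite /= !funenegE /= => ->.
move=> a0 b0 ab; rewrite !ge0_integralTE//.
apply: ge_ereal_sup => _ [s /= sa <-].
have mNC : measurable (~` N : set plane) by exact: measurableC.
pose s' : {nnsfun plane >-> R} := proj_nnsfun s mNC.
have s'E p : s' p = if p \in ~` N then s p else 0.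
  by rewrite /s' /= /proj_nnsfun/= mindicE; case: (p \in _); rewrite ?mulr1 ?mulr0.
apply: ereal_sup_ubound; exists s' => //.
  move=> p; rewrite [X in X%:E]s'E; case: ifPn => // /set_mem /= /ab <-; exact: sa.
rewrite -!integralT_nnsfun; apply: ge0_ae_eq_integral => //.
- exact/measurable_EFinP.
- exact/measurable_EFinP.
- by move=> p _; rewrite lee_fin.
- by move=> p _; rewrite lee_fin.
- exists N; split => // p /= ssp; apply: contrapT => Np; apply: ssp => _.
  by congr EFin; rewrite [LHS]s'E mem_set.
Qed.

End nice.

(** * Gauge of a convex set *)

Section geometry.
Variable R : realType.
Implicit Types (p q v w e : R * R) (A : set (R * R)) (u : R * R -> R).

Lemma convex_setP A p q (t : R) : convex_set A ->
  A p -> A q -> 0 <= t <= 1 -> A (t *: p + (1 - t) *: q).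
Proof.
move=> cA Ap Aq /andP[t0 t1].
by have := cA p q (Itv01 t0 t1); rewrite !inE => /(_ Ap Aq).
Qed.

Lemma convex_functionP A u : convex_function A u <->
  forall p q (t : R), A p -> A q -> 0 <= t <= 1 ->
    u (t *: p + (1 - t) *: q) <= t * u p + (1 - t) * u q.
Proof.
split=> [cu p q t Ap Aq /andP[t0 t1]|h t p q /set_mem Ap /set_mem Aq].
  by have := cu (Itv01 t0 t1) p q; rewrite !inE => /(_ Ap Aq).
by apply: h => //; apply/andP; split.
Qed.

Lemma vecP p q : p.1 = q.1 -> p.2 = q.2 -> p = q.
Proof. by case: p q => [? ?] [? ?] /= -> ->. Qed.

Lemma fstDE p q : (p + q).1 = p.1 + q.1. Proof. by []. Qed.
Lemma sndDE p q : (p + q).2 = p.2 + q.2. Proof. by []. Qed.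
Lemma fstNE p : (- p).1 = - p.1. Proof. by []. Qed.
Lemma sndNE p : (- p).2 = - p.2. Proof. by []. Qed.
Lemma fstZE (c : R) p : (c *: p).1 = c * p.1. Proof. by []. Qed.
Lemma sndZE (c : R) p : (c *: p).2 = c * p.2. Proof. by []. Qed.
Definition vecE := (fstDE, sndDE, fstNE, sndNE, fstZE, sndZE).

Section gauge.
Variables (A : set (R * R)) (q0 : R * R).

(** The Minkowski functional of [A] seen from [q0]. It encodes interior, closure and boundary of [A]
    as the sets where it is less than 1, at most 1 and equal to 1, and it also supplies the test
    functions. *)
Definition gauge v : R := inf [set s | 0 < s /\ A (q0 + s^-1 *: v)].

Variables (r : R) (r0 : 0 < r) (cA : convex_set A).
Hypothesis ballA : forall p, `|p - q0| < r -> A p.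

Lemma gauge_far v (s : R) : `|v| / r < s -> 0 < s /\ A (q0 + s^-1 *: v).
Proof.
move=> vs; have s0 : 0 < s by rewrite (le_lt_trans _ vs)// divr_ge0// ltW.
split => //; apply: ballA; rewrite addrAC subrr add0r normrZ gtr0_norm ?invr_gt0//.
by rewrite mulrC ltr_pdivrMr// mulrC -ltr_pdivrMr.
Qed.

Lemma gauge_has_inf v : has_inf [set s | 0 < s /\ A (q0 + s^-1 *: v)].
Proof.
split; last by exists 0 => s [/ltW].
by exists (`|v| / r + 1); apply: gauge_far; rewrite ltrDl.
Qed.

Lemma gauge_ge0 v : 0 <= gauge v.
Proof. by apply: lb_le_inf (gauge_has_inf v).1 _ => s [/ltW]. Qed.

Lemma gauge_le v (s : R) : 0 < s -> A (q0 + s^-1 *: v) -> gauge v <= s.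
Proof. by move=> s0 As; apply: ge_inf; [case: (gauge_has_inf v)|]. Qed.

Lemma mem_q0 : A q0. Proof. by apply: ballA; rewrite subrr normr0. Qed.

Lemma gauge_lt v (s : R) : gauge v < s -> A (q0 + s^-1 *: v).
Proof.
move=> /(inf_lt (gauge_has_inf v).1)[s' /= [s'0 As'] s's].
have s0 := lt_trans s'0 s's.
have -> : q0 + s^-1 *: v = (s' / s) *: (q0 + s'^-1 *: v) + (1 - s' / s) *: q0.
  by apply: vecP; rewrite !vecE; field; rewrite ?gt_eqF.
apply: convex_setP => //; first exact: mem_q0.
by rewrite divr_ge0 ?(ltW s'0) ?(ltW s0)//= ler_pdivrMr// mul1r ltW.
Qed.

Lemma gauge_le_norm v : gauge v <= `|v| / r.
Proof.
apply/ler_addgt0Pr => e e0; have [] := @gauge_far v (`|v| / r + e).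
  by rewrite ltrDl.
exact: gauge_le.
Qed.

Lemma gauge0 : gauge 0 = 0.
Proof.
apply/eqP; rewrite eq_le gauge_ge0 andbT.
by rewrite (le_trans (gauge_le_norm _))// normr0 mul0r.
Qed.

Lemma gaugeZ (t : R) v : 0 <= t -> gauge (t *: v) = t * gauge v.
Proof.
rewrite le_eqVlt => /predU1P[<-|t0]; first by rewrite scale0r gauge0 mul0r.
suff le_gZ (c : R) w : 0 < c -> gauge (c *: w) <= c * gauge w.
  apply/eqP; rewrite eq_le le_gZ//= -ler_pdivlMl//.
  rewrite -{1}(scalerK (lt0r_neq0 t0) v).
  by apply: le_gZ; rewrite invr_gt0.
move=> c0; rewrite -ler_pdivrMl//; apply: lb_le_inf (gauge_has_inf w).1 _.
move=> s [s0 As]; rewrite ler_pdivrMl//; apply: gauge_le; first exact: mulr_gt0.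
by rewrite scalerA invfM mulrC mulrA divff ?gt_eqF// mul1r.
Qed.

Lemma gaugeD v w : gauge (v + w) <= gauge v + gauge w.
Proof.
apply/ler_addgt0Pr => e e0.
have v_s : gauge v < gauge v + e / 2 by rewrite ltrDl divr_gt0.
have w_s : gauge w < gauge w + e / 2 by rewrite ltrDl divr_gt0.
rewrite (_ : _ + e = (gauge v + e / 2) + (gauge w + e / 2)); last by field.
move: (gauge_lt v_s) (gauge_lt w_s).
have := le_lt_trans (gauge_ge0 v) v_s; have := le_lt_trans (gauge_ge0 w) w_s.
set s := gauge v + _; set s' := gauge w + _ => s'0 s0 As As'.
clearbody s s'.
apply: gauge_le; first exact: addr_gt0.
have ss' : s + s' != 0 by rewrite gt_eqF// addr_gt0.
have -> : q0 + (s + s')^-1 *: (v + w) =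
    (s / (s + s')) *: (q0 + s^-1 *: v) + (1 - s / (s + s')) *: (q0 + s'^-1 *: w).
  by apply: vecP; rewrite !vecE; field; rewrite ?gt_eqF ?addr_gt0.
apply: convex_setP => //; rewrite divr_ge0 ?addr_ge0 ?(ltW s0) ?(ltW s'0)//=.
by rewrite ler_pdivrMr ?addr_gt0// mul1r lerDl ltW.
Qed.

Lemma gauge_lip v w : `|gauge v - gauge w| <= `|v - w| / r.
Proof.
suff le_g a b : gauge a - gauge b <= `|a - b| / r.
  by rewrite ler_norml le_g andbT lerNl opprB distrC le_g.
rewrite lerBlDr (le_trans _ (lerD (gauge_le_norm _) (lexx _)))//.
by rewrite (le_trans _ (gaugeD _ _))// subrK.
Qed.

Lemma gauge_convex v w (t : R) : 0 <= t <= 1 ->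
  gauge (t *: v + (1 - t) *: w) <= t * gauge v + (1 - t) * gauge w.
Proof.
move=> /andP[t0 t1]; rewrite (le_trans (gaugeD _ _))// !gaugeZ//.
by rewrite subr_ge0.
Qed.

Lemma gauge_continuous : continuous gauge.
Proof.
move=> v; apply/cvgrPdist_lt => e e0.
have er0 : 0 < e * r by exact: mulr_gt0.
apply: filterS (nbhsx_ballx v _ er0) => w; rewrite -ball_normE /= => vw.
by rewrite (le_lt_trans (gauge_lip _ _))// ltr_pdivrMr.
Qed.

Lemma gauge_continuous_subr p : continuous (fun z : R * R => gauge (z - p)).
Proof.
move=> z; apply: (@continuous_comp _ _ _ (fun z : R * R => z - p) gauge).
  by apply: cvgB; [exact: cvg_id|exact: cvg_cst].
exact: gauge_continuous.
Qed.

Lemma gauge_mem p : A p -> gauge (p - q0) <= 1.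
Proof. by move=> Ap; apply: gauge_le => //; rewrite invr1 scale1r addrC subrK. Qed.

Lemma interior_gauge : A° = [set p | gauge (p - q0) < 1].
Proof.
have openg : open [set p | gauge (p - q0) < 1].
  apply: (@open_comp _ _ (fun p => gauge (p - q0)) [set x | x < 1]).
    by move=> p _; exact: gauge_continuous_subr.
  exact: open_lt.
apply/seteqP; split => [p|p /= gp]; last first.
  have : nbhs p [set p | gauge (p - q0) < 1] by exact: open_nbhs_nbhs.
  apply: filterS => z /= /gauge_lt; by rewrite invr1 scale1r addrC subrK.
move=> /nbhs_ballP[d /= d0 dA].
pose k := `|p - q0| + 1; have k0 : 0 < k by rewrite ltr_wpDl.
pose c := d / (2 * k); have c0 : 0 < c by rewrite divr_gt0// mulr_gt0.
(* If the point pushed away from [q0] by the factor 1 + c is still in [A], the gauge at [p - q0] is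
   at most 1/(1+c) < 1; [c] is small enough for the pushed point to stay in the ball around [p]. *)
suff Ac : A (q0 + (1 + c) *: (p - q0)).
  rewrite /= (@le_lt_trans _ _ (1 + c)^-1)//.
    by apply: gauge_le; rewrite ?invrK// invr_gt0 addr_gt0.
  by rewrite invf_lt1 ?addr_gt0// ltrDl.
apply: dA; rewrite -ball_normE /=.
rewrite (_ : _ - _ = (- c) *: (p - q0)); last by apply: vecP; rewrite !vecE; ring.
rewrite normrZ normrN gtr0_norm// (@le_lt_trans _ _ (c * k))//.
  by rewrite ler_pM2l// lerDl.
rewrite (_ : c * k = d / 2); last by rewrite /c; field; rewrite gt_eqF.
by rewrite ltr_pdivrMr// ltr_pMr// ltr1n.
Qed.

Lemma closure_gauge : closure A = [set p | gauge (p - q0) <= 1].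
Proof.
have closedg : closed [set p | gauge (p - q0) <= 1].
  apply: (@closed_comp _ _ (fun p => gauge (p - q0)) [set x | x <= 1]).
    by move=> p _; exact: gauge_continuous_subr.
  exact: closed_le.
apply/seteqP; split => [p|p /= gp].
  by move=> /(closure_subset gauge_mem); rewrite -(proj1 (closure_id _) closedg).
move=> B /nbhs_ballP[d /= d0 dB].
pose k := `|p - q0| + 1; have k0 : 0 < k by rewrite ltr_wpDl.
pose c := Num.min 1 (d / (2 * k)).
have c0 : 0 < c by rewrite lt_min ltr01 divr_gt0// mulr_gt0.
have c1 : c <= 1 by rewrite ge_min lexx.
exists (q0 + (1 - c) *: (p - q0)); split.
  rewrite -[_ *: _]scale1r -[X in X *: _]invr1; apply: gauge_lt.
  rewrite gaugeZ ?subr_ge0//; have := gauge_ge0 (p - q0); nra.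
apply: dB; rewrite -ball_normE /=.
rewrite (_ : _ - _ = c *: (p - q0)); last by apply: vecP; rewrite !vecE; ring.
rewrite normrZ gtr0_norm// (@le_lt_trans _ _ (c * k))//.
  by rewrite ler_pM2l// lerDl.
rewrite (@le_lt_trans _ _ (d / (2 * k) * k))//.
  by rewrite ler_pM2r// ge_min lexx orbT.
rewrite invfM mulrA divfK ?gt_eqF//.
by rewrite ltr_pdivrMr// ltr_pMr// ltr1n.
Qed.

Lemma boundary_gauge : boundary A = [set p | gauge (p - q0) = 1].
Proof.
rewrite /boundary closure_gauge interior_gauge.
apply/seteqP; split => p /=; last by move=> ->; rewrite ltxx; split.
by move=> [g1 /negP]; rewrite -leNgt => g1'; apply/eqP; rewrite eq_le g1.
Qed.

(* One-step Hahn-Banach: the functional with value 1 at v is extended to the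
   plane by choosing its value c at a vector w independent of v. *)
Lemma gauge_support v : gauge v = 1 ->
  exists2 n, dot n v = 1 & forall w, dot n w <= gauge w.
Proof.
move=> gv.
have v0 : dot v v != 0.
  apply: contraTN isT => /eqP v0; suff v0' : v = 0.
    by move: gv; rewrite v0' gauge0 => /esym/eqP; rewrite oner_eq0.
  by apply: vecP => /=; move: v0; rewrite /dot; nra.
pose w : R * R := (- v.2, v.1).
pose S := [set t - gauge (t *: v - w) | t in [set: R]].
(* The value [c] at [w] has to satisfy [t - gauge (t *: v - w) <= c <= gauge (s *: v + w) - s] for
   all [s] and [t]. By subadditivity each lower bound is below each upper bound, so the supremum of
   the lower bounds will do. *)
have ubS (s : R) : ubound S (gauge (s *: v + w) - s).
  move=> _ [t _ <-]; rewrite lerBlDr.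
  have [st|st] := leP (s + t) 0.
    have := gauge_ge0 (s *: v + w); have := gauge_ge0 (t *: v - w); lra.
  have : gauge ((s + t) *: v) = s + t by rewrite gaugeZ ?gv ?mulr1// ltW.
  have : gauge ((s + t) *: v) <= gauge (s *: v + w) + gauge (t *: v - w).
    rewrite (le_trans _ (gaugeD _ _))// le_eqVlt; apply/orP; left; apply/eqP.
    by congr gauge; apply: vecP; rewrite !vecE; ring.
  lra.
have S0 : S !=set0 by exists (0 - gauge (0 *: v - w)), 0.
pose c := sup S.
have c_le s : c <= gauge (s *: v + w) - s by exact: ge_sup.
have le_c t : t - gauge (t *: v - w) <= c.
  by apply: ub_le_sup; [exists (gauge (0 *: v + w) - 0)|exists t].
clearbody c.
(* This is (v + c w)/|v|^2. As [w] is orthogonal to [v] and of the same length, its products with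
   [v] and [w] are 1 and [c]. *)
pose n : R * R := ((v.1 - c * v.2) / dot v v, (v.2 + c * v.1) / dot v v).
exists n; first by rewrite /n /dot /=; field; exact: v0.
move=> z; pose x := dot v z / dot v v; pose y := dot w z / dot v v.
have zE : z = x *: v + y *: w.
  by apply: vecP; rewrite !vecE /x /y /w /dot /=; field; exact: v0.
have nz : dot n z = x + c * y by rewrite /x /y /n /w /dot /=; field; exact: v0.
rewrite nz {1}zE.
have [y0|y0|y0] := ltgtP y 0.
- have -> : x *: v + y *: w = (- y) *: ((x / - y) *: v - w).
    by apply: vecP; rewrite !vecE; field; rewrite lt_eqF.
  have y0' : 0 < - y by rewrite oppr_gt0.
  rewrite gaugeZ; last exact: ltW.
  have := le_c (x / - y); rewrite lerBlDr -(ler_pM2l y0').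
  rewrite mulrDr mulrCA divff ?gt_eqF//; lra.
- have -> : x *: v + y *: w = y *: ((x / y) *: v + w).
    by apply: vecP; rewrite !vecE; field; rewrite gt_eqF.
  rewrite gaugeZ; last exact: ltW.
  have := c_le (x / y); rewrite lerBrDr -(ler_pM2l y0).
  rewrite mulrDr mulrCA divff ?gt_eqF//; lra.
- rewrite y0 mulr0 scale0r !addr0.
  have [x0|x0] := leP 0 x; first by rewrite gaugeZ// gv mulr1.
  by rewrite (le_trans (ltW x0))// gauge_ge0.
Qed.
End gauge.
End geometry.

(** * The boundary of a convex set has area zero *)

Section boundary_null.
Variable R : realType.
Implicit Types (p q v w e : R * R) (A : set (R * R)) (u : R * R -> R).
Local Notation mu := (@lebesgue_measure R).
Local Notation area := (mu \x mu)%E.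
Local Notation plane := (measurableTypeR R * measurableTypeR R)%type.

Lemma null_subset1 (X : set (measurableTypeR R)) : (forall x y, X x -> X y -> x = y) ->
  measurable X /\ mu X = 0%E.
Proof.
move=> X1; have [->|/set0P[x Xx]] := eqVneq X set0; first by rewrite measure0.
have -> : X = [set x] by apply/seteqP; split => [y /X1|y ->]//; exact.
by split; [exact: measurable_set1|exact: lebesgue_measure_set1].
Qed.

(** The quotient lies in ]0, 1[ exactly when [x] is strictly between [x0] and [y]. So [X] has at
    most one point on each side of [x0]. *)
Lemma null_one_per_side (X : set (measurableTypeR R)) (x0 : R) : ~ X x0 ->
  (forall x y : R, (0 < (x - x0) / (y - x0) < 1) -> X x -> X y -> False) ->
  measurable X /\ mu X = 0%E.
Proof.
move=> X0 Xxy.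
pose X1 : set (measurableTypeR R) := X `&` [set x : R | x0 < x].
pose X2 : set (measurableTypeR R) := X `&` [set x : R | x < x0].
have -> : X = X1 `|` X2.
  apply/seteqP; split => [x Xx|x [[]|[]]//].
  by have [xx0|xx0|xx0] := ltgtP x0 x; [left|right|subst x].
have [mX1 X10] : measurable X1 /\ mu X1 = 0%E.
  apply: null_subset1 => x y [Xx /= x0x] [Xy /= x0y].
  have [xy|xy|//] := ltgtP x y; exfalso.
    apply: (Xxy x y) => //; rewrite divr_gt0 ?subr_gt0//=.
    by rewrite ltr_pdivrMr ?subr_gt0// mul1r ltrD2r.
  apply: (Xxy y x) => //; rewrite divr_gt0 ?subr_gt0//=.
  by rewrite ltr_pdivrMr ?subr_gt0// mul1r ltrD2r.
have [mX2 X20] : measurable X2 /\ mu X2 = 0%E.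
  apply: null_subset1 => x y [Xx /= x0x] [Xy /= x0y].
  have Nd a b : (a - x0) / (b - x0) = (x0 - a) / (x0 - b).
    by rewrite -(opprB x0 a) -(opprB x0 b) invrN mulrNN.
  have [xy|xy|//] := ltgtP x y; exfalso.
    apply: (Xxy y x) => //; rewrite Nd divr_gt0 ?subr_gt0//=.
    by rewrite ltr_pdivrMr ?subr_gt0// mul1r ltrD2l ltrN2.
  apply: (Xxy x y) => //; rewrite Nd divr_gt0 ?subr_gt0//=.
  by rewrite ltr_pdivrMr ?subr_gt0// mul1r ltrD2l ltrN2.
by split; [exact: measurableU|rewrite null_set_setU].
Qed.

(** By Fubini on vertical sections. If the vertical line over x meets the interior, convexity of the
    gauge leaves at most one boundary point on each side of an interior one. The set [X] collects
    the vertical lines that touch the closure without entering the interior; again by convexity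
    there is at most one of them on each side of [q0]. Every other line misses the boundary. *)
Lemma boundary_null A : convex_set A -> A° !=set0 -> null (boundary A).
Proof.
move=> cA [q0 /nbhs_ballP[r /= r0 rA]].
have ballA p : `|p - q0| < r -> A p.
  by move=> pr; apply: rA; rewrite -ball_normE /= distrC.
have phic := gauge_convex r0 cA ballA.
have phi0 : gauge A q0 (q0 - q0) = 0 by rewrite subrr (gauge0 r0 ballA).
have bE := boundary_gauge r0 cA ballA.
have mB : measurable (boundary A : set plane).
  apply: measurableD; last by apply: open_measurable_plane; exact: open_interior.
  rewrite -[closure A]setCK; apply: measurableC; apply: open_measurable_plane.
  by apply: closed_openC; exact: closed_closure.
split=> //; rewrite bE in mB *; set B := (X in area X).
set phi := fun p => gauge A q0 (p - q0).
have phi_lt p z (t : R) : 0 < t < 1 -> phi p <= 1 -> phi z < 1 ->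
    phi (t *: p + (1 - t) *: z) < 1.
  move=> t01 p1 z1; rewrite /phi.
  rewrite (_ : _ - _ = t *: (p - q0) + (1 - t) *: (z - q0)); last first.
    by apply: vecP; rewrite !vecE; ring.
  apply: (le_lt_trans (phic _ _ t _)); first by case/andP: t01 => *; rewrite !ltW.
  by move: p1 z1; rewrite -/(phi p) -/(phi z); nra.
pose X : set (measurableTypeR R) :=
  [set x | (exists y, phi (x, y) <= 1) /\ forall y, 1 <= phi (x, y)].
have [mX X0] : measurable X /\ mu X = 0%E.
  apply: (@null_one_per_side _ q0.1) => [[_ /(_ q0.2)]|x x' t01 [_ Xx] [[y' y'1] _]].
    by rewrite -surjective_pairing /phi phi0; lra.
  set t := _ / _ in t01.
  have := phi_lt (x', y') q0 t t01 y'1; rewrite {1}/phi phi0 => /(_ ltr01).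
  rewrite (_ : _ + _ = (x, t * y' + (1 - t) * q0.2)); last first.
    apply: vecP; rewrite !vecE //= /t.
    have : x' - q0.1 != 0.
      by apply: contraTneq t01; rewrite /t => ->; rewrite invr0 mulr0 ltxx.
    by move=> ?; field.
  by rewrite ltNge Xx.
have secB x : ~ X x -> mu (xsection B x) = 0%E.
  move=> nX; have [[y0 y01]|/forallNP hy] := pselect (exists y, phi (x, y) < 1).
    apply: (proj2 (@null_one_per_side _ y0 _ _)) => [|y y' t01].
      by rewrite /xsection /= inE /B /= -/(phi _); lra.
    rewrite /xsection /= !inE /B /= -!/(phi _) => y1 y'1.
    set t := _ / _ in t01.
    have := phi_lt (x, y') (x, y0) t t01; rewrite y'1 => /(_ (lexx _) y01).
    rewrite (_ : _ + _ = (x, y)) ?y1 ?ltxx//.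
    have : y' - y0 != 0.
      by apply: contraTneq t01; rewrite /t => ->; rewrite invr0 mulr0 ltxx.
    by move=> ?; apply: vecP; rewrite !vecE /= ?/t; [ring|field].
  rewrite (_ : xsection B x = set0) ?measure0//.
  apply/seteqP; split => // y; rewrite /xsection /= inE /B /= -/(phi _) => y1.
  apply: nX; split; first by exists y; rewrite y1.
  by move=> z; rewrite leNgt; apply/negP; exact: hy.
rewrite /= /product_measure1.
transitivity (\int[mu]_x (cst 0 x : \bar R))%E; last by rewrite integral0.
apply: ge0_ae_eq_integral => //.
- exact: measurable_fun_xsection.
- exists X; split => // x /= hx; apply: contrapT => /secB sx; apply: hx => _.
  exact: sx.
Qed.

End boundary_null.

(** * Concave functions *)

Section concave.
Variable R : realType.
Implicit Types (p q v w e g h : R * R) (S : set (R * R)) (u : R * R -> R).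

Definition concave_on S u := forall p q (t : R), S p -> S q -> 0 <= t <= 1 ->
  t * u p + (1 - t) * u q <= u (t *: p + (1 - t) *: q).

(** For concave [u] the difference quotients grow as [t] decreases to 0, so this supremum is the
    one-sided derivative. *)
Definition rder S u p e : R :=
  sup [set (u (p + t *: e) - u p) / t | t in [set t | 0 < t /\ S (p + t *: e)]].

Definition diff_eps u p g := forall eps : R, 0 < eps ->
  exists2 d, 0 < d & forall h, `|h| < d -> `|u (p + h) - u p - dot g h| <= eps * `|h|.

Lemma open_segment S p e : open S -> S p ->
  exists2 d : R, 0 < d & forall t, `|t| < d -> S (p + t *: e).
Proof.
move=> oS Sp; have /nbhs_ballP[r /= r0 rS] : nbhs p S by exact: open_nbhs_nbhs.
exists (r / (`|e| + 1)); first by rewrite divr_gt0// ltr_wpDl.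
move=> t; rewrite ltr_pdivlMr ?ltr_wpDl// => tr; apply: rS; rewrite -ball_normE /=.
rewrite opprD addrA subrr add0r normrN normrZ (le_lt_trans _ tr)//.
by rewrite ler_wpM2l// lerDl.
Qed.

Lemma slope_mono S u p e (s t : R) : concave_on S u -> S p -> S (p + t *: e) ->
  0 < s <= t -> (u (p + t *: e) - u p) / t <= (u (p + s *: e) - u p) / s.
Proof.
move=> cu Sp St /andP[s0 st]; have t0 := lt_le_trans s0 st.
have st01 : 0 <= s / t <= 1 by rewrite divr_ge0 ?(ltW s0) ?(ltW t0)//= ler_pdivrMr// mul1r.
have := cu _ _ _ St Sp st01.
rewrite (_ : _ *: _ + _ = p + s *: e); last first.
  by apply: vecP; rewrite !vecE; field; rewrite gt_eqF.
move=> h; rewrite ler_pdivlMr// -(lerD2r (u p)) subrK; apply: le_trans h.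
by rewrite le_eqVlt; apply/orP; left; apply/eqP; field; rewrite gt_eqF.
Qed.

(** A backward slope dominates all forward ones. This makes the supremum in [rder] finite and orders
    the two one-sided derivatives. *)
Lemma slope_back S u p e (s t : R) : concave_on S u -> S (p + t *: e) ->
  S (p - s *: e) -> 0 < s -> 0 < t ->
  (u (p + t *: e) - u p) / t <= (u p - u (p - s *: e)) / s.
Proof.
move=> cu St Ss s0 t0; have st0 : 0 < s + t by exact: addr_gt0.
have st01 : 0 <= s / (s + t) <= 1.
  by rewrite divr_ge0 ?(ltW s0) ?(ltW st0)//= ler_pdivrMr// mul1r lerDl ltW.
have := cu _ _ _ St Ss st01.
rewrite (_ : _ *: _ + _ = p); last first.
  by apply: vecP; rewrite !vecE; field; rewrite gt_eqF.
move: (u p) (u (p + _)) (u (p - _)) => x y z h.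
rewrite ler_pdivrMr// mulrAC ler_pdivlMr//.
move: h; rewrite -(ler_pM2l st0).
rewrite (_ : _ * (_ + _) = s * y + t * z); last by field; rewrite gt_eqF.
lra.
Qed.

Lemma rder_has_sup S u p e : open S -> concave_on S u -> S p ->
  has_sup [set (u (p + t *: e) - u p) / t | t in [set t | 0 < t /\ S (p + t *: e)]].
Proof.
move=> oS cu Sp; have [d d0 dS] := open_segment e oS Sp.
have d2 : `|d / 2| < d by rewrite gtr0_norm ?divr_gt0// ltr_pdivrMr// ltr_pMr// ltr1n.
split; first by eexists; exists (d / 2) => //; split; [exact: divr_gt0|exact: dS].
exists ((u p - u (p - (d / 2) *: e)) / (d / 2)) => _ [t [t0 St] <-].
apply: slope_back cu _ _ _ _ => //; last exact: divr_gt0.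
by rewrite -scaleNr; apply: dS; rewrite normrN.
Qed.

Lemma rder_ge S u p e (t : R) : open S -> concave_on S u -> S p -> 0 < t ->
  S (p + t *: e) -> u (p + t *: e) - u p <= t * rder S u p e.
Proof.
move=> oS cu Sp t0 St; rewrite mulrC -ler_pdivrMr//.
by apply: ub_le_sup; [exact: (rder_has_sup e oS cu Sp).2|exists t].
Qed.

Lemma rder_eps S u p e (eps : R) : open S -> concave_on S u -> S p -> 0 < eps ->
  exists2 d, 0 < d & forall t, 0 < t < d -> S (p + t *: e) /\
    t * rder S u p e - eps * t <= u (p + t *: e) - u p <= t * rder S u p e.
Proof.
move=> oS cu Sp eps0; have hs := rder_has_sup e oS cu Sp.
have [_ [d /= [d0 Sd] <-] hd] := sup_adherent eps0 hs.
have [d' d'0 d'S] := open_segment e oS Sp.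
exists (Num.min d d'); first by rewrite lt_min d0.
move=> t /andP[t0]; rewrite lt_min => /andP[td td'].
have St : S (p + t *: e) by apply: d'S; rewrite gtr0_norm.
split=> //; rewrite rder_ge// andbT.
have td01 : 0 < t <= d by rewrite t0 ltW.
have := slope_mono cu Sp Sd td01; rewrite ler_pdivlMr// => /(le_trans _); apply.
rewrite (_ : _ - _ = (rder S u p e - eps) * t); last by ring.
by rewrite ler_pM2r// ltW.
Qed.

Lemma rder_le_opp S u p e : open S -> concave_on S u -> S p ->
  rder S u p e <= - rder S u p (- e).
Proof.
move=> oS cu Sp; rewrite lerNr; apply: ge_sup; first exact: (rder_has_sup (- e) oS cu Sp).1.
move=> _ [t [t0 St] <-]; rewrite lerNr; apply: ge_sup.
  exact: (rder_has_sup e oS cu Sp).1.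
move=> _ [s [s0 Ss] <-]; rewrite scalerN in St *.
by apply: le_trans (slope_back cu Ss St t0 s0) _; rewrite -mulNr opprB.
Qed.

Lemma rder_two_sided S u p e (eps : R) : open S -> concave_on S u -> S p ->
  rder S u p (- e) = - rder S u p e -> 0 < eps ->
  exists2 d, 0 < d & forall t, `|t| < d ->
    `|u (p + t *: e) - u p - t * rder S u p e| <= eps * `|t|.
Proof.
move=> oS cu Sp eE eps0; have [d d0 hd] := rder_eps e oS cu Sp eps0.
have [d' d'0 hd'] := rder_eps (- e) oS cu Sp eps0.
exists (Num.min d d'); first by rewrite lt_min d0.
move=> t; rewrite lt_min => /andP[td td'].
have [t0|t0|->] := ltgtP t 0; last by rewrite scale0r addr0 subrr mul0r subrr normr0 mulr0.
  rewrite ltr0_norm// in td' *.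
  have [|_] := hd' (- t); first by rewrite oppr_gt0 t0.
  by rewrite eE scalerN scaleNr opprK ler_norml; lra.
rewrite gtr0_norm// in td *.
have [|_] := hd t; first by rewrite t0.
by rewrite ler_norml; lra.
Qed.

Lemma ler_norm_fst h : `|h.1| <= `|h|. Proof. by rewrite le_max lexx. Qed.
Lemma ler_norm_snd h : `|h.2| <= `|h|. Proof. by rewrite le_max lexx orbT. Qed.

(** Derivatives along the two axes suffice for a concave function. From below: [p + h] is the
    midpoint of the points p + (2 h_1, 0) and p + (0, 2 h_2). From above: [p] is the midpoint of
    [p + h] and [p - h], so the error at [h] is at most minus the error at [- h], which has just
    been bounded below. *)
Lemma concave_diff_eps S u p (a b : R) : open S -> concave_on S u -> S p ->
  (forall eps, 0 < eps -> exists2 d, 0 < d & forall t, `|t| < d ->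
    `|u (p + t *: dirx R) - u p - t * a| <= eps * `|t|) ->
  (forall eps, 0 < eps -> exists2 d, 0 < d & forall t, `|t| < d ->
    `|u (p + t *: diry R) - u p - t * b| <= eps * `|t|) ->
  diff_eps u p (a, b).
Proof.
move=> oS cu Sp ha hb eps eps0.
have eps2 : 0 < eps / 2 by exact: divr_gt0.
have [d1 d10 hd1] := ha _ eps2; have [d2 d20 hd2] := hb _ eps2.
have /nbhs_ballP[r /= r0 rS] : nbhs p S by exact: open_nbhs_nbhs.
have rS' h : `|h| < r -> S (p + h).
  by move=> hr; apply: rS; rewrite -ball_normE /= opprD addrA subrr add0r normrN.
pose d := Num.min (r / 2) (Num.min (d1 / 2) (d2 / 2)).
exists d; first by rewrite !lt_min !divr_gt0.
pose V h := u (p + h) - u p - dot (a, b) h.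
have lowerV h : `|h| < d -> - (eps * `|h|) <= V h.
  rewrite !lt_min => /and3P[hr h1 h2].
  have n1 := ler_norm_fst h; have n2 := ler_norm_snd h.
  have S1 : S (p + (2 * h.1) *: dirx R).
    apply: rS'; rewrite (_ : _ *: _ = (2 * h.1, 0)).
      by rewrite norm_pairE /= normr0 max_l// normrM ger0_norm//; lra.
    by apply: vecP; rewrite !vecE /=; ring.
  have S2 : S (p + (2 * h.2) *: diry R).
    apply: rS'; rewrite (_ : _ *: _ = (0, 2 * h.2)).
      by rewrite norm_pairE /= normr0 max_r// normrM ger0_norm//; lra.
    by apply: vecP; rewrite !vecE /=; ring.
  have half : 0 <= (1 / 2 : R) <= 1 by lra.
  have := cu _ _ _ S1 S2 half.
  rewrite (_ : _ *: _ + _ *: _ = p + h); last first.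
    by apply: vecP; rewrite !vecE /=; field.
  have := hd1 (2 * h.1); have := hd2 (2 * h.2).
  rewrite !normrM ger0_norm// !ler_norml => /(_ _)/andP[|+ _]; first by lra.
  move=> k2 /(_ _)/andP[|k1 _]; first by lra.
  by rewrite /V /dot /=; nra.
move=> h hd; rewrite ler_norml lowerV//=.
have hNd : `|- h| < d by rewrite normrN.
have hr : `|h| < r by move: hd; rewrite lt_min => /andP[]; lra.
have half : 0 <= (1 / 2 : R) <= 1 by lra.
have hNr : `|- h| < r by rewrite normrN.
have := cu _ _ _ (rS' _ hr) (rS' _ hNr) half.
rewrite (_ : _ *: _ + _ *: _ = p); last by apply: vecP; rewrite !vecE /=; field.
by have := lowerV _ hNd; rewrite normrN /V /dot /=; lra.
Qed.

Lemma diff_epsP u p g : diff_eps u p g ->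
  differentiable u p /\ forall e, is_derive p e u (dot g e).
Proof.
move=> hg.
pose L v : R := dot g v.
have linL : linear L by move=> c v w; rewrite /L /dot !vecE /=; rewrite -[c *: _]/(c * _); ring.
pose LM := GRing.isLinear.Build R (R * R)%type R _ L linL.
pose L' : {linear (R * R)%type -> R} := HB.pack L LM.
have cL : continuous L'.
  move=> v; rewrite /L' /= /L /dot; apply: cvgD; apply: cvgMr.
    exact: cvg_fst.
  exact: cvg_snd.
have dE : u \o shift p = cst (u p) + L' +o_ (0 : R * R) id.
  apply/eqaddoP => eps eps0; have [d d0 hd] := hg _ eps0.
  have := nbhsx_ballx (0 : R * R) _ d0; apply: filterS => h.
  rewrite -ball_normE /= sub0r normrN => /hd.
  by rewrite [p + h]addrC -addrA -opprD.
have du : differentiable u p.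
  by apply/diff_locallyP; rewrite (diff_unique cL dE).
split=> // e.
have h := @deriveE _ _ _ u p e du; rewrite (diff_unique cL dE) in h.
 apply: DeriveDef; [exact: diff_derivable|exact: h].
Qed.

End concave.

(** * Convex bodies, supporting functionals and the Lipschitz bound *)

Section body.
Variable R : realType.
Implicit Types (p q v w e g h : R * R) (A S : set (R * R)) (u : R * R -> R).

Lemma interior_ball A p : A° p -> exists2 r : R, 0 < r & forall q, `|q - p| < r -> A q.
Proof.
move=> /nbhs_ballP[r /= r0 rA]; exists r => // q qr.
by apply: rA; rewrite -ball_normE /= distrC.
Qed.

Lemma interior_ball_interior A p : A° p ->
  exists2 r : R, 0 < r & forall q, `|q - p| < r -> A° q.
Proof.
move=> Ap; have : nbhs p A° by apply: open_nbhs_nbhs; split => //; exact: open_interior.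
move=> /nbhs_ballP[r /= r0 rA]; exists r => // q qr.
by apply: rA; rewrite -ball_normE /= distrC.
Qed.

Lemma interior_closure_subset A : A° `<=` closure A.
Proof. by move=> p /interior_subset; exact: subset_closure. Qed.

Lemma closure_convex A p q (t : R) : convex_set A -> A° !=set0 ->
  closure A p -> closure A q -> 0 <= t <= 1 -> closure A (t *: p + (1 - t) *: q).
Proof.
move=> cA [q0 /interior_ball[r r0 rA]]; rewrite (closure_gauge r0 cA rA) /= => p1 q1 t01.
rewrite (_ : _ - q0 = t *: (p - q0) + (1 - t) *: (q - q0)); last first.
  by apply: vecP; rewrite !vecE; ring.
by rewrite (le_trans (gauge_convex r0 cA rA _ _ t01))//; nra.
Qed.

Lemma closure_interior_convex A p q (t : R) : convex_set A ->
  closure A p -> A° q -> 0 <= t < 1 -> A° (t *: p + (1 - t) *: q).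
Proof.
move=> cA + Aq; have [r r0 rA] := interior_ball Aq.
rewrite (closure_gauge r0 cA rA) (interior_gauge r0 cA rA) /= => p1 /andP[t0 t1].
rewrite (_ : _ - q = t *: (p - q)); last by apply: vecP; rewrite !vecE; ring.
rewrite (gaugeZ r0 rA) //; have := gauge_ge0 r0 rA (p - q); nra.
Qed.

Lemma interior_dense A p (d : R) : convex_set A -> A° !=set0 -> closure A p ->
  0 < d -> exists2 q, A° q & `|q - p| < d.
Proof.
move=> cA [q0 Aq0] Ap d0.
pose k := `|q0 - p| + 1; have k0 : 0 < k by rewrite ltr_wpDl.
pose c := Num.min (1 / 2) (d / (2 * k)).
have c0 : 0 < c by rewrite lt_min !divr_gt0// mulr_gt0.
have c1 : c <= 1 / 2 by rewrite ge_min lexx.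
exists ((1 - c) *: p + (1 - (1 - c)) *: q0).
  by apply: closure_interior_convex => //; lra.
rewrite (_ : _ - p = c *: (q0 - p)); last by apply: vecP; rewrite !vecE; ring.
rewrite normrZ gtr0_norm// (@le_lt_trans _ _ (c * k))//.
  by rewrite ler_pM2l// lerDl.
rewrite (@le_lt_trans _ _ (d / (2 * k) * k))//.
  by rewrite ler_pM2r// ge_min lexx orbT.
rewrite invfM mulrA divfK ?gt_eqF//.
by rewrite ltr_pdivrMr// ltr_pMr// ltr1n.
Qed.

(** Intermediate value theorem for the gauge along the segment. *)
Lemma segment_boundary A p q : convex_set A -> A° !=set0 ->
  closure A p -> ~ A° q ->
  exists2 t : R, 0 <= t <= 1 & boundary A (p + t *: (q - p)).
Proof.
move=> cA [q0 /interior_ball[r r0 rA]].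
rewrite (closure_gauge r0 cA rA) (interior_gauge r0 cA rA) (boundary_gauge r0 cA rA) /=.
move=> p1 /negP; rewrite -leNgt => q1.
pose f (t : R) := gauge A q0 (p + t *: (q - p) - q0).
have cf : continuous f.
  move=> t; apply: (@continuous_comp _ _ _ (fun t : R => p + t *: (q - p))
    (fun z => gauge A q0 (z - q0))).
    by apply: cvgD; [exact: cvg_cst|apply: cvgZl; exact: cvg_id].
  exact: (gauge_continuous_subr r0 cA rA).
have f0 : f 0 <= 1 by rewrite /f scale0r addr0.
have f1 : 1 <= f 1 by rewrite /f scale1r [p + _]addrC subrK.
have [||t] := @IVT _ f 0 1 1 ler01; first exact: continuous_subspaceT.
  by rewrite ge_min f0 le_max f1 orbT.
by rewrite in_itv /= => t01 ft; exists t.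
Qed.

(** [gauge_support] at [p - q] for the gauge centred at [q]; the outer normal comes normalised by
    the interior point [q]. *)
Lemma support A p q : convex_set A -> A° q -> boundary A p ->
  exists2 n, dot n (q - p) = -1 & forall z, closure A z -> dot n (z - p) <= 0.
Proof.
move=> cA /interior_ball[r r0 rA].
rewrite (closure_gauge r0 cA rA) (boundary_gauge r0 cA rA) /=.
move=> /(gauge_support r0 cA rA)[n n1 nle]; exists n.
  by move: n1; rewrite /dot !vecE; lra.
by move=> z; have := nle (z - q); move: n1; rewrite /dot !vecE; lra.
Qed.

Lemma closure_bounded A (K : R) : (forall p, A p -> `|p| <= K) ->
  forall p, closure A p -> `|p| <= K.
Proof.
move=> AK p Ap; apply/ler_addgt0Pr => e e0.
have [q [Aq]] := Ap _ (nbhsx_ballx p e e0); rewrite -ball_normE /= => pq.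
rewrite -(subrK q p) (le_trans (ler_normD _ _))// addrC lerD ?AK//; exact: ltW.
Qed.

Lemma within_continuousP A u : {within closure A, continuous u} <->
  forall p (eps : R), closure A p -> 0 < eps -> exists2 d, 0 < d &
    forall q, closure A q -> `|q - p| < d -> `|u q - u p| < eps.
Proof.
rewrite subspace_continuousP; split=> [cu p eps Ap eps0|h p Ap].
  have /cvgrPdist_lt/(_ _ eps0) := cu p Ap.
  move=> /nbhs_ballP[d /= d0 hd]; exists d => // q Aq qp; rewrite distrC.
  by apply: hd => //; rewrite -ball_normE /= distrC.
apply/cvgrPdist_lt => eps eps0; have [d d0 hd] := h p eps Ap eps0.
apply/nbhs_ballP; exists d => // q; rewrite -ball_normE /= => pq Aq.
by rewrite distrC hd// distrC.
Qed.

Lemma continuous_at_interior A u p : {within closure A, continuous u} -> A° p ->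
  {for p, continuous u}.
Proof.
move=> /within_continuousP cu Ap; apply/cvgrPdist_lt => eps eps0.
have [d d0 hd] := cu p eps (interior_closure_subset Ap) eps0.
have [r r0 rA] := interior_ball Ap.
have m0 : 0 < Num.min d r by rewrite lt_min d0.
apply: filterS (nbhsx_ballx p _ m0) => q; rewrite -ball_normE /= distrC lt_min.
move=> /andP[qd qr]; rewrite distrC hd//.
by apply: subset_closure; exact: rA.
Qed.

Lemma dot_ge0 h : 0 <= dot h h.
Proof. by rewrite /dot -!expr2 addr_ge0 ?sqr_ge0. Qed.

Lemma dot_norm h : `|h| ^+ 2 <= dot h h.
Proof.
have := sqr_ge0 h.1; have := sqr_ge0 h.2.
rewrite norm_pairE /dot -!expr2 /Num.max; case: ifP => _; rewrite real_normK ?num_real//; lra.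
Qed.

(* Touching a concave function from below by a paraboloid. *)
Lemma dense_diff S u p0 (r : R) : open S -> concave_on S u ->
  (forall p, S p -> {for p, continuous u}) -> S p0 -> 0 < r ->
  exists p g, [/\ S p, `|p - p0| < r & diff_eps u p g].
Proof.
move=> oS cu contu Sp0 r0.
have /nbhs_ballP[r1 /= r10 r1S] : nbhs p0 S by exact: open_nbhs_nbhs.
have /cvgrPdist_lt/(_ _ ltr01)/nbhs_ballP[r2 /= r20 hr2] := contu _ Sp0.
pose rho := Num.min r (Num.min r1 r2) / 2.
have rho0 : 0 < rho by rewrite divr_gt0// !lt_min r0 r10.
have rho_lt : rho < Num.min r (Num.min r1 r2).
  by rewrite ltr_pdivrMr// ltr_pMr ?ltr1n// !lt_min r0 r10.
move: rho_lt; rewrite !lt_min => /and3P[rr rr1 rr2].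
pose Q : set (R * R) := `[p0.1 - rho, p0.1 + rho]%classic `*` `[p0.2 - rho, p0.2 + rho]%classic.
have QE q : Q q <-> `|q - p0| <= rho.
  rewrite /Q /= !in_itv /= norm_pairE ge_max !ler_distl.
  by split=> [[-> ->]//|/andP[-> ->]].
have QS q : Q q -> S q.
  move=> /QE qr; apply: r1S; rewrite -ball_normE /= distrC.
  exact: le_lt_trans rr1.
have cQ : compact Q by apply: compact_setX; exact: segment_compact.
(* On the border of the square [Q] the paraboloid is then at least 3, while [u] differs from [u p0]
   by less than 1 on [Q]. So the minimum of [u + P] is not attained on the border. *)
pose C := 3 / rho ^+ 2; have C0 : 0 < C by rewrite divr_gt0// exprn_gt0.
pose P q := C * dot (q - p0) (q - p0).
have cP : continuous P.
  move=> q; apply: cvgMr; apply: cvgD; apply: cvgM; apply: cvgB;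
    [exact: cvg_fst|exact: cvg_cst|exact: cvg_fst|exact: cvg_cst
    |exact: cvg_snd|exact: cvg_cst|exact: cvg_snd|exact: cvg_cst].
have Q0 : Q p0 by apply/QE; rewrite subrr normr0 ltW.
have [||p Qp pmin] := @compact_EVT_min _ _ (fun q => u q + P q) Q _ cQ.
- by exists p0.
- apply: continuous_in_subspaceT => q /set_mem /QS Sq.
  by apply: cvgD; [exact: contu|exact: cP].
have {}Qp : Q p by exact: set_mem.
have {}pmin q : Q q -> u p + P p <= u q + P q by move=> Qq; exact/pmin/mem_set.
have prho : `|p - p0| < rho.
  rewrite lt_neqAle; apply/andP; split; last exact/QE.
  apply/eqP => prho; have := pmin _ Q0.
  have : `|u p0 - u p| < 1.
    by apply: hr2; rewrite -ball_normE /= distrC prho.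
  have : 3 <= P p.
    rewrite /P /C mulrAC ler_pdivlMr ?exprn_gt0// ler_pM2l//.
    by rewrite -prho dot_norm.
  have -> : P p0 = 0 by rewrite /P subrr /dot /= mulr0 addr0 mulr0.
  by rewrite ltr_norml; lra.
have Sp := QS _ Qp.
pose m e := - (2 * C * dot (p - p0) e).
have Pp e (t : R) : P p - P (p + t *: e) = t * m e - C * dot e e * t ^+ 2.
  by rewrite /P /m /dot !vecE; ring.
have rder_ge_m e : m e <= rder S u p e.
  apply/ler_addgt0Pr => eps eps0.
  pose k := C * dot e e + 1; have Ce0 : 0 <= C * dot e e.
    by rewrite mulr_ge0 ?dot_ge0// ltW.
  have k0 : 0 < k by rewrite ltr_wpDl.
  pose t := Num.min (eps / k) ((rho - `|p - p0|) / (`|e| + 1)).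
  have t0 : 0 < t by rewrite lt_min !divr_gt0// ?subr_gt0// ltr_wpDl.
  have Qt : Q (p + t *: e).
    apply/QE; rewrite addrAC (le_trans (ler_normD _ _))// -lerBrDl normrZ gtr0_norm//.
    have : t <= (rho - `|p - p0|) / (`|e| + 1) by rewrite ge_min lexx orbT.
    rewrite ler_pdivlMr ?ltr_wpDl//; apply: le_trans.
    by rewrite ler_wpM2l ?lerDl// ltW.
  have h1 := rder_ge oS cu Sp t0 (QS _ Qt).
  have h2 := pmin _ Qt; have h3 := Pp e t.
  have tk : t * k <= eps by rewrite -ler_pdivlMr// ge_min lexx.
  have h4 : t * (t * k) <= t * eps by rewrite ler_pM2l.
  rewrite -(ler_pM2l t0); have := sqr_ge0 t; move: h4; rewrite /k; lra.
have mN e : m (- e) = - m e by rewrite /m /dot !vecE; ring.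
(* [m] is odd and lies below the one-sided derivatives in all directions. Since the forward
   derivative is at most the backward one, they are squeezed together. *)
have rderE e : rder S u p e = m e.
  apply/eqP; rewrite eq_le rder_ge_m andbT.
  by rewrite (le_trans (rder_le_opp e oS cu Sp))// lerNl -mN rder_ge_m.
exists p, (m (dirx R), m (diry R)); split => //; first exact: lt_trans rr.
apply: (concave_diff_eps oS cu Sp) => eps eps0.
  have [|d d0 hd] := @rder_two_sided _ S u p (dirx R) eps oS cu Sp _ eps0.
    by rewrite !rderE mN.
  by exists d => // t /hd; rewrite rderE.
have [|d d0 hd] := @rder_two_sided _ S u p (diry R) eps oS cu Sp _ eps0.
  by rewrite !rderE mN.
by exists d => // t /hd; rewrite rderE.
Qed.

(** For small [t], concavity bounds [t * (u q - u p)] by the increment of [u] from [p] to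
    [p + t *: (q - p)], which differentiability at [p] compares with the linear term. *)
Lemma supergradient S u p q g : concave_on S u -> S p -> S q -> diff_eps u p g ->
  u q <= u p + dot g (q - p).
Proof.
move=> cu Sp Sq hg; apply/ler_addgt0Pr => e e0.
pose k := `|q - p| + 1; have k0 : 0 < k by rewrite ltr_wpDl.
have [d d0 hd] := hg _ (divr_gt0 e0 k0).
pose t := Num.min 1 (d / (2 * k)).
have t0 : 0 < t by rewrite lt_min ltr01 divr_gt0// mulr_gt0.
have t01 : 0 <= t <= 1 by rewrite ltW//= ge_min lexx.
have tkd : t * k < d.
  apply: (@le_lt_trans _ _ (d / (2 * k) * k)).
    by rewrite ler_pM2r// ge_min lexx orbT.
  by rewrite invfM mulrA divfK ?gt_eqF// ltr_pdivrMr// ltr_pMr// ltr1n.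
have tq : `|t *: (q - p)| = t * `|q - p| by rewrite normrZ gtr0_norm.
have tqd : `|t *: (q - p)| < d.
  by rewrite tq (le_lt_trans _ tkd)// ler_pM2l// lerDl.
have := cu _ _ _ Sq Sp t01; have := hd _ tqd.
rewrite (_ : p + t *: (q - p) = t *: q + (1 - t) *: p); last first.
  by apply: vecP; rewrite !vecE; ring.
rewrite tq (_ : dot g (t *: _) = t * dot g (q - p)); last first.
  by rewrite /dot !vecE; ring.
have ke : e / k * (t * `|q - p|) <= t * e.
  rewrite mulrCA ler_pM2l// mulrAC ler_pdivrMr// ler_pM2l// lerDl//.
rewrite ler_norml => /andP[_ h1] h2.
by rewrite -(ler_pM2l t0); lra.
Qed.

Lemma dot_le_norm g h (M : R) : enorm g <= M -> dot g h <= 2 * M * `|h|.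
Proof.
move=> gM; have M0 : 0 <= M by rewrite (le_trans _ gM)// sqrtr_ge0.
have gle (x : R) : x ^+ 2 <= dot g g -> `|x| <= M.
  by move=> xg; rewrite -sqrtr_sqr (le_trans _ gM)// ler_wsqrtr.
have g1 : `|g.1| <= M by apply: gle; rewrite /dot -!expr2 lerDl sqr_ge0.
have g2 : `|g.2| <= M by apply: gle; rewrite /dot -!expr2 lerDr sqr_ge0.
rewrite (le_trans (ler_norm _))// (le_trans (ler_normD _ _))// !normrM.
rewrite -mulrA mulr2n mulrDl mul1r lerD ?ler_pM//; [exact: ler_norm_fst|exact: ler_norm_snd].
Qed.

Lemma grad_diff_eps u p g : diff_eps u p g -> grad u p = g.
Proof.
move=> /diff_epsP[_ dg]; rewrite /grad !derive_val /dot /=.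
by apply: vecP => /=; ring.
Qed.

(** [u] need not be differentiable at [p], but it is at some interior [p2] as close to [p] as
    desired. The supergradient inequality at [p2] bounds [u q], and continuity replaces [u p2] by
    [u p]. The factor 2 comes from pairing Euclidean length with the maximum norm. *)
Lemma concave_lipschitz A u (M : R) : convex_set A -> A° !=set0 ->
  {within closure A, continuous u} -> concave_on (closure A) u ->
  (forall p, A° p -> differentiable u p -> enorm (grad u p) <= M) ->
  forall p q, closure A p -> closure A q -> `|u p - u q| <= 2 * M * `|p - q|.
Proof.
move=> cA A0 contu cu gM.
have cui : concave_on A° u.
  by move=> p q t Ap Aq; apply: cu; exact: interior_closure_subset.
have M0 : 0 <= M.
  case: A0 => p0 Ap0.
  have [p [g [Ap _ hg]]] := dense_diff (@open_interior _ A) cui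
    (fun p => continuous_at_interior contu) Ap0 ltr01.
  by rewrite (le_trans _ (gM p Ap (diff_epsP hg).1))// sqrtr_ge0.
suff up p q : closure A p -> closure A q -> u q <= u p + 2 * M * `|p - q|.
  move=> p q Ap Aq; rewrite ler_norml lerNl opprB !lerBlDl; apply/andP; split.
    exact: up.
  by rewrite distrC; exact: up.
move=> Ap Aq; apply/ler_addgt0Pr => e e0.
have e2 : 0 < e / 2 by exact: divr_gt0.
have /within_continuousP/(_ p _ Ap e2)[d d0 hd] := contu.
pose c := Num.min (d / 2) (e / 2 / (2 * (2 * M + 1))).
have M1 : 0 < 2 * M + 1 by lra.
have c0 : 0 < c by rewrite lt_min !divr_gt0// mulr_gt0.
have [p1 Ap1 pp1] := interior_dense cA A0 Ap c0.
have [p2 [g [Ap2 p12 hg]]] := dense_diff (@open_interior _ A) cui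
    (fun p => continuous_at_interior contu) Ap1 c0.
have cd : c <= d / 2 by rewrite ge_min lexx.
have Mc : 2 * (2 * M + 1) * c <= e / 2.
  by rewrite mulrC -ler_pdivlMr ?mulr_gt0// ge_min lexx orbT.
have p2p : `|p2 - p| < 2 * c.
  rewrite (_ : p2 - p = (p2 - p1) + (p1 - p)); last by rewrite addrA subrK.
  by rewrite (le_lt_trans (ler_normD _ _))//; lra.
have gM' : enorm g <= M by rewrite -(grad_diff_eps hg); exact: gM (diff_epsP hg).1.
have h1 : `|u p2 - u p| < e / 2.
  by apply: hd; [exact: interior_closure_subset|lra].
have h2 := supergradient cu (interior_closure_subset Ap2) Aq hg.
have h3 := dot_le_norm (q - p2) gM'.
have h4 : `|q - p2| <= `|p - q| + `|p2 - p|.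
  rewrite (_ : q - p2 = - ((p - q) + (p2 - p))); last first.
    by apply: vecP; rewrite !vecE; ring.
  by rewrite normrN ler_normD.
have h5 : 2 * M * `|q - p2| <= 2 * M * (`|p - q| + `|p2 - p|).
  by rewrite ler_wpM2l// mulr_ge0.
have h6 : 2 * M * `|p2 - p| <= 2 * M * (2 * c).
  by rewrite ler_wpM2l ?mulr_ge0// ltW.
by move: h1; rewrite ltr_norml => /andP[_ h1]; lra.
Qed.

Definition ext A u : R * R -> R := fun p => if p \in closure A then u p else 0.

(** A segment from the closure to a point outside crosses the boundary, where [u] is 0; the part up
    to the crossing gives the bound. *)
Lemma ext_lipschitz A u (L : R) : convex_set A -> A° !=set0 ->
  (forall p, boundary A p -> u p = 0) -> 
  (forall p q, closure A p -> closure A q -> `|u p - u q| <= L * `|p - q|) ->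
  forall p q, `|ext A u p - ext A u q| <= L * `|p - q|.
Proof.
move=> cA A0 u0 uL.
have L0 : 0 <= L.
  case: (A0) => p Ap; have [r r0 rA] := interior_ball Ap.
  have Aq : A (p + (r / 2, 0)).
    apply: rA; rewrite addrAC subrr add0r norm_pairE /= normr0 max_l// gtr0_norm.
      by rewrite ltr_pdivrMr// ltr_pMr// ltr1n.
    exact: divr_gt0.
  have := uL _ _ (subset_closure Aq) (interior_closure_subset Ap).
  rewrite addrAC subrr add0r => /(le_trans (normr_ge0 _)).
  rewrite pmulr_lge0// norm_pairE /= normr0 max_l// normr_gt0.
  by rewrite gt_eqF// divr_gt0.
have in_out p q : closure A p -> ~ closure A q -> `|u p| <= L * `|p - q|.
  move=> Ap Aq; have [|t /andP[t0 t1] bt] := segment_boundary cA A0 Ap (q := q).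
    by move=> /interior_closure_subset.
  have := uL _ _ Ap bt.1; rewrite (u0 _ bt) subr0 opprD addrA subrr add0r normrN normrZ.
  move=> /le_trans; apply; rewrite ler_wpM2l// ger0_norm// distrC.
  by rewrite ler_piMl.
move=> p q; rewrite /ext; case: ifPn => [/set_mem Ap|/negP pA]; case: ifPn => [/set_mem Aq|/negP qA].
- exact: uL.
- by rewrite subr0; apply: in_out => // /mem_set.
- by rewrite sub0r normrN distrC; apply: in_out => // /mem_set.
- by rewrite subrr normr0 mulr_ge0.
Qed.

Lemma lipschitz_continuous u (L : R) : (forall p q, `|u p - u q| <= L * `|p - q|) ->
  continuous u.
Proof.
move=> uL p; apply/cvgrPdist_lt => e e0.
have L1 : 0 < `|L| + 1 by rewrite ltr_wpDl.
apply: filterS (nbhsx_ballx p _ (divr_gt0 e0 L1)) => q; rewrite -ball_normE /=.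
rewrite ltr_pdivlMr// => pq; rewrite (le_lt_trans (uL _ _))// (le_lt_trans _ pq)//.
rewrite mulrC ler_wpM2l// (le_trans (ler_norm _))// lerDl//.
Qed.

End body.

(** * The gradient almost everywhere *)

Section gradient.
Variable R : realType.
Implicit Types (p q v w e g h : R * R) (A S : set (R * R)) (u psi : R * R -> R).
Local Notation plane := (measurableTypeR R * measurableTypeR R)%type.
Local Notation meas h := (measurable_fun [set: plane] h).

Definition convex_body A := [/\ convex_set A, A° !=set0 &
  exists K : R, forall p, A p -> `|p| <= K].

(** [G] is a version of the gradient defined on the whole plane: measurable, bounded, 0 off the
    interior, and a true gradient outside a null set that also contains the boundary. It replaces
    [grad u], whose values are arbitrary where a derivative does not exist. *)
Definition weak_grad A u (G : R * R -> R * R) :=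
  [/\ nice (fun p => (G p).1), nice (fun p => (G p).2),
      (forall p, ~ A° p -> G p = 0) &
      exists2 N, null N & forall p, ~ N p ->
        ~ boundary A p /\ (A° p -> diff_eps u p (G p))].

Definition quot (f : R * R -> R) e (n : nat) p : R :=
  n.+1%:R * (f (p + n.+1%:R^-1 *: e) - f p).

Lemma in_class_concave A u : in_class A u -> concave_on (closure A) u.
Proof.
move=> [_ cu _ _] p q t Ap Aq t01.
by have := proj1 (convex_functionP _ _) cu p q t Ap Aq t01; lra.
Qed.

Lemma in_class_interior A u : in_class A u -> concave_on A° u.
Proof.
move=> /in_class_concave cu p q t Ap Aq.
by apply: cu; exact: interior_closure_subset.
Qed.

Lemma cvg_zero (a : nat -> R) (x : R) : (forall n, a n = 0) -> a @ \oo --> x -> x = 0.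
Proof.
move=> a0; have -> : a = cst 0 by apply/funext.
by move=> /(cvg_lim (@Rhausdorff R)) <-; rewrite lim_cst.
Qed.

Section fixed.
Variables (A : set (R * R)) (u : R * R -> R).
Hypotheses (bodyA : convex_body A) (uA : in_class A u).

Let w := ext A u.

Lemma ext_interior p : A° p -> w p = u p.
Proof. by move=> /interior_closure_subset Ap; rewrite /w /ext mem_set. Qed.

Lemma ext_out p : ~ closure A p -> w p = 0.
Proof. by move=> Ap; rewrite /w /ext memNset. Qed.

Lemma in_class_lip : exists2 L : R, 0 <= L &
  forall p q, `|w p - w q| <= L * `|p - q|.
Proof.
have [cA A0 _] := bodyA; have [contu _ u0 [M hM]] := uA.
have uL := concave_lipschitz cA A0 contu (in_class_concave uA) hM.
have wL := ext_lipschitz cA A0 u0 uL.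
exists `|2 * M| => // p q; rewrite (le_trans (wL p q))//.
by rewrite ler_wpM2r// ler_norm.
Qed.

Lemma nice_ext : nice w.
Proof.
have [L L0 wL] := in_class_lip; have [_ [p0 _] [K AK]] := bodyA.
split; first by apply: continuous_measurable_plane; exact: lipschitz_continuous wL.
have cAK := closure_bounded AK.
exists (`|w p0| + L * (`|K| + `|p0|) + `|K|); split => p; last first.
  move=> pK; apply: ext_out => /cAK; apply/negP; rewrite -ltNge.
  rewrite (le_lt_trans (ler_norm _))// (le_lt_trans _ pK)// lerDr.
  by rewrite addr_ge0// mulr_ge0// addr_ge0.
have [/cAK pK|/ext_out ->] := pselect (closure A p); last first.
  by rewrite normr0 !addr_ge0// mulr_ge0// addr_ge0.
have K0 : 0 <= `|K| by [].
rewrite -[X in X <= _]addr0 lerD//.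
rewrite -{1}(subrK (w p0) (w p)) addrC (le_trans (ler_normD _ _))// lerD2l.
rewrite (le_trans (wL _ _))// ler_wpM2l// (le_trans (ler_normB _ _))// lerD2r.
by rewrite (le_trans pK)// ler_norm.
Qed.

Lemma nice_quot e n : nice (quot w e n).
Proof.
by apply: niceZ; apply: niceB; [exact: nice_translation nice_ext|exact: nice_ext].
Qed.

Lemma Int_quot e n : Int (quot w e n) = 0.
Proof.
have nw := nice_ext; rewrite IntZ; last by apply: niceB => //; exact: nice_translation.
by rewrite IntB ?Int_translation ?subrr ?mulr0//; exact: nice_translation.
Qed.

(** The Lipschitz constant bounds the values, and steps of length at most [|e|] enlarge the support
    by at most that much, for all [n] at once. *)
Lemma bounded_quot e : exists C : R, forall n, bounded_with C (quot w e n).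
Proof.
have [L L0 wL] := in_class_lip; have [_ _ [K AK]] := bodyA.
have cAK := closure_bounded AK.
exists (L * `|e| + (`|K| + `|e|)) => n; split => p.
  rewrite /quot normrM ger0_norm// (@le_trans _ _ (L * `|e|))//; last first.
    by rewrite lerDl addr_ge0.
  rewrite -ler_pdivlMl// (le_trans (wL _ _))// addrAC subrr add0r normrZ.
  by rewrite ger0_norm ?invr_ge0// mulrCA.
move=> Cp; have Kp : `|K| + `|e| < `|p|.
  by rewrite (le_lt_trans _ Cp)// lerDr mulr_ge0.
have n1 : n.+1%:R^-1 * `|e| <= `|e|.
  by rewrite ler_piMl// invf_le1// ler1n.
rewrite /quot !ext_out ?subrr ?mulr0// => /cAK; apply/negP; rewrite -ltNge.
  rewrite (le_lt_trans (ler_norm _))// (le_lt_trans _ Kp)// lerDl//.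
rewrite (le_lt_trans (ler_norm _))//.
have : `|p| <= `|p + n.+1%:R^-1 *: e| + n.+1%:R^-1 * `|e|.
  rewrite -[X in _ <= _ + X * _]ger0_norm ?invr_ge0// -normrZ.
  by rewrite -{1}(addrK (n.+1%:R^-1 *: e) p) ler_normB.
by move: (n.+1%:R^-1) n1 => x; lra.
Qed.

Lemma quot_out e p : ~ closure A p -> quot w e n p @[n --> \oo] --> 0.
Proof.
move=> Ap; have oC : open (~` closure A) by apply: closed_openC; exact: closed_closure.
have [d d0 hd] := open_segment e oC Ap.
apply/cvgrPdist_lt => eps eps0.
have := @near_infty_natSinv_lt R (PosNum d0); apply: filterS => n /= nd.
rewrite /quot (ext_out Ap) ext_out ?subrr ?mulr0 ?subrr ?normr0//.
by apply: hd; rewrite ger0_norm ?invr_ge0.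
Qed.

Definition D e p : R := if p \in (A° : set (R * R)) then rder A° u p e else 0.

Lemma D_in e p : A° p -> D e p = rder A° u p e.
Proof. by move=> Ap; rewrite /D mem_set. Qed.

Lemma D_out e p : ~ A° p -> D e p = 0.
Proof. by move=> Ap; rewrite /D memNset. Qed.

Lemma quot_in e p : A° p -> quot w e n p @[n --> \oo] --> D e p.
Proof.
move=> Ap; rewrite D_in//; apply/cvgrPdist_le => eps eps0.
have [d d0 hd] := rder_eps e (@open_interior _ A) (in_class_interior uA) Ap eps0.
have := @near_infty_natSinv_lt R (PosNum d0); apply: filterS => n /= nd.
have n0 : 0 < n.+1%:R^-1 :> R by rewrite invr_gt0.
have [|Ae] := hd n.+1%:R^-1; first by rewrite n0.
rewrite /quot !ext_interior//.
set t := n.+1%:R^-1 in n0 Ae *; have -> : n.+1%:R = t^-1 by rewrite invrK.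
move=> /andP[h1 h2]; rewrite ler_norml; apply/andP; split.
  rewrite -(ler_pM2l n0) mulrBr mulrA divff ?gt_eqF// mul1r.
  have : 0 <= t * eps by rewrite mulr_ge0// ltW.
  lra.
rewrite -(ler_pM2l n0) mulrBr mulrA divff ?gt_eqF// mul1r; lra.
Qed.

Lemma quot_D e p : ~ boundary A p -> quot w e n p @[n --> \oo] --> D e p.
Proof.
move=> bp; have [Ap|Ap] := pselect (A° p); first exact: quot_in.
rewrite D_out//; apply: quot_out => cAp; exact: bp.
Qed.

Lemma indic_bound (B : set (R * R)) p : `|\1_B p : R| <= 1.
Proof. by rewrite indicE; case: (_ \in _); rewrite ?normr1 ?normr0. Qed.

Lemma measurable_interior : measurable (A° : set plane).
Proof. by apply: open_measurable_plane; exact: open_interior. Qed.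

(** Measurability comes from pointwise limits. At boundary points the difference quotients need not
    tend to the value 0 of [D], so they are multiplied by the indicator of the interior before
    passing to the limit. *)
Lemma nice_D e : nice (D e).
Proof.
have [C hC] := bounded_quot e.
have cvgD p : (\1_(A° : set (R * R)) p * quot w e n p) @[n --> \oo] --> D e p.
  have [Ap|Ap] := pselect (A° p); rewrite indicE.
    by rewrite mem_set//= [X in X @ _ --> _](_ : _ = quot w e ^~ p);
      [exact: quot_in|apply/funext => n; rewrite mul1r].
  rewrite memNset//= D_out// [X in X @ _ --> _](_ : _ = cst 0); first exact: cvg_cst.
  by apply/funext => n; rewrite mul0r.
split.
  apply: (@measurable_fun_cvg _ _ _ setT (fun n p => \1_(A° : set (R * R)) p * quot w e n p)) => //.
  move=> n; apply: measurable_funM; last exact: (nice_quot e n).1.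
  by apply: measurable_indic; exact: measurable_interior.
exists C; split => p.
  have h : (fun n => `|\1_(A° : set (R * R)) p * quot w e n p|) @ \oo --> `|D e p|.
    by apply: cvg_norm; exact: cvgD.
  rewrite -(cvg_lim (@Rhausdorff R) h); apply: limr_le.
    by apply/cvg_ex; eexists; exact: h.
  apply: nearW => n.
  by rewrite normrM (le_trans _ ((hC n).1 p))// ler_piMl// indic_bound.
move=> Cp; have [Ap|/D_out//] := pselect (A° p).
by apply: cvg_zero (cvgD p) => n; rewrite (hC n).2 ?mulr0.
Qed.

Lemma Int_D e : Int (D e) = 0.
Proof.
have [C hC] := bounded_quot e; have [cA A0 _] := bodyA.
have := Int_dominated (fun n => (nice_quot e n).1) hC (nice_D e)
  (boundary_null cA A0) (fun p => @quot_D e p).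
by apply: cvg_zero => n; exact: Int_quot.
Qed.

Lemma D_opp_ae e : exists2 N, null N & forall p, ~ N p -> D (- e) p = - D e p.
Proof.
have nDD := niceD (nice_D e) (nice_D (- e)).
have n1 := niceZ (- 1) nDD.
have [||N N0 hN] := Int_eq0 n1.
- move=> p; have [Ap|Ap] := pselect (A° p); last by rewrite !D_out ?addr0 ?mulr0.
  rewrite !D_in//.
  have := rder_le_opp e (@open_interior _ A) (in_class_interior uA) Ap; lra.
- by rewrite IntZ// IntD ?Int_D ?addr0 ?mulr0//; exact: nice_D.
by exists N => // p /hN; lra.
Qed.

Lemma exists_grad : exists G, weak_grad A u G.
Proof.
have [N1 N10 hN1] := D_opp_ae (dirx R); have [N2 N20 hN2] := D_opp_ae (diry R).
have [cA A0 _] := bodyA.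
exists (fun p => (D (dirx R) p, D (diry R) p)); split; [exact: nice_D|exact: nice_D| |].
  by move=> p Ap; rewrite !D_out.
exists (boundary A `|` (N1 `|` N2)).
  by apply: nullU; [exact: boundary_null|exact: nullU].
move=> p /not_orP[bp /not_orP[p1 p2]]; split=> // Ap.
have oA := @open_interior _ A; have cu := in_class_interior uA.
apply: (concave_diff_eps oA cu Ap) => eps eps0; rewrite D_in//.
  by apply: (rder_two_sided oA cu Ap) eps0; rewrite -!D_in// hN1.
by apply: (rder_two_sided oA cu Ap) eps0; rewrite -!D_in// hN2.
Qed.

Variables (G : R * R -> R * R).
Hypothesis uG : weak_grad A u G.

Lemma nice_dot e : nice (fun p => dot (G p) e).
Proof.
have [n1 n2 _ _] := uG; rewrite /dot.
rewrite (_ : (fun p => _) = fun p => e.1 * (G p).1 + e.2 * (G p).2).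
  by apply: niceD; exact: niceZ.
by apply/funext => p; rewrite [_ * e.1]mulrC [_ * e.2]mulrC.
Qed.

Lemma quot_dot e p : ~ boundary A p -> (A° p -> diff_eps u p (G p)) ->
  quot w e n p @[n --> \oo] --> dot (G p) e.
Proof.
move=> bp hG; have [Ap|Ap] := pselect (A° p); last first.
  have [_ _ -> // _] := uG.
  rewrite (_ : dot 0 e = 0); last by rewrite /dot /= !mul0r addr0.
  by apply: quot_out => cAp; exact: bp.
apply/cvgrPdist_le => eps eps0.
have e1 : 0 < `|e| + 1 by rewrite ltr_wpDl.
have [d d0 hd] := hG Ap _ (divr_gt0 eps0 e1).
have [d' d'0 hd'] := open_segment e (@open_interior _ A) Ap.
have dd0 : 0 < Num.min d' (d / (`|e| + 1)) by rewrite lt_min d'0 divr_gt0.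
have := @near_infty_natSinv_lt R (PosNum dd0); apply: filterS => n /=.
rewrite lt_min => /andP[nd' nd].
have n0 : 0 < n.+1%:R^-1 :> R by rewrite invr_gt0.
rewrite /quot !ext_interior//; last by apply: hd'; rewrite gtr0_norm.
have := hd (n.+1%:R^-1 *: e); rewrite normrZ gtr0_norm//.
set t := n.+1%:R^-1 in n0 nd *; have -> : n.+1%:R = t^-1 by rewrite invrK.
have te : t * `|e| < d.
  rewrite ltr_pdivlMr// in nd; rewrite (le_lt_trans _ nd)// ler_pM2l//.
  by rewrite lerDl.
move=> /(_ te) h; rewrite -(ler_pM2l n0) -[X in X * `|_|](gtr0_norm n0) -normrM.
rewrite mulrBr mulrA divff ?gt_eqF// mul1r distrC.
rewrite (_ : t * dot (G p) e = dot (G p) (t *: e)); last by rewrite /dot !vecE; ring.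
apply: (le_trans h); rewrite mulrCA ler_pM2l// mulrAC ler_pdivrMr// ler_pM2l//.
by rewrite lerDl.
Qed.

(** The weight [psi] has two uses: the constant 1 shows that the gradient has mean zero, and the
    indicator of a box gives the flux through that box. *)
Lemma quot_limit psi (K : R) e : meas psi -> (forall p, `|psi p| <= K) ->
  Int (fun p => psi p * quot w e n p) @[n --> \oo] --> Int (fun p => psi p * dot (G p) e).
Proof.
move=> mpsi psiK; have [C hC] := bounded_quot e; have [_ _ _ [N N0 hN]] := uG.
have K0 : 0 <= K by rewrite (le_trans _ (psiK 0)).
apply: (@Int_dominated _ _ _ (K * C + C) N) => //.
- by move=> n; apply: measurable_funM => //; exact: (nice_quot e n).1.
- have C0 : 0 <= C by rewrite (le_trans _ ((hC 0%N).1 0)).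
  move=> n; split => p.
    by rewrite normrM (@le_trans _ _ (K * C)) ?lerDl// ler_pM// (hC n).1.
  by move=> Cp; rewrite (hC n).2 ?mulr0// (le_lt_trans _ Cp)// lerDr mulr_ge0.
- exact: nice_mull psiK (nice_dot e).
- by move=> p /hN[bp hp]; apply: cvgMl_tmp; exact: quot_dot.
Qed.

Lemma Int_dot e : Int (fun p => dot (G p) e) = 0.
Proof.
have c1 p : `|cst 1 p : R| <= 1 by rewrite normr1.
have -> : (fun p => dot (G p) e) = fun p => (cst 1 p : R) * dot (G p) e.
  by apply/funext => p; rewrite mul1r.
have m1 : meas (cst 1 : R * R -> R) by exact: measurable_cst.
have h := @quot_limit (cst 1) 1 e m1 c1.
apply: (cvg_zero _ h) => n.
rewrite -[RHS](Int_quot e n); congr Int.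
by apply/funext => p; rewrite mul1r.
Qed.

End fixed.
End gradient.

(** * Energies as integrals of the gradient field *)

Section energy.
Variable R : realType.
Implicit Types (p q v w e g h : R * R) (A S : set (R * R)) (u f : R * R -> R).
Local Notation mu := (@lebesgue_measure R).
Local Notation area := (mu \x mu)%E.
Local Notation plane := (measurableTypeR R * measurableTypeR R)%type.
Local Notation meas h := (measurable_fun [set: plane] h).

Lemma le_Int_ae (h g : R * R -> R) N : nice h -> nice g -> null N ->
  (forall p, ~ N p -> h p <= g p) -> Int h <= Int g.
Proof.
move=> nh ng N0 hg.
have mN : meas (\1_(~` N) : R * R -> R).
  by apply: measurable_indic; apply: measurableC; exact: N0.1.
have nk k : nice k -> nice (fun p => \1_(~` N) p * k p).
  by apply: nice_mull mN _ => p; exact: indic_bound.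
have Ik k : nice k -> Int k = Int (fun p => \1_(~` N) p * k p).
  move=> nk'; apply: (Int_ae_eq nk' (nk _ nk') N0) => p Np.
  by rewrite indicE mem_set// mul1r.
rewrite (Ik h)// (Ik g)//; apply: le_Int; [exact: nk|exact: nk|] => p.
rewrite indicE; have [Np|Np] := pselect (N p); last by rewrite mem_set// !mul1r hg.
by rewrite memNset ?mul0r//; exact.
Qed.

Lemma mem_interior A p : A p -> ~ boundary A p -> A° p.
Proof.
move=> Ap bp; apply: contrapT => Ai; apply: bp; split => //.
exact: subset_closure.
Qed.

Section fixed.
Variables (A : set (R * R)) (u : R * R -> R) (G : R * R -> R * R).
Hypotheses (bodyA : convex_body A) (uA : in_class A u) (uG : weak_grad A u G).

Lemma integral_grad (phi : R * R -> R) :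
  (\int[area]_(p in A) phi (grad u p))%R = Int (fun p => \1_(A° : set (R * R)) p * phi (G p)).
Proof.
have [_ _ _ [N N0 hN]] := uG; apply: (integral_null N0) => p Np.
have [bp hp] := hN p Np; rewrite patchE indicE.
have [Ap|Ap] := pselect (A p).
  have Aip := mem_interior Ap bp.
  by rewrite !mem_set// mul1r (grad_diff_eps (hp Aip)).
rewrite !memNset ?mul0r//.
by move=> /interior_subset.
Qed.

Lemma dir_energyE e : dir_energy A e u = Int (fun p => dot (G p) e ^+ 2).
Proof.
rewrite /dir_energy (integral_grad (fun v => dot v e ^+ 2)); congr Int; apply/funext => p.
rewrite indicE; have [Ap|Ap] := pselect (A° p); first by rewrite mem_set// mul1r.
have [_ _ /(_ p Ap) -> _] := uG.
by rewrite memNset// mul0r /dot /= !mul0r addr0 expr0n.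
Qed.

Lemma nice_dotX e : nice (fun p => dot (G p) e ^+ 2).
Proof. by have n := nice_dot uG e; exact: niceM. Qed.

Lemma indic_interior_nice (c : R) : nice (fun p => \1_(A° : set (R * R)) p * c).
Proof.
have [_ _ [K AK]] := bodyA.
have n1 : nice (\1_(A° : set (R * R)) : R * R -> R).
  apply: (@nice_indic _ _ K); first exact: measurable_interior.
  by move=> p /interior_subset /AK.
rewrite (_ : (fun p => _) = fun p => c * \1_(A° : set (R * R)) p).
  exact: niceZ.
by apply/funext => p; rewrite mulrC.
Qed.

Lemma weak_grad_bounded : exists2 C : R, 0 <= C & forall p, `|G p| <= C.
Proof.
have [[_ [C1 [h1 _]]] [_ [C2 [h2 _]]] _ _] := uG.
have C10 : 0 <= C1 by rewrite (le_trans _ (h1 0)).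
have C20 : 0 <= C2 by rewrite (le_trans _ (h2 0)).
exists (C1 + C2); first exact: addr_ge0.
by move=> p; rewrite norm_pairE ge_max; have := h1 p; have := h2 p; lra.
Qed.

(** The values of [G] stay in a compact square, on which [f] is bounded. The indicator is there
    because [f 0] may be non-zero outside [A]. *)
Lemma nice_comp f : continuous f -> nice (fun p => \1_(A° : set (R * R)) p * f (G p)).
Proof.
move=> cf; have [C C0 hC] := weak_grad_bounded.
pose Q : set (R * R) := `[- C, C]%classic `*` `[- C, C]%classic.
have cQ : compact Q by apply: compact_setX; exact: segment_compact.
have Q0 : Q !=set0 by exists 0; split; rewrite /= in_itv /= oppr_le0 C0.
have [|c _ hc] := @compact_EVT_max _ _ (fun v => `|f v|) Q Q0 cQ.
  apply: continuous_subspaceT => v; apply: (@continuous_comp _ _ _ f); first exact: cf.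
  exact: norm_continuous.
have fG p : `|f (G p)| <= `|f c|.
  apply: hc; rewrite inE; have := hC p; rewrite norm_pairE ge_max => /andP[h1 h2].
  by split; rewrite /= in_itv /= -ler_norml.
have [[m1 _] [m2 _] _ _] := uG.
have mfG : meas (fun p => f (G p)).
  apply: (measurableT_comp (continuous_measurable_plane cf)).
  by apply/measurable_fun_pairP.
rewrite (_ : (fun p => _) = fun p => f (G p) * (\1_(A° : set (R * R)) p * 1)).
  exact: nice_mull fG (indic_interior_nice 1).
by apply/funext => p; rewrite mulr1 mulrC.
Qed.

Lemma functional0 f : functional A f (cst 0) = Int (fun p => \1_(A° : set (R * R)) p * f 0).
Proof.
have [cA A0 _] := bodyA.
apply: (integral_null (boundary_null cA A0)) => p bp; rewrite patchE indicE.
have [Ap|Ap] := pselect (A p).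
  rewrite (mem_set Ap) (mem_set (mem_interior Ap bp)) mul1r; congr f.
  by rewrite /grad !derive_cst.
rewrite !memNset ?mul0r//.
by move=> /interior_subset.
Qed.

(** A horizontal line through an interior [p] hits the boundary on both sides; [u] is 0 at both
    points and concave between them. *)
Lemma in_class_ge0 p : closure A p -> 0 <= u p.
Proof.
have [cA A0 [K AK]] := bodyA; have [_ _ u0 _] := uA.
move=> Ap; have [Ai|Ai] := pselect (A° p); last first.
  by rewrite u0//; split.
have cAK := closure_bounded AK.
pose T := 2 * `|K| + 1; have T0 : 0 < T by rewrite ltr_wpDl// mulr_ge0.
have out (s : R) : `|s| = T -> ~ A° (p + s *: dirx R).
  move=> sT /interior_closure_subset /cAK.
  have := cAK p Ap; have := ler_norm K.
  have : T <= `|p + s *: dirx R| + `|p|.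
    rewrite -sT -[X in X <= _]mulr1 -[X in `|s| * X](_ : `|dirx R| = 1); last first.
      by rewrite norm_pairE /= normr1 normr0 max_l.
    by rewrite -normrZ -{1}(addKr p (s *: _)) addrC ler_normB.
  by rewrite /T; lra.
have [t1 /andP[t10 _] b1] := segment_boundary cA A0 Ap (out T (ger0_norm (ltW T0))).
have [|t2 /andP[t20 _] b2] := segment_boundary cA A0 Ap (out (- T) _).
  by rewrite normrN ger0_norm// ltW.
have t_neq0 t q : boundary A (p + t *: q) -> t != 0.
  by move=> [_ hb]; apply/eqP => t0; apply: hb; rewrite t0 scale0r addr0.
have {}t10 : 0 < t1 by rewrite lt_def t10 (t_neq0 _ _ b1).
have {}t20 : 0 < t2 by rewrite lt_def t20 (t_neq0 _ _ b2).
have t01 : 0 <= t2 / (t1 + t2) <= 1.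
  rewrite divr_ge0 ?addr_ge0 ?ltW//= ?addr_gt0//.
  by rewrite ltr_pdivrMr ?addr_gt0// mul1r ltrDr.
have := in_class_concave uA b1.1 b2.1 t01; rewrite (u0 _ b1) (u0 _ b2) !mulr0 addr0.
rewrite [X in u X](_ : _ = p)//.
by apply: vecP; rewrite !vecE /=; field; rewrite gt_eqF// addr_gt0.
Qed.

Lemma dense_notnull N p (d : R) : null N -> A° p -> 0 < d ->
  exists q, [/\ A° q, `|q - p| < d & ~ N q].
Proof.
move=> [mN N0] Ap d0; have [r r0 rA] := interior_ball_interior Ap.
pose c := Num.min d r / 2; have c0 : 0 < c by rewrite divr_gt0// lt_min d0.
have cd : c < Num.min d r by rewrite ltr_pdivrMr ?ltr_pMr ?ltr1n// lt_min d0.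
pose Q : set plane := `[p.1 - c, p.1 + c]%classic `*` `[p.2 - c, p.2 + c]%classic.
have mQ : measurable Q by apply: measurableX; exact: measurable_itv.
apply: contrapT => hN.
have QN : Q `<=` N.
  move=> q [] /=; rewrite !in_itv /= => q1 q2; apply: contrapT => Nq.
  have qc : `|(q : R * R) - p| < Num.min d r.
    by apply: le_lt_trans cd; rewrite norm_pairE ge_max !ler_distl q1.
  apply: hN; exists q; move: qc; rewrite lt_min => /andP[qd qr]; split => //.
  exact: rA.
have : (area Q <= area N)%E by apply: le_measure => //; rewrite inE.
rewrite N0 area_box; [|lra..].
by rewrite lee_fin; apply/negP; rewrite -ltNge mulr_gt0//; lra.
Qed.

(* At a point p near the boundary with zero derivative along e, the value u p
   bounds u on the whole line p + R e, which passes close to a given point. *)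
Lemma dir_energy_eq0 e : e != 0 -> dir_energy A e u = 0 ->
  forall p, closure A p -> u p = 0.
Proof.
have [cA A0 [K AK]] := bodyA; have [contu _ u0 _] := uA.
rewrite dir_energyE => e0 E0 p0 Ap0; apply/eqP; rewrite eq_le in_class_ge0// andbT.
rewrite leNgt; apply/negP => up0.
have [N1 N10 hN1] := Int_eq0 (nice_dotX e) (fun p => sqr_ge0 _) E0.
have [_ _ _ [N2 N20 hN2]] := uG.
have Ai0 : A° p0.
  by apply: contrapT => Ai; move: up0; rewrite u0 ?ltxx//; split.
have cAK := closure_bounded AK.
have ee : 0 < `|e| by rewrite normr_gt0.
pose T := (2 * `|K| + 1) / `|e|.
have T0 : 0 < T by rewrite divr_gt0// ltr_wpDl// mulr_ge0.
have out : ~ A° (p0 + T *: e).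
  move=> /interior_closure_subset /cAK.
  have := cAK p0 Ap0; have := ler_norm K.
  have : 2 * `|K| + 1 <= `|p0 + T *: e| + `|p0|.
    have -> : 2 * `|K| + 1 = `|T *: e|.
      by rewrite normrZ gtr0_norm// /T divfK// gt_eqF.
    by rewrite -{1}(addKr p0 (T *: _)) addrC ler_normB.
  by lra.
have [t1 /andP[t10 t11] b1] := segment_boundary cA A0 Ap0 out.
rewrite addrAC subrr add0r in b1; set z := p0 + _ in b1.
(* p1 is interior, on the segment from z to p0, with u p1 < u p0 / 4 *)
have h4 : 0 < u p0 / 4 by exact: divr_gt0.
have h2 : 0 < u p0 / 2 by exact: divr_gt0.
have [d1 d10 hd1] := proj1 (within_continuousP _ _) contu z _ b1.1 h4.
have [d2 d20 hd2] := proj1 (within_continuousP _ _) contu p0 _ Ap0 h2.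
have [r2 r20 hr2] := interior_ball Ai0.
pose s := Num.min (1 / 2) (d1 / 2 / (T * `|e| + 1)).
have Te : 0 < T * `|e| + 1 by rewrite ltr_wpDl// mulr_ge0// ltW.
have s0 : 0 < s by rewrite lt_min !divr_gt0.
have s1 : s <= 1 / 2 by rewrite ge_min lexx.
pose p1 := (1 - s) *: z + (1 - (1 - s)) *: p0.
have Ap1 : A° p1 by apply: (closure_interior_convex cA b1.1 Ai0); lra.
have p1z : `|p1 - z| < d1 / 2.
  have -> : p1 - z = - (s * t1) *: (T *: e).
    by rewrite /p1 /z; apply: vecP; rewrite !vecE; ring.
  have t1p : 0 < t1.
    rewrite lt_def t10 andbT; apply/eqP => t0.
    by apply: b1.2; rewrite /z t0 scale0r addr0.
  rewrite normrZ normrN (gtr0_norm (mulr_gt0 s0 t1p)) normrZ (gtr0_norm T0).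
  have : s * (T * `|e| + 1) <= d1 / 2 by rewrite -ler_pdivlMr// ge_min lexx orbT.
  have : s * t1 * (T * `|e|) <= s * (T * `|e|).
    apply: ler_wpM2r; first by apply: mulr_ge0 => //; exact: ltW.
    by rewrite ger_pMr.
  by move: s0; lra.
have dd0 : 0 < Num.min (d1 / 2) (Num.min d2 r2) by rewrite !lt_min d20 divr_gt0.
have [p2 [Ap2 p21 Np2]] := dense_notnull (nullU N10 N20) Ap1 dd0.
have [Np21 Np22] : ~ N1 p2 /\ ~ N2 p2 by move/not_orP: Np2.
move: p21; rewrite !lt_min => /and3P[p21 p2d p2r].
have up2 : u p2 < u p0 / 4.
  have := hd1 p2 (interior_closure_subset Ap2); rewrite (u0 _ b1) subr0.
  have : `|p2 - z| <= `|p2 - p1| + `|p1 - z|.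
    by rewrite -{1}(subrK p1 p2) -addrA ler_normD.
  move=> h h'; have /h' : `|p2 - z| < d1 by lra.
  by rewrite ltr_norml => /andP[].
have := dot_ge0 e; have := hN1 _ Np21 => /eqP; rewrite sqrf_eq0 => /eqP ge0 _.
(* [p2] avoids the null sets but has left the line through [p0] along [e]. Moving [p0] by the same
   vector restores the alignment: [q - p2] is a multiple of [e], so the supergradient inequality
   reads [u q <= u p2], against [u q > u p0 / 2] and [u p2 < u p0 / 4]. *)
pose q := p0 + (p2 - p1).
have Aq : A q by apply: hr2; rewrite /q addrAC subrr add0r.
have uq : u p0 / 2 < u q.
  have := hd2 q (subset_closure Aq); rewrite /q addrAC subrr add0r => /(_ p2d).
  rewrite ltr_norml => /andP[h _]; lra.
have := supergradient (in_class_concave uA) (interior_closure_subset Ap2)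
  (subset_closure Aq) ((hN2 _ Np22).2 Ap2).
have -> : q - p2 = (- ((1 - s) * t1 * T)) *: e.
  by rewrite /q /p1 /z; apply: vecP; rewrite !vecE; ring.
have -> c : dot (G p2) (c *: e) = c * dot (G p2) e by rewrite /dot !vecE; ring.
rewrite ge0 mulr0 addr0; lra.
Qed.


End fixed.
End energy.

(** * Second-order expansion and local minima *)

Section taylor.
Variable R : realType.
Implicit Types (p q v w e g h : R * R) (A S : set (R * R)) (u f : R * R -> R).

Lemma derive_bound f p e (L : R) :
  (exists2 d, 0 < d & forall t, `|t| < d -> `|f (p + t *: e) - f p| <= L * `|t|) ->
  derivable f p e -> `|'D_e f p| <= L.
Proof.
move=> [d d0 hd] df.
have cn : (fun h : R => `|h^-1 *: ((f \o shift p) (h *: e) - f p)|) @ 0^' --> `|'D_e f p|.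
  by apply: cvg_norm.
rewrite -(cvg_lim (@Rhausdorff R) cn); apply: limr_le.
  by apply/cvg_ex; eexists; exact: cn.
near=> t.
have t0 : t != 0 by near: t; exact: nbhs_dnbhs_neq.
have td : `|t| < d by near: t; exact: dnbhs0_lt.
rewrite /= normrZ normfV ler_pdivrMl ?normr_gt0// mulrC addrC.
by rewrite [_ + p]addrC addrC; exact: hd.
Unshelve. all: by end_near. Qed.

Lemma diff_grad f q v : differentiable f q -> 'd f q v = dot (grad f q) v.
Proof.
move=> df; rewrite /dot /grad !deriveE//=.
rewrite {1}(_ : v = v.1 *: dirx R + v.2 *: diry R); last first.
  by apply: vecP; rewrite !vecE /=; ring.
by rewrite linearD !linearZ /= [_ * v.1]mulrC [_ * v.2]mulrC.
Qed.

Lemma dot_bound g h : `|dot g h| <= 2 * (`|g| * `|h|).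
Proof.
rewrite /dot (le_trans (ler_normD _ _))// !normrM mulr2n mulrDl mul1r.
by apply: lerD; apply: ler_pM => //; rewrite ?ler_norm_fst ?ler_norm_snd.
Qed.

Lemma is_derive_line f v (t : R) : differentiable f (t *: v) ->
  is_derive t 1 (fun s : R => f (s *: v)) (dot (grad f (t *: v)) v).
Proof.
move=> df.
have E : (fun h : R => h^-1 *: (((fun s : R => f (s *: v)) \o shift t) (h *: 1) - f (t *: v)))
       = (fun h : R => h^-1 *: ((f \o shift (t *: v)) (h *: v) - f (t *: v))).
  by apply/funext => h /=; rewrite [h *: 1]mulr1 scalerDl.
apply: DeriveDef.
  by rewrite /derivable E; exact: diff_derivable.
by rewrite /derive E -diff_grad// -deriveE.
Qed.

(** The gradient of [f] is only known to be differentiable at the origin. So the mean value theorem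
    is applied once, and the expansion of the gradient at 0 controls the resulting derivative. *)
Lemma taylor2 f (eps : R) : twice_differentiable f 0 -> 0 < eps ->
  exists2 d, 0 < d & forall v, `|v| < d ->
    `|f v - f 0 - dot (grad f 0) v - hess_form f 0 v / 2| <= eps * dot v v.
Proof.
move=> [/nbhs_ballP[d1 /= d10 hd1] dg] eps0.
have eps2 : 0 < eps / 2 by exact: divr_gt0.
have /eqaddoP/(_ _ eps2)/nbhs_ballP[d2 /= d20 hd2] := diff_locally dg.
exists (Num.min d1 d2); first by rewrite lt_min d10.
move=> v; rewrite lt_min => /andP[vd1 vd2].
pose a := dot (grad f 0) v; pose b := hess_form f 0 v.
(* [f] along the segment minus its linear and quadratic terms: the required error is
   [psi 1 - psi 0], and the derivative of [psi] pairs the first-order error of the gradient with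
   [v]. Requesting [eps / 2] from the gradient absorbs the factor 2 of [dot_bound]. *)
pose psi (t : R) := f (t *: v) - (t * a + t ^+ 2 * (b / 2)).
have dline (t : R) : t \in `[0, 1] -> is_derive t 1 psi (dot (grad f (t *: v)) v - (a + t * b)).
  rewrite in_itv /= => /andP[t0 t1].
  have df : differentiable f (t *: v).
    apply: hd1; rewrite -ball_normE /= sub0r normrN normrZ ger0_norm//.
    by rewrite (le_lt_trans _ vd1)// ler_piMl.
  have := is_derive_line df => hl.
  have hp : is_derive t 1 (fun s : R => s * a + s ^+ 2 * (b / 2)) (a + t * b).
    have h := is_deriveD (is_deriveZ a (is_derive_id t (1 : R)))
      (is_deriveZ (b / 2) (is_deriveX 2 (is_derive_id t (1 : R)))).
    rewrite (_ : (fun s : R => _) = (a \*: id + (b / 2) \*: (id ^+ 2))%R); last first.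
      by apply/funext => s; rewrite [s * a]mulrC [_ * (b / 2)]mulrC.
    apply: (is_derive_eq h); rewrite /= expr1.
    have -> : 2 * t *: (1 : R) = 2 * t by rewrite -[LHS]/(2 * t * 1) mulr1.
    rewrite -[X in X + _ = _]/(a * 1) -[X in _ + X = _]/(b / 2 * (2 * t)).
    by field.
  exact: is_deriveB.
have dline' (t : R) : t \in `]0, 1[ ->
    is_derive t 1 psi (dot (grad f (t *: v)) v - (a + t * b)).
  by rewrite in_itv /= => /andP[t0 t1]; apply: dline; rewrite in_itv /= !ltW.
have cpsi : {within `[0, 1], continuous psi}.
  by apply: derivable_within_continuous => t /dline [].
have [t t01 ht] := MVT ltr01 dline' cpsi.
have t0 : 0 < t < 1 by move: t01; rewrite in_itv.
have -> : f v - f 0 - dot (grad f 0) v - hess_form f 0 v / 2 = psi 1 - psi 0.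
  by rewrite /psi scale1r scale0r -/a -/b; ring.
rewrite ht subr0 mulr1.
have tv : `|t *: v| <= `|v|.
  by case/andP: t0 => ta tb; rewrite normrZ gtr0_norm// ler_piMl// ltW.
have hle : `|grad f (t *: v) - (grad f 0 + hess f 0 (t *: v))| <= eps / 2 * `|t *: v|.
  rewrite -[X in grad f X - _]addr0; apply: hd2.
  by rewrite -ball_normE /= sub0r normrN (le_lt_trans tv).
have -> : dot (grad f (t *: v)) v - (a + t * b) =
    dot (grad f (t *: v) - (grad f 0 + hess f 0 (t *: v))) v.
  by rewrite {1}/hess linearZ /= -/(hess f 0) /a /b /hess_form /dot !vecE; ring.
apply: (le_trans (dot_bound _ _)).
have := dot_norm v; rewrite expr2.
have := le_trans hle (ler_wpM2l (ltW eps2) tv).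
move: (`|grad f _ - _|) => x hx hv.
have := ler_wpM2r (normr_ge0 v) hx; nra.
Qed.

End taylor.

(** * Two criteria: coercivity and a negative second variation *)

Section local_min.
Variable R : realType.
Implicit Types (p q v w e g h : R * R) (A S : set (R * R)) (u f : R * R -> R).

Lemma norm_dirx : `|dirx R| = 1.
Proof. by rewrite norm_pairE /= normr1 normr0 max_l. Qed.

Lemma norm_diry : `|diry R| = 1.
Proof. by rewrite norm_pairE /= normr1 normr0 max_r. Qed.

Lemma derive_lip A u p e (L : R) :
  (forall p q, closure A p -> closure A q -> `|u p - u q| <= L * `|p - q|) ->
  `|e| = 1 -> A° p -> derivable u p e -> `|'D_e u p| <= L.
Proof.
move=> uL e1 Ap; apply: derive_bound.
have [d d0 hd] := open_segment e (@open_interior _ A) Ap.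
exists d => // t td.
have := uL _ _ (interior_closure_subset (hd t td)) (interior_closure_subset Ap).
by rewrite addrAC subrr add0r normrZ e1 mulr1.
Qed.

Lemma enorm_le v (M : R) : `|v.1| <= M -> `|v.2| <= M -> enorm v <= 2 * M.
Proof.
move=> v1 v2; have M0 : 0 <= M by rewrite (le_trans _ v1).
have M2 : 0 <= 2 * M by rewrite mulr_ge0.
rewrite /enorm -[leRHS](ger0_norm M2) -sqrtr_sqr ler_wsqrtr// /dot -!expr2.
have := real_normK (num_real v.1); have := real_normK (num_real v.2).
by move=> <- <-; have := normr_ge0 v.1; have := normr_ge0 v.2; nra.
Qed.

(** A Lipschitz bound provides both the continuity and the bounded gradient; multiples of functions
    and tents enter the class this way. *)
Lemma lip_in_class A u (L : R) :
  (forall p q, closure A p -> closure A q -> `|u p - u q| <= L * `|p - q|) ->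
  concave_on (closure A) u -> (forall p, boundary A p -> u p = 0) -> in_class A u.
Proof.
move=> uL cu u0; split => //.
- apply/within_continuousP => p eps Ap eps0.
  have L1 : 0 < `|L| + 1 by rewrite ltr_wpDl.
  exists (eps / (`|L| + 1)); first exact: divr_gt0.
  move=> q Aq; rewrite ltr_pdivlMr// => qp.
  rewrite (le_lt_trans (uL _ _ Aq Ap))// (le_lt_trans _ qp)//.
  by rewrite mulrC ler_wpM2l// (le_trans (ler_norm _))// lerDl.
- apply/convex_functionP => p q t Ap Aq t01.
  by have := cu p q t Ap Aq t01; lra.
- exists (2 * L) => p Ap du; apply: enorm_le => /=.
    by apply: derive_lip uL norm_dirx Ap _; exact: diff_derivable.
  by apply: derive_lip uL norm_diry Ap _; exact: diff_derivable.
Qed.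

Lemma C1norm_le A u (C L : R) : (forall p, A p -> `|u p| <= C) ->
  (forall p q, closure A p -> closure A q -> `|u p - u q| <= L * `|p - q|) ->
  (C1norm A u <= (C + L + L)%:E)%E.
Proof.
move=> uC uL; rewrite /C1norm !EFinD; apply: leeD; first apply: leeD.
- by apply: ge_ereal_sup => _ [p /= Ap <-]; rewrite lee_fin uC.
- apply: ge_ereal_sup => _ [p /= [Ap dp] <-]; rewrite lee_fin.
  exact: derive_lip uL norm_dirx Ap dp.
- apply: ge_ereal_sup => _ [p /= [Ap dp] <-]; rewrite lee_fin.
  exact: derive_lip uL norm_diry Ap dp.
Qed.

Section fixed.
Variables (A : set (R * R)) (bodyA : convex_body A).

Lemma in_class_lip_closure u : in_class A u -> exists2 L : R, 0 <= L &
  forall p q, closure A p -> closure A q -> `|u p - u q| <= L * `|p - q|.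
Proof.
move=> uA; have [L L0 hL] := in_class_lip bodyA uA; exists L => // p q Ap Aq.
by have := hL p q; rewrite /ext !mem_set.
Qed.

Lemma in_class_bounded u : in_class A u -> exists2 C : R, 0 <= C &
  forall p, A p -> `|u p| <= C.
Proof.
move=> uA; have [_ [C [hC _]]] := nice_ext bodyA uA.
exists C => [|p Ap]; first by rewrite (le_trans _ (hC 0)).
by have := hC p; rewrite /ext mem_set//; exact: subset_closure.
Qed.

Lemma lip_scale u (L s : R) : 0 <= s ->
  (forall p q, closure A p -> closure A q -> `|u p - u q| <= L * `|p - q|) ->
  forall p q, closure A p -> closure A q -> `|s * u p - s * u q| <= s * L * `|p - q|.
Proof.
move=> s0 uL p q Ap Aq; rewrite -mulrBr normrM ger0_norm// -mulrA.
by rewrite ler_wpM2l// uL.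
Qed.

Lemma in_class_scale u (s : R) : 0 <= s -> in_class A u -> in_class A (fun p => s * u p).
Proof.
move=> s0 uA; have [L _ uL] := in_class_lip_closure uA.
apply: (lip_in_class (lip_scale s0 uL)).
  move=> p q t Ap Aq t01; have := in_class_concave uA Ap Aq t01.
  by move=> /(ler_wpM2l s0); lra.
by have [_ _ u0 _] := uA; move=> p /u0 ->; rewrite mulr0.
Qed.

Lemma weak_grad_scale u G (s : R) : 0 < s -> weak_grad A u G ->
  weak_grad A (fun p => s * u p) (fun p => s *: G p).
Proof.
move=> s0 [n1 n2 G0 [N N0 hN]]; split; [exact: niceZ|exact: niceZ| |].
  by move=> p /G0 ->; rewrite scaler0.
exists N => // p /hN[bp hp]; split=> // /hp dp eps eps0.
have [d d0 hd] := dp _ (divr_gt0 eps0 s0); exists d => // h /hd hle.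
rewrite (_ : _ - dot _ _ = s * (u (p + h) - u p - dot (G p) h)); last first.
  by rewrite /dot !vecE; ring.
by rewrite normrM (gtr0_norm s0) -ler_pdivlMl// mulrA [s^-1 * _]mulrC.
Qed.

(** A summand of an extended real sum is bounded by the sum once the others are non-negative. The
    supremum of an empty set is -oo, so a point [p1] of differentiability is exhibited to make all
    three suprema non-negative. *)
Lemma C1norm_grad u G (delta : R) : weak_grad A u G -> (C1norm A u < delta%:E)%E ->
  exists2 N, null N & forall p, ~ N p -> `|G p| < delta.
Proof.
move=> uG; have [_ _ G0 [N N0 hN]] := uG; have [_ [p0 Ap0] _] := bodyA.
have der p e : ~ N p -> A° p -> derivable u p e /\ 'D_e u p = dot (G p) e.
  by move=> Np Ap; have [_ /(_ e) h] := diff_epsP ((hN p Np).2 Ap); rewrite derive_val.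
have [p1 [Ap1 _ Np1]] := dense_notnull N0 Ap0 ltr01.
rewrite /C1norm; set S1 := ereal_sup _; set S2 := ereal_sup _; set S3 := ereal_sup _.
have S10 : (0 <= S1)%E.
  apply: (@le_trans _ _ `|u p1|%:E); first by rewrite lee_fin.
  by apply: ereal_sup_ubound; exists p1 => //; exact: interior_subset.
have S2le p : ~ N p -> A° p -> (`|(G p).1|%:E <= S2)%E.
  move=> Np Ap; have [dp De] := der p (dirx R) Np Ap.
  apply: ereal_sup_ubound; exists p => //; rewrite De /dot /=; congr (`|_|%:E); ring.
have S3le p : ~ N p -> A° p -> (`|(G p).2|%:E <= S3)%E.
  move=> Np Ap; have [dp De] := der p (diry R) Np Ap.
  apply: ereal_sup_ubound; exists p => //; rewrite De /dot /=; congr (`|_|%:E); ring.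
have S20 : (0 <= S2)%E by apply: le_trans (S2le p1 Np1 Ap1); rewrite lee_fin.
have S30 : (0 <= S3)%E by apply: le_trans (S3le p1 Np1 Ap1); rewrite lee_fin.
clearbody S1 S2 S3 => Sd.
have Sd2 : (S2 < delta%:E)%E.
  apply: le_lt_trans Sd; apply: (@le_trans _ _ (S1 + S2)%E).
    by rewrite leeDr.
  by rewrite leeDl.
have Sd3 : (S3 < delta%:E)%E.
  by apply: le_lt_trans Sd; rewrite leeDr// adde_ge0.
exists N => // p Np; have [Ap|/G0 ->] := pselect (A° p).
  rewrite norm_pairE gt_max -!lte_fin (le_lt_trans (S2le p Np Ap))//.
  exact: le_lt_trans (S3le p Np Ap) _.
by rewrite normr0 -lte_fin (le_lt_trans S20).
Qed.

Lemma hess_formE f v : hess_form f 0 v =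
  dot (hess f 0 (dirx R)) (dirx R) * (v.1 * v.1) +
  (dot (hess f 0 (dirx R)) (diry R) + dot (hess f 0 (diry R)) (dirx R)) * (v.1 * v.2) +
  dot (hess f 0 (diry R)) (diry R) * (v.2 * v.2).
Proof.
rewrite /hess_form {1}(_ : v = v.1 *: dirx R + v.2 *: diry R); last first.
  by apply: vecP; rewrite !vecE /=; ring.
by rewrite /hess linearD !linearZ /= /dot !vecE /=; ring.
Qed.

Lemma hess_formZ f v (s : R) : hess_form f 0 (s *: v) = s ^+ 2 * hess_form f 0 v.
Proof. by rewrite !hess_formE !vecE; ring. Qed.

Section grad.
Variables (u : R * R -> R) (G : R * R -> R * R) (f : R * R -> R).
Hypotheses (uA : in_class A u) (uG : weak_grad A u G).

Lemma nice_hess : nice (fun p => hess_form f 0 (G p)).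
Proof.
have [n1 n2 _ _] := uG.
rewrite (_ : (fun p => _) = fun p =>
  dot (hess f 0 (dirx R)) (dirx R) * ((G p).1 * (G p).1) +
  (dot (hess f 0 (dirx R)) (diry R) + dot (hess f 0 (diry R)) (dirx R)) * ((G p).1 * (G p).2) +
  dot (hess f 0 (diry R)) (diry R) * ((G p).2 * (G p).2)).
  by apply: niceD; [apply: niceD|]; apply: niceZ; exact: niceM.
by apply/funext => p; rewrite hess_formE.
Qed.

Lemma nice_sqr : nice (fun p => dot (G p) (G p)).
Proof. by have [n1 n2 _ _] := uG; apply: niceD; exact: niceM. Qed.

(** The linear term integrates to 0 by [Int_dot]. The parameter [c] carries the Taylor error, with
    either sign. *)
Lemma Int_taylor (c : R) :
  Int (fun p => \1_(A° : set (R * R)) p * f 0 + dot (G p) (grad f 0) +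
      (2^-1 * hess_form f 0 (G p) + c * dot (G p) (G p))) =
  functional A f (cst 0) + 2^-1 * Int (fun p => hess_form f 0 (G p))
    + c * Int (fun p => dot (G p) (G p)).
Proof.
have n0 := indic_interior_nice bodyA (f 0); have n1 := nice_dot uG (grad f 0).
have n2 := nice_hess; have n3 := nice_sqr.
have n2' := niceZ 2^-1 n2; have n3' := niceZ c n3.
rewrite (IntD (niceD n0 n1) (niceD n2' n3')) (IntD n0 n1) (IntD n2' n3').
by rewrite !IntZ// (Int_dot bodyA uA uG) addr0 functional0// addrA.
Qed.

Lemma nice_taylor (c : R) :
  nice (fun p => \1_(A° : set (R * R)) p * f 0 + dot (G p) (grad f 0) +
      (2^-1 * hess_form f 0 (G p) + c * dot (G p) (G p))).
Proof.
have n0 := indic_interior_nice bodyA (f 0); have n1 := nice_dot uG (grad f 0).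
have n2 := nice_hess; have n3 := nice_sqr.
exact: (niceD (niceD n0 n1) (niceD (niceZ _ n2) (niceZ _ n3))).
Qed.

End grad.

Variable f : R * R -> R.
Hypotheses (cf : continuous f) (df : twice_differentiable f 0).

Lemma local_min_of_coercive : (exists2 c : R, 0 < c &
    forall u G, in_class A u -> weak_grad A u G ->
      c * Int (fun p => dot (G p) (G p)) <= Int (fun p => hess_form f 0 (G p))) ->
  zero_local_min A f.
Proof.
(* The quadratic term contributes at least c/2 times the integral of |G|^2, so an error of c/4 times
   it is harmless. *)
move=> [c c0 hc]; have c4 : 0 < c / 4 by exact: divr_gt0.
have [d d0 hd] := taylor2 df c4; exists d; [exact: d0|move=> u uA ud].
have [G uG] := exists_grad bodyA uA.
have [N N0 hN] := C1norm_grad uG ud.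
have GG0 : 0 <= Int (fun p => dot (G p) (G p)) by apply: Int_ge0 => p; exact: dot_ge0.
have cGG := hc u G uA uG.
apply: (@le_trans _ _ (functional A f (cst 0) + 2^-1 * Int (fun p => hess_form f 0 (G p))
    + (- (c / 4)) * Int (fun p => dot (G p) (G p)))).
  by move: GG0 cGG; set x := Int _; set y := Int _; nra.
rewrite -(Int_taylor f uA uG) [leRHS](integral_grad uG f).
apply: (le_Int_ae (nice_taylor f uG (- (c / 4))) (nice_comp bodyA uG cf) N0) => p Np.
have := hd _ (hN p Np); rewrite indicE.
have [Ap|Ap] := pselect (A° p).
  rewrite mem_set// !mul1r ler_norml => /andP[h _].
  by rewrite [dot (G p) _](_ : _ = dot (grad f 0) (G p)); [lra|rewrite /dot; ring].
have [_ _ /(_ p Ap) -> _] := uG; rewrite memNset// !mul0r add0r => _.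
by rewrite hess_formE /dot /= !(mul0r, mulr0, addr0).
Qed.

(** One [u] with negative second variation is enough: for the multiples [s * u] the quadratic term
    and the error bound both scale like s^2, so their sum keeps its sign while the norm becomes
    small. *)
Lemma not_local_min u G : in_class A u -> weak_grad A u G ->
  Int (fun p => hess_form f 0 (G p)) < 0 -> ~ zero_local_min A f.
Proof.
move=> uA uG; set Q := Int _ => Q0 [delta delta0 hmin].
pose E := Int (fun p => dot (G p) (G p)).
have E0 : 0 <= E by apply: Int_ge0 => p; exact: dot_ge0.
(* Then [eps * E] is at most -Q/4, less than the gain -Q/2 of the quadratic term; the added 1 covers
   [E = 0]. *)
pose eps := - Q / (4 * (E + 1)).
have eps0 : 0 < eps by rewrite divr_gt0 ?oppr_gt0// mulr_gt0// ltr_wpDl.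
have [d d0 hd] := taylor2 df eps0.
have [C C0 hC] := weak_grad_bounded uG.
have [B B0 hB] := in_class_bounded uA.
have [L L0 uL] := in_class_lip_closure uA.
have C1 : 0 < C + 1 by lra.
have B1 : 0 < B + L + L + 1 by lra.
(* The first bound puts the scaled gradient in the range of the Taylor estimate, the second one puts
   the scaled function in the neighbourhood of size [delta]. *)
pose s := Num.min (d / (C + 1)) (delta / (B + L + L + 1)).
have s0 : 0 < s by rewrite lt_min !divr_gt0.
have sd : s * (C + 1) <= d by rewrite -ler_pdivlMr// ge_min lexx.
have sdelta : s * (B + L + L + 1) <= delta by rewrite -ler_pdivlMr// ge_min lexx orbT.
have suA := in_class_scale (ltW s0) uA.
have suG := weak_grad_scale s0 uG.
have /(hmin _ suA) : (C1norm A (fun p => (s * u p)%R) < delta%:E)%E.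
  apply: (le_lt_trans (C1norm_le _ (lip_scale (ltW s0) uL))) => [p Ap|].
    by rewrite normrM gtr0_norm//; apply: ler_wpM2l (hB p Ap); exact: ltW.
  by rewrite lte_fin; move: sdelta s0; lra.
apply/negP; rewrite -ltNge.
apply: (@le_lt_trans _ _ (functional A f (cst 0)
    + 2^-1 * Int (fun p => hess_form f 0 (s *: G p))
    + eps * Int (fun p => dot (s *: G p) (s *: G p)))); last first.
  have -> : (fun p => hess_form f 0 (s *: G p)) = fun p => s ^+ 2 * hess_form f 0 (G p).
    by apply/funext => p; exact: hess_formZ.
  have -> : (fun p => dot (s *: G p) (s *: G p)) = fun p => s ^+ 2 * dot (G p) (G p).
    by apply/funext => p; rewrite /dot !vecE; ring.
  rewrite !IntZ; [|exact: nice_sqr uG|exact: nice_hess uG].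
  rewrite -/Q -/E -addrA gtrDl.
  rewrite (_ : _ + _ = s ^+ 2 * (Q / 2 + eps * E)); last by ring.
  rewrite pmulr_rlt0 ?exprn_gt0//.
  have : eps * (E + 1) = - Q / 4 by rewrite /eps; field; rewrite gt_eqF// ltr_wpDl.
  by move: eps0 E0 Q0; nra.
rewrite -(Int_taylor f suA suG) [leLHS](integral_grad suG f).
apply: (le_Int (nice_comp bodyA suG cf) (nice_taylor f suG eps)) => p.
have /hd : `|s *: G p| < d.
  rewrite normrZ gtr0_norm// (lt_le_trans _ sd)// ltr_pM2l//.
  by rewrite (le_lt_trans (hC p))// ltrDl.
rewrite indicE; have [Ap|Ap] := pselect (A° p).
  rewrite mem_set// !mul1r ler_norml => /andP[_ h].
  by rewrite [dot (s *: G p) (grad f 0)](_ : _ = dot (grad f 0) (s *: G p)); [lra|rewrite /dot; ring].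
have [_ _ /(_ p Ap) -> _] := uG; rewrite memNset// !mul0r add0r => _.
by rewrite scaler0 hess_formE /dot /= !(mul0r, mulr0, addr0).
Qed.

End fixed.
End local_min.

(** * Test functions concentrated near a boundary point *)

Section tent.
Variable R : realType.
Implicit Types (p q v w e g h : R * R) (A S : set (R * R)) (u f : R * R -> R).
Local Notation mu := (@lebesgue_measure R).
Local Notation area := (mu \x mu)%E.
Local Notation plane := (measurableTypeR R * measurableTypeR R)%type.
Local Notation meas h := (measurable_fun [set: plane] h).

(* The concave function whose graph is the cone over boundary A with apex (P, 1). *)
Definition tent A P p : R := 1 - gauge A P (p - P).

Lemma tent_in_class A P : convex_set A -> A° P -> in_class A (tent A P).
Proof.
move=> cA /interior_ball[r r0 rA].
apply: (@lip_in_class _ _ _ r^-1).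
- move=> p q _ _; rewrite /tent.
  have := gauge_lip r0 cA rA (p - P) (q - P).
  rewrite (_ : p - P - (q - P) = p - q); last by apply: vecP; rewrite !vecE; ring.
  rewrite mulrC; apply: le_trans.
  by rewrite le_eqVlt -[X in X == _]normrN; apply/orP; left; apply/eqP; congr `|_|; ring.
- move=> p q t _ _ t01; rewrite /tent.
  rewrite [t *: p + _ - P](_ : _ = t *: (p - P) + (1 - t) *: (q - P)); last first.
    by apply: vecP; rewrite !vecE; ring.
  by have := gauge_convex r0 cA rA (p - P) (q - P) t01; lra.
- by move=> p; rewrite (boundary_gauge r0 cA rA) /tent /= => ->; rewrite subrr.
Qed.

(** The gauge is subadditive and at most 1 at [q - P], so a move by [t *: (q - P)] from any point
    lowers the tent by at most [t]. *)
Lemma tent_grad A P p q g : convex_set A -> A° P -> closure A q ->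
  diff_eps (tent A P) p g -> -1 <= dot g (q - P).
Proof.
move=> cA /interior_ball[r r0 rA]; rewrite (closure_gauge r0 cA rA) /= => q1 hg.
apply/ler_addgt0Pr => eps eps0.
pose k := `|q - P| + 1; have k0 : 0 < k by rewrite ltr_wpDl.
have [d d0 hd] := hg _ (divr_gt0 eps0 k0).
pose t := d / (2 * k); have t0 : 0 < t by rewrite divr_gt0// mulr_gt0.
have tk : t * k < d.
  by rewrite /t invfM mulrA divfK ?gt_eqF// ltr_pdivrMr// ltr_pMr// ltr1n.
have tq : `|t *: (q - P)| = t * `|q - P| by rewrite normrZ gtr0_norm.
have := hd (t *: (q - P)); rewrite tq => /(_ (le_lt_trans _ tk)).
rewrite ler_pM2l// lerDl => /(_ ler01).
rewrite (_ : dot g (t *: _) = t * dot g (q - P)); last by rewrite /dot !vecE; ring.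
have ke : eps / k * (t * `|q - P|) <= t * eps.
  by rewrite mulrCA ler_pM2l// mulrAC ler_pdivrMr// ler_pM2l// lerDl.
have := gaugeD r0 cA rA (p - P) (t *: (q - P)); rewrite (gaugeZ r0 rA _ (ltW t0)).
rewrite /tent [p + _ - P]addrAC ler_norml => h1 /andP[_ h2].
have h3 : t * gauge A P (q - P) <= t by rewrite ger_pMr.
by rewrite -(ler_pM2l t0); lra.
Qed.

(** The two coordinate directions, in either order and with either sign. Boxes in such a frame are
    products of intervals, whose area is known without invariance under rotations. *)
Definition axis_frame e e' :=
  ((`|e.1| = 1 /\ e.2 = 0) /\ (e'.1 = 0 /\ `|e'.2| = 1)) \/
  ((e.1 = 0 /\ `|e.2| = 1) /\ (`|e'.1| = 1 /\ e'.2 = 0)).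

Definition box P e e' (x0 x1 y0 y1 : R) : set plane :=
  [set p : R * R | x0 <= dot (p - P) e < x1 /\ y0 <= dot (p - P) e' < y1].

Lemma norm1P (s : R) : `|s| = 1 -> s = 1 \/ s = -1.
Proof. by have [|] := ger0P s => _ h; [left|right; rewrite -h opprK]. Qed.

(** A reflection exchanges the closed and the open end; [i] records which one is closed. *)
Lemma signed_itv (s c a b : R) : `|s| = 1 -> a <= b -> exists i x y,
  [/\ [set x | a <= (x - c) * s < b] = [set` Interval (BSide i x) (BSide i y)],
      x <= y & y - x = b - a].
Proof.
move=> /norm1P[] -> ab; [exists true, (c + a), (c + b)|exists false, (c - b), (c - a)].
  split; [|lra|lra]; apply/seteqP; split => x /=; rewrite in_itv /=; lra.
split; [|lra|lra]; apply/seteqP; split => x /=; rewrite in_itv /=; lra.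
Qed.

Lemma box_area P e e' (x0 x1 y0 y1 : R) : axis_frame e e' -> x0 <= x1 -> y0 <= y1 ->
  measurable (box P e e' x0 x1 y0 y1) /\
  area (box P e e' x0 x1 y0 y1) = ((x1 - x0) * (y1 - y0))%:E.
Proof.
move=> ee x01 y01.
case: ee => [[[e1 e2] [e'1 e'2]]|[[e1 e2] [e'1 e'2]]].
  have [i [a [b [E1 ab bE]]]] := signed_itv P.1 e1 x01.
  have [j [c [d [E2 cd dE]]]] := signed_itv P.2 e'2 y01.
  have -> : box P e e' x0 x1 y0 y1 =
      [set` Interval (BSide i a) (BSide i b)] `*` [set` Interval (BSide j c) (BSide j d)].
    rewrite -E1 -E2 /box /dot e2 e'1; apply/seteqP; split => p /=;
      by rewrite !mulr0 addr0 add0r.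
  by split; [apply: measurableX; exact: measurable_itv|rewrite area_box// bE dE].
have [i [a [b [E1 ab bE]]]] := signed_itv P.2 e2 x01.
have [j [c [d [E2 cd dE]]]] := signed_itv P.1 e'1 y01.
have -> : box P e e' x0 x1 y0 y1 =
    [set` Interval (BSide j c) (BSide j d)] `*` [set` Interval (BSide i a) (BSide i b)].
  rewrite -E1 -E2 /box /dot e1 e'2; apply/seteqP; split => p /=;
    by rewrite !mulr0 addr0 add0r => -[].
split; first by apply: measurableX; exact: measurable_itv.
by rewrite area_box// bE dE mulrC.
Qed.

Lemma frame_dot e e' : axis_frame e e' ->
  [/\ dot e e = 1, dot e' e' = 1, dot e e' = 0, `|e| = 1 & `|e'| = 1] /\
  forall v, v = dot v e *: e + dot v e' *: e'.
Proof.
have sq (x : R) : `|x| = 1 -> x * x = 1.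
  by move=> /norm1P[] ->; rewrite ?mulrNN mulr1.
case=> [[[h1 h2] [h3 h4]]|[[h1 h2] [h3 h4]]].
  split; first split.
  - by rewrite /dot h2 sq// mulr0 addr0.
  - by rewrite /dot h3 (sq _ h4) mulr0 add0r.
  - by rewrite /dot h2 h3 mulr0 mul0r addr0.
  - by rewrite norm_pairE h1 h2 normr0 max_l.
  - by rewrite norm_pairE h3 h4 normr0 max_r.
  move=> v; apply: vecP; rewrite !vecE /dot h2 h3 !(mulr0, addr0, add0r).
    by rewrite -mulrA sq// mulr1.
  by rewrite -mulrA sq// mulr1.
split; first split.
- by rewrite /dot h1 (sq _ h2) mulr0 add0r.
- by rewrite /dot h4 sq// mulr0 addr0.
- by rewrite /dot h1 h4 mulr0 mul0r addr0.
- by rewrite norm_pairE h1 h2 normr0 max_r.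
- by rewrite norm_pairE h3 h4 normr0 max_l.
move=> v; apply: vecP; rewrite !vecE /dot h1 h4 !(mulr0, addr0, add0r).
  by rewrite -mulrA sq// mulr1.
by rewrite -mulrA sq// mulr1.
Qed.

Lemma box_bounded P e e' (x0 x1 y0 y1 : R) : axis_frame e e' ->
  exists K : R, forall p, box P e e' x0 x1 y0 y1 p -> `|p| <= K.
Proof.
move=> /frame_dot[[_ _ _ ne ne'] eE].
exists (`|P| + (`|x0| + `|x1| + (`|y0| + `|y1|))) => p [px py].
rewrite -{1}(subrK P p) addrC (le_trans (ler_normD _ _))// lerD2l.
rewrite (eE (p - P)) (le_trans (ler_normD _ _))// !normrZ ne ne' !mulr1.
have aux (a b x : R) : a <= x < b -> `|x| <= `|a| + `|b|.
  move=> /andP[ax xb]; rewrite ler_norml; have := ler_norm (- a); rewrite normrN.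
  have := ler_norm b; have := normr_ge0 a; have := normr_ge0 b; lra.
by apply: lerD; exact: aux.
Qed.

(** The shifted indicator minus the original one is -1 on [x0, x0 + t[, where [z] is at least [k],
    and +1 on [x1, x1 + t[, where [z] vanishes. As [t < x1 - x0] the two pieces do not overlap. *)
Lemma slab_aux (x0 x1 t tau x k z : R) : 0 < t -> t < tau -> t < x1 - x0 -> 0 <= z ->
  (x0 <= x <= x0 + tau -> k <= z) -> (x1 <= x -> z = 0) ->
  ((x0 <= x - t < x1)%R)%:R * z - ((x0 <= x < x1)%R)%:R * z <=
    - k * ((x0 <= x < x0 + t)%R)%:R.
Proof.
move=> t0 t_tau t_x z0 hk h0.
have [x1x|xx1] := leP x1 x.
  rewrite h0// !mulr0 subrr; case: andP => [[_ h]|_]; last by rewrite mulr0.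
  by exfalso; lra.
case: andP => [[a1 a2]|a]; case: andP => [[b1 b2]|b]; case: andP => [[c1 c2]|c] /=;
  rewrite ?(mul1r, mul0r, mulr1, mulr0); try (by lra).
Qed.

Section box_energy.
Variables (A : set (R * R)) (u : R * R -> R) (G : R * R -> R * R).
Hypotheses (bodyA : convex_body A) (uA : in_class A u) (uG : weak_grad A u G).
Variables (P e e' : R * R) (ee : axis_frame e e').
Let w := ext A u.

Lemma ext_ge0 p : 0 <= w p.
Proof.
rewrite /w /ext; case: ifPn => // /set_mem; exact: in_class_ge0.
Qed.

Lemma nice_box (x0 x1 y0 y1 : R) : x0 <= x1 -> y0 <= y1 ->
  nice (\1_(box P e e' x0 x1 y0 y1) : R * R -> R).
Proof.
move=> x01 y01; have [m _] := box_area P ee x01 y01.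
by have [K hK] := box_bounded P x0 x1 y0 y1 ee; apply: nice_indic hK.
Qed.

Lemma Int_box (x0 x1 y0 y1 : R) : x0 <= x1 -> y0 <= y1 ->
  Int (\1_(box P e e' x0 x1 y0 y1) : R * R -> R) = (x1 - x0) * (y1 - y0).
Proof.
by move=> x01 y01; have [m a] := box_area P ee x01 y01; rewrite Int_indic// a.
Qed.

(** The integral of the derivative along [e] is exit value minus entrance value. To see this with
    areas only, translation invariance moves the difference quotient from [w] to the indicator of
    the box, where [slab_aux] applies; this is why [w] is bounded below on a slab of width [tau] and
    not just on the entrance side. *)
Lemma box_flux (x0 x1 y0 y1 kappa tau : R) : x0 < x1 -> y0 <= y1 -> 0 < tau ->
  (forall p, y0 <= dot (p - P) e' < y1 -> x0 <= dot (p - P) e <= x0 + tau -> kappa <= w p) ->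
  (forall p, y0 <= dot (p - P) e' < y1 -> x1 <= dot (p - P) e -> w p = 0) ->
  Int (fun p => \1_(box P e e' x0 x1 y0 y1) p * dot (G p) e) <= - (kappa * (y1 - y0)).
Proof.
move=> x01 y01 tau0 hk h0; set B := box _ _ _ _ _ _ _.
have mB : measurable B by have [] := box_area P ee (ltW x01) y01.
have mi : meas (\1_B : R * R -> R) by exact: measurable_indic.
have [[de _ dee' _ _] _] := frame_dot ee.
have nw := nice_ext bodyA uA.
have cv := quot_limit bodyA uA uG (e := e) mi (indic_bound B).
rewrite -(cvg_lim (@Rhausdorff R) cv); apply: limr_le.
  by apply/cvg_ex; eexists; exact: cv.
have m0 : 0 < Num.min tau (x1 - x0) by rewrite lt_min tau0 subr_gt0.
have := @near_infty_natSinv_lt R (PosNum m0); apply: filterS => n /=.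
rewrite lt_min => /andP[t_tau t_x].
set t := n.+1%:R^-1 in t_tau t_x; have t0 : 0 < t by rewrite invr_gt0.
have nB1 : nice (fun p => \1_B p * w p) by exact: nice_mull mi (indic_bound B) nw.
have nB2 : nice (fun p => \1_B (p - t *: e) * w p).
  apply: (nice_mull _ (fun p => indic_bound B (p - t *: e)) nw).
  exact: (measurableT_comp mi (measurable_translation (- (t *: e)))).
have -> : Int (fun p => \1_B p * quot (ext A u) e n p) =
    t^-1 * Int (fun p => \1_B (p - t *: e) * w p - \1_B p * w p).
  rewrite IntB// -(Int_translation (t *: e) nB2) -IntB//; last exact: nice_translation nB2.
  rewrite -IntZ; last by apply: niceB => //; exact: nice_translation nB2.
  congr Int; apply/funext => p; rewrite addrK /quot invrK -/t -/w; ring.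
rewrite ler_pdivrMl//.
have nS : nice (\1_(box P e e' x0 (x0 + t) y0 y1) : R * R -> R).
  by apply: nice_box => //; rewrite lerDl ltW.
have -> : t * - (kappa * (y1 - y0)) = - kappa * Int (\1_(box P e e' x0 (x0 + t) y0 y1)).
  by rewrite Int_box ?lerDl ?(ltW t0)//; ring.
rewrite -IntZ//; apply: le_Int; [exact: niceB|exact: niceZ|] => p.
rewrite !indicE.
have Ep : dot (p - t *: e - P) e = dot (p - P) e - t.
  by rewrite -[X in _ = _ - X]mulr1 -de /dot !vecE; ring.
have Ep' : dot (p - t *: e - P) e' = dot (p - P) e'.
  by rewrite -[RHS]subr0 -[X in _ = _ - X](mulr0 t) -dee' /dot !vecE; ring.
have wp := ext_ge0 p.
have [py|py] := pselect (y0 <= dot (p - P) e' < y1); last first.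
  by rewrite !memNset ?mul0r ?subrr ?mulr0//= => -[_]; rewrite ?Ep'.
have inB (x : R) : (p - t *: e \in B) = (x0 <= dot (p - P) e - t < x1).
  apply/idP/idP => [/set_mem[]|h]; first by rewrite Ep.
  by apply/mem_set; split; rewrite ?Ep ?Ep'.
have inB' (x : R) : (p \in B) = (x0 <= dot (p - P) e < x1).
  by apply/idP/idP => [/set_mem[]|h]//; apply/mem_set; split.
have inS : (p \in box P e e' x0 (x0 + t) y0 y1) = (x0 <= dot (p - P) e < x0 + t).
  by apply/idP/idP => [/set_mem[]|h]//; apply/mem_set; split.
rewrite (inB 0) (inB' 0) inS; apply: slab_aux t0 t_tau t_x wp _ _.
  exact: hk.
exact: h0.
Qed.

(** Cauchy-Schwarz: the square of the flux is at most the area of the box times the energy in it. *)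
Lemma box_energy (x0 x1 y0 y1 kappa tau : R) : x0 < x1 -> y0 <= y1 -> 0 < tau ->
  0 < kappa ->
  (forall p, y0 <= dot (p - P) e' < y1 -> x0 <= dot (p - P) e <= x0 + tau -> kappa <= w p) ->
  (forall p, y0 <= dot (p - P) e' < y1 -> x1 <= dot (p - P) e -> w p = 0) ->
  kappa ^+ 2 * (y1 - y0) / (x1 - x0) <=
    Int (fun p => \1_(box P e e' x0 x1 y0 y1) p * dot (G p) e ^+ 2).
Proof.
move=> x01 y01 tau0 k0 hk h0; have := box_flux x01 y01 tau0 hk h0.
have := Int_box (ltW x01) y01; have := nice_box (ltW x01) y01.
set B := box _ _ _ _ _ _ _ => nB IBx Iflux.
have d0 : 0 < x1 - x0 by rewrite subr_gt0.
(* Cauchy-Schwarz comes from integrating [0 <= (dot (G p) e + s) ^+ 2] over the box; [- s] is the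
   mean derivative when the flux bound is sharp. *)
pose s := kappa / (x1 - x0); have s0 : 0 < s by exact: divr_gt0.
have nd : nice (fun p => \1_B p * dot (G p) e) by apply: niceM nB (nice_dot uG e).
apply: (@le_trans _ _ (Int (fun p => (- (2 * s)) * (\1_B p * dot (G p) e) - s ^+ 2 * \1_B p))).
  rewrite IntB; [|exact: niceZ|exact: niceZ]; rewrite !IntZ// IBx.
  rewrite (_ : _ / _ = 2 * s * (kappa * (y1 - y0)) - s ^+ 2 * ((x1 - x0) * (y1 - y0))); last first.
    by rewrite /s; field; rewrite gt_eqF.
  have s2 : 0 <= 2 * s by rewrite mulr_ge0// ltW.
  by have := ler_wpM2l s2 Iflux; rewrite lerD2r mulNr lerNr; lra.
apply: le_Int; [by apply: niceB; exact: niceZ|exact: niceM nB (nice_dotX uG e)|] => p.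
rewrite indicE; case: (p \in B); rewrite /= ?(mul1r, mul0r, mulr0, subrr)//.
by have := sqr_ge0 (dot (G p) e + s); lra.
Qed.

End box_energy.

Lemma axis_frame_exists n v : n != 0 -> exists e e',
  [/\ axis_frame e e', 0 < dot n e & 0 <= dot v e'].
Proof.
move=> n0; pose sg (x : R) : R := if 0 <= x then 1 else -1.
have sg1 x : `|sg x| = 1 by rewrite /sg; case: ifP; rewrite ?normrN normr1.
have sgx x : x * sg x = `|x|.
  by rewrite /sg; case: ger0P => _; rewrite ?mulr1 ?mulrN1.
have [n1|n1] := eqVneq n.1 0.
  exists (0, sg n.2), (sg v.1, 0); split; first by right; do 2!split => //=.
    rewrite /dot /= mulr0 add0r sgx normr_gt0; apply: contraNneq n0 => n2.
    by apply/eqP/vecP.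
  by rewrite /dot /= mulr0 addr0 sgx.
exists (sg n.1, 0), (0, sg v.2); split; first by left; do 2!split => //=.
  by rewrite /dot /= mulr0 addr0 sgx normr_gt0.
by rewrite /dot /= mulr0 add0r sgx.
Qed.

(* The energy in the N boxes P0 + t_k * [x0, x1) * [y0, y1), t_k = (y0/y1)^k / 4,
   is bounded below independently of k, so it diverges as the apex tends to P0. *)
Lemma tent_energy A P0 q0 (Z d1 : R) : convex_body A -> boundary A P0 -> A° q0 ->
  0 < d1 -> exists2 delta, 0 < delta < d1 & A° (P0 + delta *: (q0 - P0)) /\
    forall G, weak_grad A (tent A (P0 + delta *: (q0 - P0))) G ->
      Z <= Int (fun p => dot (G p) (G p)).
Proof.
move=> bodyA bP0 Aq0 d10; have [cA A0 _] := bodyA.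
have [n nq nle] := support cA Aq0 bP0.
have n0 : n != 0.
  apply/eqP => n0; move: nq; rewrite n0 /dot /= !mul0r addr0 => /eqP.
  by rewrite eq_sym oppr_eq0 oner_eq0.
set v0 := q0 - P0 in nq *.
(* [0 < dot n e] makes lines in direction [e] leave the supporting half-plane, so the tent must fall
   to 0 along them; [0 <= dot v0 e'] puts the interior ball, raised by [rho], at positive height
   along [e']. *)
have [e [e' [ee ne ve']]] := axis_frame_exists v0 n0.
have [[de de' dee' ne1 ne'1] eE] := frame_dot ee.
have [r r0 rA] := interior_ball_interior Aq0.
pose rho := r / 2; have rho0 : 0 < rho by exact: divr_gt0.
pose z0 := v0 + rho *: e'.
pose x0 := dot z0 e; pose y0 := dot z0 e'.
have y00 : 0 < y0.
  by rewrite /y0 /z0 (_ : dot _ _ = dot v0 e' + rho * dot e' e');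
    [rewrite de'; lra|rewrite /dot !vecE; ring].
pose y1 := y0 + rho / 8; have y01 : y0 < y1 by rewrite /y1; lra.
pose tau := rho / 8; have tau0 : 0 < tau by exact: divr_gt0.
pose x1 := `|x0| + tau + `|dot n e'| * y1 / dot n e + 1.
have y10 : 0 < y1 by exact: lt_trans y01.
have x01 : x0 < x1.
  have : 0 <= `|dot n e'| * y1 / dot n e by rewrite divr_ge0 ?(ltW ne)// mulr_ge0 ?(ltW y10).
  by have := ler_norm x0; rewrite /x1; lra.
have out (x y : R) : x1 <= x -> 0 <= y -> y < y1 -> 0 < x * dot n e + y * dot n e'.
  move=> xx1 y_ge0 yy1; have : `|dot n e'| * y1 < x * dot n e.
    have : `|dot n e'| * y1 / dot n e < x by have := normr_ge0 x0; rewrite /x1 in xx1; lra.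
    by rewrite ltr_pdivrMr.
  have : - `|dot n e'| <= dot n e' by rewrite lerNl -normrN ler_norm.
  by move=> h; have := ler_wpM2l y_ge0 h; have := normr_ge0 (dot n e'); nra.
pose c := (1 / 2) ^+ 2 * (y1 - y0) / (x1 - x0).
have c0 : 0 < c by rewrite divr_gt0 ?subr_gt0// mulr_gt0 ?exprn_gt0 ?subr_gt0//; lra.
pose N := Num.bound (`|Z| / c).
have ZN : Z <= N%:R * c.
  rewrite -ler_pdivrMr// (le_trans (ler_norm _))// normrM normfV (gtr0_norm c0).
  by apply/ltW/archi_boundP; rewrite divr_ge0// ltW.
(* With this ratio [t k.+1 * y1 = t k * y0]: each half-open box ends where the previous one begins,
   so the boxes are disjoint. *)
pose lam := y0 / y1; have lam0 : 0 < lam by exact: divr_gt0.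
have lam1 : lam <= 1 by rewrite ler_pdivrMr// mul1r ltW.
pose t k : R := lam ^+ k / 4.
have t0 k : 0 < t k by rewrite divr_gt0// exprn_gt0.
have t4 k : t k <= 1 / 4 by rewrite ler_pM2r// exprn_ile1// ltW.
have tN k : (k <= N)%N -> t N <= t k by move=> kN; rewrite ler_pM2r// ler_wiXn2l// ltW.
have tS k : t k.+1 * y1 = t k * y0.
  by rewrite /t exprS /lam; field; rewrite gt_eqF.
pose V := `|v0| + 1; have V0 : 0 < V by rewrite ltr_wpDl.
(* The last bound makes the offset of the apex from [P0] small compared with the smallest scale
   [t N], so that all [N] boxes see the apex as if it were at [P0]. *)
pose delta := Num.min (1 / 2) (Num.min (d1 / 2) (rho * t N / V)).
have delta0 : 0 < delta by rewrite !lt_min !divr_gt0// mulr_gt0.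
have delta1 : delta <= 1 / 2 by rewrite ge_min lexx.
have deltad : delta <= d1 / 2 by rewrite !ge_min lexx orbT.
have deltaN : delta * V <= rho * t N by rewrite -ler_pdivlMr// !ge_min lexx !orbT.
exists delta; first by rewrite delta0; lra.
set P := P0 + delta *: v0.
have AP : A° P.
  rewrite (_ : P = (1 - delta) *: P0 + (1 - (1 - delta)) *: q0).
    by apply: (closure_interior_convex cA bP0.1 Aq0); lra.
  by rewrite /P /v0; apply: vecP; rewrite !vecE; ring.
split=> // G uG.
have uA := tent_in_class cA AP.
have nG := nice_sqr uG; have nd := nice_dotX uG e.
have boxk k : (k < N)%N -> c <= Int (fun p =>
    \1_(box P0 e e' (t k * x0) (t k * x1) (t k * y0) (t k * y1)) p * dot (G p) e ^+ 2).
  move=> kN; have tk0 := t0 k.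
  have -> : c = (1 / 2) ^+ 2 * (t k * y1 - t k * y0) / (t k * x1 - t k * x0).
    rewrite /c -!mulrBr; field; rewrite !gt_eqF// ?mulr_gt0 ?subr_gt0//.
  apply: (box_energy bodyA uA uG ee (tau := t k * tau)).
  - by rewrite ltr_pM2l.
  - by rewrite ler_pM2l// ltW.
  - exact: mulr_gt0.
  - lra.
  - move=> p /andP[py1 py2] /andP[px1 px2].
    pose z := (t k)^-1 *: (p - P0).
    have zx : x0 <= dot z e <= x0 + tau.
      rewrite (_ : dot z e = (t k)^-1 * dot (p - P0) e); last by rewrite /z /dot !vecE; ring.
      by rewrite ler_pdivlMl// ler_pdivrMl// px1 mulrDr.
    have zy : y0 <= dot z e' <= y1.
      rewrite (_ : dot z e' = (t k)^-1 * dot (p - P0) e'); last by rewrite /z /dot !vecE; ring.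
      by rewrite ler_pdivlMl// ler_pdivrMl// py1 ltW.
    have pE : p = P0 + t k *: z.
      by rewrite /z scalerA divff ?gt_eqF// scale1r addrC subrK.
    have zz0 : `|z - z0| <= rho / 4.
      rewrite (eE (z - z0)) (le_trans (ler_normD _ _))// !normrZ ne1 ne'1 !mulr1.
      rewrite (_ : dot (z - z0) e = dot z e - x0); last by rewrite /x0 /dot !vecE; ring.
      rewrite (_ : dot (z - z0) e' = dot z e' - y0); last by rewrite /y0 /dot !vecE; ring.
      have h1 : `|dot z e - x0| <= rho / 8 by rewrite ler_norml; rewrite /tau in zx; lra.
      have h2 : `|dot z e' - y0| <= rho / 8 by rewrite ler_norml; rewrite /y1 in zy; lra.
      lra.
    have dt : delta / (2 * t k) * `|v0| <= rho / 2.
      have tk2 : 0 < 2 * t k by rewrite mulr_gt0.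
      rewrite mulrAC ler_pdivrMr//.
      have : delta * `|v0| <= delta * V by rewrite ler_pM2l// lerDl.
      have := ler_wpM2l (ltW rho0) (tN k (ltnW kN)); lra.
    (* [a] is within 7/4 of [rho], hence less than [r], from [q0]. The point P + 2 (p - P) is a
       convex combination of [P0] and [a] with weight [2 * t k] on [a]; it is interior, so the gauge
       at [p - P] is at most 1/2 and the tent at [p] at least 1/2. *)
    pose a := P0 + z - (delta / (2 * t k)) *: v0.
    have Aa : A° a.
      apply: rA; rewrite (_ : a - q0 = (z - z0) + (rho *: e' - (delta / (2 * t k)) *: v0)).
        have : `|z - z0 + (rho *: e' - (delta / (2 * t k)) *: v0)| <=
            `|z - z0| + (`|rho *: e'| + `|(delta / (2 * t k)) *: v0|).
          by rewrite (le_trans (ler_normD _ _))// lerD2l ler_normB.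
        have -> : `|rho *: e'| = rho by rewrite normrZ ne'1 mulr1 gtr0_norm.
        have -> : `|(delta / (2 * t k)) *: v0| = delta / (2 * t k) * `|v0|.
          by rewrite normrZ gtr0_norm// divr_gt0// mulr_gt0.
        by move: zz0 dt rho0; rewrite /rho; lra.
      by rewrite /a /z0 /v0; apply: vecP; rewrite !vecE; ring.
    have Ab : A° (P + (1 / 2)^-1 *: (p - P)).
      rewrite (_ : _ + _ = (1 - 2 * t k) *: P0 + (1 - (1 - 2 * t k)) *: a).
        by apply: (closure_interior_convex cA bP0.1 Aa); have := t4 k; lra.
      rewrite /a pE /P; apply: vecP; rewrite !vecE; field; rewrite gt_eqF//.
    have [rP rP0 rPA] := interior_ball AP.
    have half0 : 0 < 1 / 2 :> R by lra.
    have gP := gauge_le rP0 rPA half0 (interior_subset Ab).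
    rewrite /ext ifT; first by rewrite /tent; lra.
    by rewrite inE (closure_gauge rP0 cA rPA) /=; lra.
  - move=> p /andP[py1 py2] px; apply: ext_out => /nle; apply/negP; rewrite -ltNge.
    have -> : dot n (p - P0) = t k * ((t k)^-1 * dot (p - P0) e * dot n e
        + (t k)^-1 * dot (p - P0) e' * dot n e').
      rewrite {1}(eE (p - P0)).
      rewrite (_ : dot n _ = dot (p - P0) e * dot n e + dot (p - P0) e' * dot n e').
        by field; rewrite gt_eqF.
      by rewrite /dot !vecE; ring.
    rewrite mulr_gt0// out//.
    + by rewrite ler_pdivlMl.
    + by rewrite mulr_ge0 ?invr_ge0 ?ltW// (lt_le_trans _ py1)// mulr_gt0.
    + by rewrite ltr_pdivrMl.
(* The half-plane [H k] misses the k-th box and contains all earlier ones, and [H k.+1] contains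
   both; this organises the summation of the energies. *)
pose H (k : nat) : set plane := [set p : R * R | t k * y1 <= dot (p - P0) e'].
have mH k : measurable (H k).
  have cH : continuous (fun p : R * R => dot (p - P0) e').
    apply: (@lipschitz_continuous _ _ (2 * `|e'|)) => p q.
    rewrite (_ : _ - _ = dot e' (p - q)); last by rewrite /dot !vecE; ring.
    by rewrite (le_trans (dot_bound _ _))// mulrA.
  rewrite (_ : H k = ~` [set p : R * R | dot (p - P0) e' < t k * y1]); last first.
    by apply/seteqP; split=> p /=; rewrite /H /= leNgt => /negP.
  apply: measurableC; apply: open_measurable_plane.
  apply: (@open_comp _ _ (fun p : R * R => dot (p - P0) e') [set x | x < t k * y1]).
    by move=> p _; exact: cH.
  exact: open_lt.
have nH k : nice (fun p => \1_(H k) p * dot (G p) e ^+ 2).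
  by apply: (@nice_mull _ _ 1 _ _ _ nd); [exact: measurable_indic|exact: indic_bound].
have IH k : (k <= N)%N -> k%:R * c <= Int (fun p => \1_(H k) p * dot (G p) e ^+ 2).
  elim: k => [_|k IHk kN].
    by rewrite mul0r; apply: Int_ge0 => p; rewrite mulr_ge0// ?sqr_ge0// indicE.
  have nB : nice (fun p => \1_(box P0 e e' (t k * x0) (t k * x1) (t k * y0) (t k * y1)) p
      * dot (G p) e ^+ 2).
    apply: niceM nd; apply: nice_box => //; rewrite ler_pM2l//; exact: ltW.
  rewrite -addn1 natrD mulrDl mul1r.
  apply: (le_trans (lerD (IHk (ltnW kN)) (boxk k kN))); rewrite addn1 -IntD//.
  apply: le_Int => //; first exact: niceD.
  move=> p; rewrite -mulrDl ler_wpM2r ?sqr_ge0// !indicE.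
  case: (boolP (p \in H k)) => [/set_mem pH|pH].
    have -> : (p \in box P0 e e' (t k * x0) (t k * x1) (t k * y0) (t k * y1)) = false.
      by apply/negP => /set_mem[_ /andP[_]]; rewrite ltNge pH.
    rewrite addr0 mem_set// /H /= tS (le_trans _ pH)// ler_pM2l// ltW//.
  rewrite add0r; case: (boolP (p \in box _ _ _ _ _ _ _)) => [/set_mem[_ /andP[h _]]|_]//.
  by rewrite mem_set// /H /= tS.
apply: (le_trans ZN); apply: (le_trans (IH N (leqnn N))).
apply: le_Int => // p.
have : dot (G p) e ^+ 2 <= dot (G p) (G p).
  have -> : dot (G p) (G p) = dot (G p) e ^+ 2 + dot (G p) e' ^+ 2.
    rewrite {2}(eE (G p)).
    rewrite (_ : dot (G p) (_ + _) = dot (G p) e * dot (G p) e + dot (G p) e' * dot (G p) e').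
      by ring.
    by rewrite /dot !vecE; ring.
  by rewrite lerDl sqr_ge0.
rewrite indicE; case: (p \in H N); rewrite ?mul1r ?mul0r// => _.
exact: dot_ge0.
Qed.

End tent.

(** * Eigendirections and the ratio of energies *)

Section final.
Variable R : realType.
Implicit Types (p q v w e g h : R * R) (A S l : set (R * R)) (u f : R * R -> R).

Lemma convex_bodyP A : bounded_set A -> convex_set A -> A° !=set0 -> convex_body A.
Proof.
move=> [M [_ hM]] cA A0; split => //; exists (M + 1) => p Ap.
by apply: hM => //; rewrite ltrDl.
Qed.

Lemma orthonormal_decomp em ep v : orthonormal_pair em ep ->
  v = dot v em *: em + dot v ep *: ep.
Proof.
move=> [mm pp mp].
(* The determinant of the pair: [ep] is [d] times [em] turned by a right angle, and [d ^+ 2 = 1]. *)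
pose d := em.1 * ep.2 - em.2 * ep.1.
have ep2 : ep.2 = d * em.1.
  transitivity (ep.2 * dot em em - em.2 * dot em ep); last by rewrite /d /dot; ring.
  by rewrite mm mp mulr0 subr0 mulr1.
have ep1 : ep.1 = - (d * em.2).
  transitivity (ep.1 * dot em em - em.1 * dot em ep); last by rewrite /d /dot; ring.
  by rewrite mm mp mulr0 subr0 mulr1.
have dd : d ^+ 2 = 1.
  by rewrite -pp -[LHS]mulr1 -mm /dot ep1 ep2; ring.
have mm' : em.1 * em.1 = 1 - em.2 * em.2 by rewrite -mm /dot; ring.
apply: vecP; rewrite !vecE /dot ep1 ep2.
  transitivity (v.1 * (em.1 * em.1 + d ^+ 2 * (em.2 * em.2)) + v.2 * (em.1 * em.2) * (1 - d ^+ 2)).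
    by rewrite dd mm'; ring.
  by ring.
transitivity (v.2 * (em.2 * em.2 + d ^+ 2 * (em.1 * em.1)) + v.1 * (em.1 * em.2) * (1 - d ^+ 2)).
  by rewrite dd mm'; ring.
by ring.
Qed.

Lemma orthonormal_dot em ep v w : orthonormal_pair em ep ->
  dot v w = dot v em * dot w em + dot v ep * dot w ep.
Proof.
move=> o; rewrite {1}(orthonormal_decomp w o) /dot !vecE; ring.
Qed.

Lemma hess_form_eigen f (a b : R) em ep v : orthonormal_pair em ep ->
  hess f 0 em = - a *: em -> hess f 0 ep = b *: ep ->
  hess_form f 0 v = - a * dot v em ^+ 2 + b * dot v ep ^+ 2.
Proof.
move=> o hm hp; rewrite /hess_form {1}(orthonormal_decomp v o).
rewrite /hess linearD !linearZ /= -!/(hess f 0 _) hm hp /dot !vecE; ring.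
Qed.

Lemma quadratic_coercive (al be ga : R) :
  (forall v, v != 0 -> 0 < al * (v.1 * v.1) + be * (v.1 * v.2) + ga * (v.2 * v.2)) ->
  exists2 c, 0 < c & forall v, c * dot v v <= al * (v.1 * v.1) + be * (v.1 * v.2) + ga * (v.2 * v.2).
Proof.
move=> pos.
have al0 : 0 < al.
  have /pos /= : (1, 0) != 0 :> R * R by apply/eqP => -[/eqP]; rewrite oner_eq0.
  by rewrite !(mulr0, mulr1, addr0).
have ga0 : 0 < ga.
  have /pos /= : (0, 1) != 0 :> R * R by apply/eqP => -[/eqP]; rewrite oner_eq0.
  by rewrite !(mulr0, mul0r, mulr1, add0r).
have disc : 0 < 4 * al * ga - be ^+ 2.
  have /pos /= : (- be, 2 * al) != 0 :> R * R.
    by apply/eqP => -[_ /eqP]; rewrite mulf_eq0 (gt_eqF al0) pnatr_eq0.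
  rewrite (_ : _ + _ = al * (4 * al * ga - be ^+ 2)); last by ring.
  by rewrite pmulr_rgt0.
(* Determinant over trace of the form, a lower bound for its least eigenvalue. With this [c] the
   discriminant of the reduced form is 4 c^2, which completes the square below. *)
pose c := (4 * al * ga - be ^+ 2) / (4 * (al + ga)).
have ag0 : 0 < 4 * (al + ga) by rewrite mulr_gt0 ?addr_gt0.
have c0 : 0 < c by exact: divr_gt0.
have ce : c * (4 * (al + ga)) = 4 * al * ga - be ^+ 2 by rewrite /c divfK// gt_eqF.
have cal : c < al.
  rewrite -(ltr_pM2r ag0) ce; have := sqr_ge0 be; have := mulr_gt0 al0 al0; lra.
clearbody c; exists c => // v; rewrite -subr_ge0 -(pmulr_rge0 _ (_ : 0 < 4 * (al - c))); last by lra.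
rewrite [leRHS](_ : _ = (2 * (al - c) * v.1 + be * v.2) ^+ 2 +
    (4 * al * ga - be ^+ 2 - c * (4 * (al + ga)) + 4 * c ^+ 2) * v.2 ^+ 2); last first.
  by rewrite /dot; ring.
rewrite ce subrr add0r addr_ge0 ?sqr_ge0// mulr_ge0 ?sqr_ge0// mulr_ge0 ?sqr_ge0//.
Qed.

Section body.
Variable A : set (R * R).
Hypothesis bodyA : convex_body A.

Lemma dir_energy_gt0 u e p : in_class A u -> e != 0 -> closure A p -> u p != 0 ->
  0 < dir_energy A e u.
Proof.
move=> uA e0 Ap up; have [G uG] := exists_grad bodyA uA.
rewrite lt_neqAle (dir_energyE uG); apply/andP; split; last first.
  by apply: Int_ge0 => q; exact: sqr_ge0.
apply: contra up => /eqP E0; apply/eqP.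
by apply: (dir_energy_eq0 bodyA uA uG e0 _ Ap); rewrite (dir_energyE uG) -E0.
Qed.

(** Covers the zero function, which is excluded from the supremum [Kconst]. Where [u] is 0, testing
    differentiability along the gradient itself forces the gradient to vanish. *)
Lemma Int_zero u G (k : R * R -> R) : weak_grad A u G -> nice k ->
  (forall p, A p -> u p = 0) -> (forall p, G p = 0 -> k p = 0) -> Int k = 0.
Proof.
move=> [_ _ G0 [N N0 hN]] nk u0 k0.
transitivity (Int (fun p => 0 * k p)); last by rewrite IntZ// mul0r.
apply: (Int_ae_eq nk (niceZ 0 nk) N0) => p Np; rewrite mul0r; apply: k0.
have [Ap|/G0//] := pselect (A° p).
have dG := (hN p Np).2 Ap; set g := G p in dG *.
have [s s0 hs] := open_segment g (@open_interior _ A) Ap.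
suff gg : dot g g <= 0.
  have := dot_norm g => /le_trans/(_ gg); rewrite -[X in _ <= X](expr0n _ 2).
  by rewrite ler_pXn2r ?nnegrE// normr_le0 => /eqP.
apply/ler_addgt0Pr => eps eps0; rewrite add0r.
have g1 : 0 < `|g| + 1 by rewrite ltr_wpDl.
have [d d0 hd] := dG _ (divr_gt0 eps0 g1).
pose t := Num.min (s / 2) (d / 2 / (`|g| + 1)).
have t0 : 0 < t by rewrite lt_min !divr_gt0.
have ts : t <= s / 2 by rewrite ge_min lexx.
have td : t * (`|g| + 1) <= d / 2 by rewrite -ler_pdivlMr// ge_min lexx orbT.
have := hd (t *: g); rewrite normrZ (gtr0_norm t0) => /(_ _).
rewrite !u0 ?subrr; last 2 first.
- by apply: interior_subset; exact: Ap.
- by apply: interior_subset; apply: hs; rewrite gtr0_norm//; lra.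
rewrite sub0r normrN (_ : dot g (t *: g) = t * dot g g); last by rewrite /dot !vecE; ring.
move=> h; have {h} := h (_ : t * `|g| < d).
have tg : t * `|g| < d by lra.
move=> /(_ tg) /(le_trans (ler_norm _)) h.
rewrite -(ler_pM2l t0); apply: (le_trans h).
by rewrite mulrCA ler_pM2l// mulrAC ler_pdivrMr// ler_pM2l// lerDl.
Qed.

Section eigen.
Variables (f : R * R -> R) (a b : R) (em ep : R * R).
Hypotheses (cf : continuous f) (df : twice_differentiable f 0).
Hypotheses (a0 : 0 < a) (b0 : 0 < b) (o : orthonormal_pair em ep).
Hypotheses (hm : hess f 0 em = - a *: em) (hp : hess f 0 ep = b *: ep).

Lemma Int_hess_eigen u G : weak_grad A u G -> Int (fun p => hess_form f 0 (G p)) =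
  - a * dir_energy A em u + b * dir_energy A ep u.
Proof.
move=> uG; rewrite !(dir_energyE uG).
have nm := nice_dotX uG em; have np := nice_dotX uG ep.
rewrite -!IntZ// -IntD; [|exact: niceZ|exact: niceZ].
by congr Int; apply/funext => p; exact: hess_form_eigen.
Qed.

Lemma Int_sqr_eigen u G : weak_grad A u G -> Int (fun p => dot (G p) (G p)) =
  dir_energy A em u + dir_energy A ep u.
Proof.
move=> uG; rewrite !(dir_energyE uG) -IntD; [|exact: nice_dotX uG _|exact: nice_dotX uG _].
by congr Int; apply/funext => p; rewrite (orthonormal_dot _ _ o) !expr2.
Qed.

Lemma unit_neq0 e : dot e e = 1 -> e != 0.
Proof.
move=> ee; apply/eqP => e0; move: ee; rewrite e0 /dot /= !mulr0 addr0 => /eqP.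
by rewrite eq_sym oner_eq0.
Qed.

(** With a real bound k < b/a for all ratios, the second variation is at least (b - a k) times the
    energy along [ep], and the total energy is at most 1 + k times the latter. The quotient is the
    coercivity constant. *)
Lemma small_ratio_local_min : (Kconst A em ep < (b / a)%:E)%E -> zero_local_min A f.
Proof.
move=> Kba; apply: (local_min_of_coercive bodyA cf df).
have [_ pp _] := o.
have [k [k0 kba hk]] : exists k : R, [/\ 0 <= k, k < b / a & forall u, in_class A u ->
    (exists2 p, A p & u p != 0) -> dir_energy A em u / dir_energy A ep u <= k].
  have hle u : in_class A u -> (exists2 p, A p & u p != 0) ->
      ((dir_energy A em u / dir_energy A ep u)%:E <= Kconst A em ep)%E.
    by move=> uA unz; apply: ereal_sup_ubound; exists u.
  case: (Kconst A em ep) Kba hle => [k| |]; rewrite ?lte_fin => kba hle //.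
    exists (Num.max 0 k); split; first by rewrite le_max lexx.
      by rewrite gt_max divr_gt0.
    by move=> u uA unz; have := hle u uA unz; rewrite lee_fin le_max orbC => ->.
  exists 0; split => //; first exact: divr_gt0.
  by move=> u uA unz; have := hle u uA unz.
have bak : 0 < b - a * k by rewrite subr_gt0 mulrC -ltr_pdivlMr.
have k1 : 0 < 1 + k by lra.
exists ((b - a * k) / (1 + k)); first exact: divr_gt0.
move=> u G uA uG; have [unz|uz] := pselect (exists2 p, A p & u p != 0); last first.
  have u0 p : A p -> u p = 0.
    by move=> Ap; apply/eqP/negPn/negP => up; apply: uz; exists p.
  rewrite (Int_zero uG (nice_sqr uG) u0); last by move=> p ->; rewrite /dot /= !mul0r addr0.
  rewrite (Int_zero uG (nice_hess f uG) u0) ?mulr0// => p ->.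
  by rewrite hess_formE /= !(mul0r, mulr0, addr0).
have Ep0 : 0 < dir_energy A ep u.
  case: unz => p /subset_closure Ap up.
  exact: dir_energy_gt0 uA (unit_neq0 pp) Ap up.
have := hk u uA unz; rewrite ler_pdivrMr// => Ek.
rewrite (Int_sqr_eigen uG) (Int_hess_eigen uG) mulrAC ler_pdivrMr//.
have h1 : dir_energy A em u + dir_energy A ep u <= (1 + k) * dir_energy A ep u by lra.
have := ler_wpM2l (ltW bak) h1.
have h2 : (b - a * k) * dir_energy A ep u <= - a * dir_energy A em u + b * dir_energy A ep u.
  by have := ler_wpM2l (ltW a0) Ek; lra.
by have := ler_wpM2r (ltW k1) h2; lra.
Qed.

Lemma large_ratio_not_local_min : ((b / a)%:E < Kconst A em ep)%E -> ~ zero_local_min A f.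
Proof.
move=> /ereal_sup_gt[_ [u [uA unz] <-]]; rewrite lte_fin => ba.
have [G uG] := exists_grad bodyA uA; apply: (not_local_min bodyA cf df uA uG).
have [_ pp _] := o.
have Ep0 : 0 < dir_energy A ep u.
  case: unz => p /subset_closure Ap up.
  exact: dir_energy_gt0 uA (unit_neq0 pp) Ap up.
move: ba; rewrite ltr_pdivlMr// mulrAC ltr_pdivrMr// => h.
by rewrite (Int_hess_eigen uG); lra.
Qed.

End eigen.
End body.
End final.

(** * Lines of support that are not angular *)

Section flat.
Variable R : realType.
Implicit Types (p q v w e g h : R * R) (A S l : set (R * R)) (u f : R * R -> R).

Lemma dotBl p q e : dot (p - q) e = dot p e - dot q e.
Proof. by rewrite /dot !vecE; ring. Qed.

Lemma dotNr p e : dot p (- e) = - dot p e.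
Proof. by rewrite /dot !vecE; ring. Qed.

Lemma dotC p q : dot p q = dot q p.
Proof. by rewrite /dot mulrC [p.2 * _]mulrC. Qed.

Lemma dot_continuous q e : continuous (fun p : R * R => dot (p - q) e).
Proof.
apply: (@lipschitz_continuous _ _ (2 * `|e|)) => p z.
rewrite (_ : _ - _ = dot e (p - z)); last by rewrite /dot !vecE; ring.
by rewrite (le_trans (dot_bound _ _))// mulrA.
Qed.

Lemma orthonormal_pairN em ep (s t : R) : `|s| = 1 -> `|t| = 1 ->
  orthonormal_pair em ep -> orthonormal_pair (s *: em) (t *: ep).
Proof.
have sq (x : R) : `|x| = 1 -> x * x = 1.
  by move=> /norm1P[] ->; rewrite ?mulrNN mulr1.
move=> /sq s1 /sq t1 [mm pp mp]; split.
- by rewrite -mm -[RHS]mul1r -s1 /dot !vecE; ring.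
- by rewrite -pp -[RHS]mul1r -t1 /dot !vecE; ring.
- by rewrite -[RHS](mulr0 (s * t)) -mp /dot !vecE; ring.
Qed.

(** The hypothesis puts [A] in a closed cone with vertex [xi] and a positive angle to the line on
    both sides. The tangent cone lies in it and meets the line at [xi] only; [xi] is singular
    because an edge of the cone, with normal [eta *: ep - em], is a second line of support. *)
Lemma angular_of_cone A xi em ep n (c eta : R) : A !=set0 -> orthonormal_pair em ep ->
  boundary A xi -> support_line A [set q | dot n q = c] -> dot n xi = c ->
  dot n ep = 0 -> dot n em != 0 -> 0 < eta ->
  (forall p, A p -> eta * `|dot (p - xi) ep| <= dot (p - xi) em) ->
  angular A [set q | dot n q = c].
Proof.
move=> [p0 Ap0] o bxi sl nxi nep nem eta0 cone; split=> //; have [mm pp mp] := o.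
exists xi.
  split=> // -[_ [l' [[sl' l'xi] uniq]]].
  pose n' := eta *: ep - em.
  pose l2 := [set q | dot n' q = dot n' xi].
  have n'E v : dot n' v = eta * dot v ep - dot v em by rewrite /n' /dot !vecE; ring.
  have sl2 : support_line A l2.
    exists n', (dot n' xi); split => //.
    - apply/eqP => n'0; have := n'E em; rewrite n'0 mm mp mulr0 sub0r.
      by rewrite /dot /= !mul0r addr0 => /eqP; rewrite eq_sym oppr_eq0 oner_eq0.
    - move=> p Ap; have := cone p Ap; rewrite -subr_le0 !n'E !dotBl.
      have := ler_wpM2l (ltW eta0) (ler_norm (dot p ep - dot xi ep)); lra.
    - by exists xi.
  have E : [set q | dot n q = c] = l2.
    by rewrite -(uniq _ (conj sl nxi)) -(uniq _ (conj sl2 erefl)).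
  have : l2 (xi + ep).
    rewrite -E /=; transitivity (dot n xi + dot n ep); last by rewrite nep addr0.
    by rewrite /dot !vecE; ring.
  rewrite /l2 /= (_ : dot n' (xi + ep) = dot n' xi + dot n' ep); last first.
    by rewrite /dot !vecE; ring.
  move=> /eqP; rewrite -subr_eq0 addrAC subrr add0r n'E pp [dot ep em]dotC mp.
  by rewrite mulr1 subr0 gt_eqF.
apply/seteqP; split => [q [/= nq cq]|q ->]; last first.
  split => //; apply: subset_closure; exists p0, 0.
  by split=> //; rewrite scale0r addr0.
pose C := [set z | eta * `|dot (z - xi) ep| - dot (z - xi) em <= 0].
have closedC : closed C.
  apply: (@closed_comp _ _ (fun z : R * R => eta * `|dot (z - xi) ep| - dot (z - xi) em)
     [set x | x <= 0]); last exact: closed_le.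
  move=> z _; apply: cvgB; last exact: dot_continuous.
  apply: cvgMl_tmp; apply: (@continuous_comp _ _ _ (fun z : R * R => dot (z - xi) ep) (fun x : R => `|x|)).
    exact: dot_continuous.
  exact: norm_continuous.
have {cq} : C q.
  rewrite (closure_id C).1//; apply: closure_subset cq => z [p [t [Ap t0 ->]]].
  rewrite /C /= addrAC subrr add0r.
  have E e : dot (t *: (p - xi)) e = t * dot (p - xi) e by rewrite /dot !vecE; ring.
  rewrite !E normrM (ger0_norm t0); have := ler_wpM2l t0 (cone p Ap); lra.
have nqxi : dot (q - xi) em = 0.
  have : dot n (q - xi) = 0.
    by rewrite dotC dotBl ![dot _ n]dotC nq nxi subrr.
  rewrite (orthonormal_dot _ _ o) nep mul0r addr0 => /eqP.
  by rewrite mulf_eq0 (negbTE nem) => /eqP.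
rewrite /C /= nqxi subr0 pmulr_rle0// normr_le0 => /eqP qep.
apply/eqP; rewrite -subr_eq0; apply/eqP.
by rewrite (orthonormal_decomp (q - xi) o) nqxi qep !scale0r addr0.
Qed.

(** If points close to the line failed to exist on both sides of [xi], with thresholds [e1] and
    [e2], then [A] would lie in the cone of slope [Num.min e1 e2] and the line would be angular. The
    sign [s] turns [em] into the inner normal, [t] selects the side. *)
Lemma flat_direction A l em ep : A !=set0 -> orthonormal_pair em ep ->
  support_line A l -> parallel l ep -> ~ angular A l ->
  exists xi s t, [/\ boundary A xi, `|s| = 1, `|t| = 1,
    (forall p, A p -> 0 <= dot (p - xi) (s *: em)) &
    forall eps : R, 0 < eps -> exists p, [/\ A p, 0 < dot (p - xi) (t *: ep) &
      dot (p - xi) (s *: em) <= eps * dot (p - xi) (t *: ep)]].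
Proof.
move=> A0 o sl [z lz] nang; have [n [c [n0 lE nA [xi bxi lxi]]]] := sl.
have [mm pp mp] := o.
rewrite lE /= in lxi sl nang *.
have nep : dot n ep = 0.
  have lzt t : dot n (z + t *: ep) = c.
    have : l (z + t *: ep) by rewrite lz; exists t.
    by rewrite lE.
  have := lzt 0; have := lzt 1.
  rewrite scale0r addr0 scale1r (_ : dot n (z + ep) = dot n z + dot n ep); last first.
    by rewrite /dot !vecE; ring.
  by lra.
have nem : dot n em != 0.
  apply: contra n0 => /eqP nem; apply/eqP.
  by rewrite (orthonormal_decomp n o) nem nep !scale0r addr0.
pose s : R := if 0 < dot n em then -1 else 1.
have s1 : `|s| = 1 by rewrite /s; case: ifP; rewrite ?normrN normr1.
have sn : dot n em = - `|dot n em| * s.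
  rewrite /s; case: ltP => h; first by rewrite gtr0_norm// mulrN1 opprK.
  by rewrite ler0_norm// opprK mulr1.
clearbody s.
have Y0 p : A p -> 0 <= dot (p - xi) (s *: em).
  move=> /nA; rewrite -lxi -subr_le0 => h.
  have : dot n (p - xi) <= 0 by move: h; rewrite /dot !vecE; lra.
  rewrite (orthonormal_dot _ _ o) nep mul0r addr0 sn.
  have -> : - `|dot n em| * s * dot (p - xi) em = - (`|dot n em| * dot (p - xi) (s *: em)).
    by rewrite (_ : dot _ (s *: em) = s * dot (p - xi) em); [ring|rewrite /dot !vecE; ring].
  by rewrite oppr_le0 pmulr_rge0// normr_gt0.
have [h1|h1] := pselect (forall eps : R, 0 < eps -> exists p, [/\ A p, 0 < dot (p - xi) (1 *: ep) &
      dot (p - xi) (s *: em) <= eps * dot (p - xi) (1 *: ep)]).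
  by exists xi, s, 1; split => //; rewrite normr1.
have [h2|h2] := pselect (forall eps : R, 0 < eps -> exists p, [/\ A p, 0 < dot (p - xi) (-1 *: ep) &
      dot (p - xi) (s *: em) <= eps * dot (p - xi) (-1 *: ep)]).
  by exists xi, s, (-1); split => //; rewrite normrN normr1.
exfalso; apply: nang.
move/existsNP: h1 => [e1 /not_implyP[e10 /forallNP h1]].
move/existsNP: h2 => [e2 /not_implyP[e20 /forallNP h2]].
have o' := orthonormal_pairN s1 (normr1 _) o.
apply: (@angular_of_cone A xi (s *: em) (1 *: ep) n c (Num.min e1 e2)) => //.
- by rewrite scale1r.
- rewrite (_ : dot n (s *: em) = s * dot n em); last by rewrite /dot !vecE; ring.
  by rewrite mulf_neq0// -normr_gt0 s1.
- by rewrite lt_min e10.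
- move=> p Ap; have Yp := Y0 p Ap.
  have := h1 p; have := h2 p; rewrite !scaleN1r scale1r dotNr.
  set X := dot (p - xi) ep; set Y := dot (p - xi) (s *: em) in Yp *.
  have m1 : Num.min e1 e2 <= e1 by rewrite ge_min lexx.
  have m2 : Num.min e1 e2 <= e2 by rewrite ge_min lexx orbT.
  move=> k2 k1; have [X0|X0|X0] := ltgtP X 0.
  + rewrite ltr0_norm//; have [//|YX] := leP _ Y; exfalso; apply: k2; split => //.
      by rewrite oppr_gt0.
    by rewrite (le_trans (ltW YX))// ler_pM2r// oppr_gt0.
  + rewrite gtr0_norm//; have [//|YX] := leP _ Y; exfalso; apply: k1; split => //.
    by rewrite (le_trans (ltW YX))// ler_pM2r.
  + by rewrite X0 normr0 mulr0.
Qed.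

Lemma small_along (x e k : R) : `|x| <= k -> 0 < e -> 0 <= k ->
  forall d, 0 < d < e / (k + 1) -> `|d * x| <= e.
Proof.
move=> xk e0 k0 d /andP[d0]; rewrite ltr_pdivlMr ?ltr_wpDl// => de.
rewrite normrM gtr0_norm// ltW// (le_lt_trans _ de)// ler_pM2l//; lra.
Qed.

Lemma dot_slide M v xi e (t : R) :
  dot (M + t *: (M - v - M) - xi) e = dot (M - xi) e - t * dot v e.
Proof. by rewrite /dot !vecE; ring. Qed.

Lemma dot_shift q v xi e (t : R) : dot (q + t *: v - xi) e - dot (q - xi) e = t * dot v e.
Proof. by rewrite /dot !vecE; ring. Qed.

Lemma dotZl (t : R) v e : dot (t *: v) e = t * dot v e.
Proof. by rewrite /dot !vecE; ring. Qed.

(** In coordinates centred at xi the apex is (x, y) and B is (r, z), and [g1], [g2] are the slopes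
    along and across the line. Both points are at horizontal distance at least r/4 from the apex and
    on different sides, so |g1| is at most 4/r + 8 eps |g2|; squaring a sum doubles the squares,
    whence 32 and 128. *)
Lemma slope_bound (r eps x y z g1 g2 : R) : 0 < r -> 0 < eps ->
  r / 4 <= x <= 3 / 4 * r -> `|y| <= 2 * (eps * r) -> `|z - y| <= 2 * (eps * r) ->
  -1 <= g2 * (z - y) + g1 * (r - x) -> -1 <= g2 * - y + g1 * - x ->
  g1 ^+ 2 <= 32 / r ^+ 2 + 128 * eps ^+ 2 * g2 ^+ 2.
Proof.
move=> r0 eps0 /andP[x1 x2] hy hz hB hxi.
have yle (s : R) : `|s| <= 2 * (eps * r) -> g2 * s <= 2 * (eps * r) * `|g2|.
  move=> hs; rewrite (le_trans (ler_norm _))// normrM mulrC.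
  by rewrite ler_wpM2r.
have z1 : g2 * - y <= 2 * (eps * r) * `|g2| by apply: yle; rewrite normrN.
have z2 := yle _ hz.
pose T := 4 / r + 8 * eps * `|g2|.
have rT : r / 4 * T = 1 + 2 * (eps * r) * `|g2| by rewrite /T; field; rewrite gt_eqF.
have T0 : 0 <= T.
  by rewrite /T addr_ge0 ?divr_ge0 ?(ltW r0)// mulr_ge0// mulr_ge0// ltW.
have r4 : 0 < r / 4 by exact: divr_gt0.
have x3 : r / 4 <= r - x by lra.
have le_T (s g : R) : r / 4 <= s -> s * g <= 1 + 2 * (eps * r) * `|g2| -> g <= T.
  move=> rs sg; rewrite leNgt; apply/negP => Tg.
  have g0 : 0 <= g by exact: le_trans (ltW Tg).
  have := ler_wpM2r g0 rs; rewrite -(ltr_pM2l r4) in Tg; lra.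
have g1T : g1 <= T by apply: le_T x1 _; lra.
have g1NT : - g1 <= T by apply: le_T x3 _; lra.
have -> : 32 / r ^+ 2 + 128 * eps ^+ 2 * g2 ^+ 2 =
    2 * (4 / r) ^+ 2 + 2 * (8 * eps * `|g2|) ^+ 2.
  by rewrite !exprMn real_normK ?num_real//; field; rewrite gt_eqF.
have : g1 ^+ 2 <= T ^+ 2.
  rewrite -[g1 ^+ 2]real_normK ?num_real// lerXn2r ?nnegrE// ler_norml g1T andbT.
  by rewrite lerNl.
move/le_trans; apply; rewrite /T.
by have := sqr_ge0 (4 / r - 8 * eps * `|g2|); lra.
Qed.

(** Since [Ep <= W + 128 * Em], the total is at most [W + 129 * Em], so a total above the stated
    threshold forces [Em] above 2bW/a + 1. Then bW is less than half of a Em, and 512 = 4 * 128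
    keeps the eps-term below a quarter of it. *)
Lemma energy_balance (a b eps W Em Ep : R) : 0 < a -> 0 < b -> 0 < eps -> eps <= 1 ->
  eps * (512 * b) <= a -> 0 <= W -> 0 <= Em -> Ep <= W + 128 * eps ^+ 2 * Em ->
  W + 129 * (2 * b * W / a + 1) <= Em + Ep -> - a * Em + b * Ep < 0.
Proof.
move=> a0 b0 eps0 eps1 epsb W0 Em0 EpW ZE.
have e2 : eps ^+ 2 <= eps by rewrite expr2 ger_pMl.
have h1 : 128 * eps ^+ 2 * Em <= 128 * Em.
  by rewrite ler_wpM2r// ler_piMr//; lra.
have EmZ : 2 * b * W / a + 1 <= Em by lra.
have h2 : b * (128 * eps ^+ 2 * Em) <= a / 4 * Em.
  by rewrite mulrA ler_wpM2r//; have := ler_wpM2l (ltW b0) e2; lra.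
have h3 : b * Ep <= b * W + a / 4 * Em.
  by have := ler_wpM2l (ltW b0) EpW; rewrite mulrDr; lra.
have h4 : 2 * b * W + a <= a * Em.
  have := ler_wpM2l (ltW a0) EmZ.
  by rewrite (_ : a * (_ + 1) = 2 * b * W + a)//; field; rewrite gt_eqF.
have bW : 0 <= b * W by rewrite mulr_ge0// ltW.
lra.
Qed.

Lemma flat_energy A xi em ep (a b : R) : convex_body A -> orthonormal_pair em ep ->
  0 < a -> 0 < b -> boundary A xi ->
  (forall p, A p -> 0 <= dot (p - xi) em) ->
  (forall eps : R, 0 < eps -> exists p, [/\ A p, 0 < dot (p - xi) ep &
      dot (p - xi) em <= eps * dot (p - xi) ep]) ->
  exists u G, [/\ in_class A u, weak_grad A u G &
    - a * dir_energy A em u + b * dir_energy A ep u < 0].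
Proof.
move=> bodyA o a0 b0 bxi Y0 flat; have [cA A0 _] := bodyA; have [mm pp mp] := o.
pose eps := Num.min 1 (a / (512 * b)).
have b512 : 0 < 512 * b by lra.
have eps0 : 0 < eps by rewrite lt_min ltr01 divr_gt0.
have eps1 : eps <= 1 by rewrite ge_min lexx.
have epsb : eps * (512 * b) <= a by rewrite -ler_pdivlMr// ge_min lexx orbT.
have [B [AB rB YB]] := flat eps eps0.
set r := dot (B - xi) ep in rB YB; set y := dot (B - xi) em in YB.
have y0 : 0 <= y by exact: Y0.
have half : 0 <= (1 / 2 : R) <= 1 by lra.
have cM := closure_convex cA A0 bxi.1 (subset_closure AB) half.
set M := _ + _ in cM.
have YM : dot (M - xi) em = y / 2 by rewrite /y /M /dot !vecE; field.
have XM : dot (M - xi) ep = r / 2 by rewrite /r /M /dot !vecE; field.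
(* The foot of the midpoint [M] on the line of support: a small further step would make the distance
   to the line negative. So [P0] is found between [M] and its foot. *)
have out : ~ A° (M - (y / 2) *: em).
  move=> Aq; have [d d0 hd] := open_segment em (@open_interior _ A) Aq.
  have /interior_subset/Y0 : A° (M - (y / 2) *: em + (- (d / 2)) *: em).
    by apply: hd; rewrite normrN gtr0_norm; lra.
  rewrite (_ : dot _ em = dot (M - xi) em - (y / 2 + d / 2) * dot em em); last first.
    by rewrite /dot !vecE; ring.
  by rewrite YM mm; lra.
have [t /andP[t0 t1] bP0] := segment_boundary cA A0 cM out.
set P0 := M + t *: _ in bP0.
have YP0 : dot (P0 - xi) em = (1 - t) * (y / 2).
  by rewrite /P0 dot_slide dotZl YM mm mulr1 mulrBl mul1r.
have XP0 : dot (P0 - xi) ep = r / 2.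
  by rewrite /P0 dot_slide dotZl XM mp !mulr0 subr0.
have ty : 0 <= (1 - t) * (y / 2) <= eps * r / 2.
  by rewrite mulr_ge0; [|lra|lra]; nra.
case: (A0) => q0 Aq0.
pose k := `|dot (q0 - P0) em| + `|dot (q0 - P0) ep|.
have k0 : 0 <= k by rewrite addr_ge0.
have er0 : 0 < eps * r / 4 by rewrite divr_gt0// mulr_gt0.
(* Displacements from [P0] shorter than this fraction of [q0 - P0] change both coordinates by at
   most [eps * r / 4], as [slope_bound] will tolerate. *)
pose d1 := eps * r / 4 / (k + 1).
have d10 : 0 < d1 by rewrite divr_gt0// ltr_wpDl.
pose W := Int (fun p => \1_(A° : set (R * R)) p * (32 / r ^+ 2)).
have W0 : 0 <= W.
  apply: Int_ge0 => p; apply: mulr_ge0; first by rewrite indicE.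
  by apply: divr_ge0 => //; apply: exprn_ge0; exact: ltW.
pose Z := W + 129 * (2 * b * W / a + 1).
have [delta hdelta [AP Zle]] := tent_energy Z bodyA bP0 Aq0 d10.
set P := P0 + _ in AP Zle.
have uA := tent_in_class cA AP; have [G uG] := exists_grad bodyA uA.
exists (tent A P), G; split => //.
have XP : `|dot (P - xi) ep - r / 2| <= eps * r / 4.
  rewrite -XP0 /P dot_shift.
  by apply: (small_along (k := k)) => //; rewrite lerDr.
have YP : `|dot (P - xi) em - (1 - t) * (y / 2)| <= eps * r / 4.
  rewrite -YP0 /P dot_shift.
  by apply: (small_along (k := k)) => //; rewrite lerDl.
have er : eps * r <= r by rewrite ger_pMl.
set xP := dot (P - xi) ep in XP; set yP := dot (P - xi) em in YP.
move: XP YP; rewrite !ler_norml => /andP[X1 X2] /andP[Y1 Y2].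
have gradb p : A° p -> diff_eps (tent A P) p (G p) ->
    dot (G p) ep ^+ 2 <= 32 / r ^+ 2 + 128 * eps ^+ 2 * dot (G p) em ^+ 2.
  move=> Ap hG.
  have := tent_grad cA AP bxi.1 hG; have := tent_grad cA AP (subset_closure AB) hG.
  rewrite (orthonormal_dot (G p) (B - P) o) (orthonormal_dot (G p) (xi - P) o).
  rewrite (_ : dot (B - P) em = y - yP); last by rewrite /y /yP !dotBl; ring.
  rewrite (_ : dot (B - P) ep = r - xP); last by rewrite /r /xP !dotBl; ring.
  rewrite (_ : dot (xi - P) em = - yP); last by rewrite /yP !dotBl; ring.
  rewrite (_ : dot (xi - P) ep = - xP); last by rewrite /xP !dotBl; ring.
  apply: slope_bound; rewrite // ?normrN ?ler_norml; lra.
have nep := nice_dotX uG ep; have nem := nice_dotX uG em.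
have nW := indic_interior_nice bodyA (32 / r ^+ 2).
have EpW : dir_energy A ep (tent A P) <= W + 128 * eps ^+ 2 * dir_energy A em (tent A P).
  rewrite !(dir_energyE uG) -IntZ// -IntD//; last exact: niceZ.
  have [_ _ G0 [N N0 hN]] := uG.
  apply: (le_Int_ae nep _ N0) => [|p Np]; first by apply: niceD => //; exact: niceZ.
  rewrite indicE; have [Ap|Ap] := pselect (A° p).
    by rewrite mem_set// mul1r; apply: gradb => //; exact: (hN p Np).2.
  by rewrite memNset// mul0r add0r G0// /dot /= !mul0r addr0 expr0n mulr0.
have ZE := Zle G uG; rewrite (Int_sqr_eigen o uG) in ZE.
have Em0 : 0 <= dir_energy A em (tent A P).
  by rewrite (dir_energyE uG); apply: Int_ge0 => p; exact: sqr_ge0.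
exact: (energy_balance a0 b0 eps0 eps1 epsb W0 Em0 EpW ZE).
Qed.

End flat.

Unset Implicit Arguments.

Theorem theorem2 (R : realType) (Omega : set (R * R)) (f : R * R -> R)
  (Omega_bounded : bounded_set Omega)
  (Omega_convex : convex_set Omega)
  (Omega_interior : Omega° !=set0)
  (f_continuous : continuous f)
  (f_twice_diff : twice_differentiable f 0) :
  [/\ (* (a) *)
      positive_definite (hess_form f 0) -> zero_local_min Omega f,
      (* (b) *)
      negative_definite (hess_form f 0) -> ~ zero_local_min Omega f &
      (* (c) *)
      forall (a b : R) (em ep : R * R),
        0 < a -> 0 < b ->
        orthonormal_pair em ep ->
        hess f 0 em = (- a) *: em ->
        hess f 0 ep = b *: ep ->
        (* (i) *)
        ((exists l : set (R * R),
            [/\ support_line Omega l, parallel l ep & ~ angular Omega l]) ->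
          ~ zero_local_min Omega f) /\
        (* (ii) *)
        ((forall l : set (R * R),
            support_line Omega l -> parallel l ep -> angular Omega l) ->
          (((b / a)%:E < Kconst Omega em ep)%E -> ~ zero_local_min Omega f) /\
          ((Kconst Omega em ep < (b / a)%:E)%E -> zero_local_min Omega f))].
Proof.
have body := convex_bodyP Omega_bounded Omega_convex Omega_interior.
split.
- move=> pos; apply: (local_min_of_coercive body f_continuous f_twice_diff).
  have [|c c0 hc] := @quadratic_coercive R
    (dot (hess f 0 (dirx R)) (dirx R))
    (dot (hess f 0 (dirx R)) (diry R) + dot (hess f 0 (diry R)) (dirx R))
    (dot (hess f 0 (diry R)) (diry R)).
    by move=> v /pos; rewrite hess_formE.
  exists c => // u G uA uG; rewrite -IntZ; last exact: nice_sqr uG.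
  apply: le_Int => [||p]; [by apply: niceZ; exact: nice_sqr uG|exact: nice_hess uG|].
  by rewrite hess_formE; exact: hc.
- move=> neg.
  have [|c c0 hc] := @quadratic_coercive R
    (- dot (hess f 0 (dirx R)) (dirx R))
    (- (dot (hess f 0 (dirx R)) (diry R) + dot (hess f 0 (diry R)) (dirx R)))
    (- dot (hess f 0 (diry R)) (diry R)).
    by move=> v /neg; rewrite hess_formE !mulNr; lra.
  (* Any non-zero function of the class is a witness here; the tent over an interior point is one,
     and its energy is positive. *)
  have [q0 Aq0] := Omega_interior.
  have uA := tent_in_class Omega_convex Aq0; have [G uG] := exists_grad body uA.
  apply: (not_local_min body f_continuous f_twice_diff uA uG).
  have nG := nice_sqr uG.
  apply: (@le_lt_trans _ _ (- c * Int (fun p => dot (G p) (G p)))).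
    rewrite -IntZ//; apply: le_Int => [||p]; [exact: nice_hess uG|exact: niceZ|].
    by have := hc (G p); rewrite hess_formE !mulNr; lra.
  rewrite mulNr oppr_lt0 mulr_gt0//.
  have [r r0 rA] := interior_ball Aq0.
  have : 0 < dir_energy Omega (dirx R) (tent Omega q0).
    apply: (dir_energy_gt0 body uA _ (interior_closure_subset Aq0)).
      by apply/eqP => -[/eqP]; rewrite oner_eq0.
    by rewrite /tent subrr (gauge0 r0 rA) subr0 oner_eq0.
  rewrite (dir_energyE uG) => /lt_le_trans; apply.
  apply: le_Int => // [|p]; first exact: nice_dotX uG _.
  rewrite (_ : dot (G p) (dirx R) = (G p).1); last by rewrite /dot /=; ring.
  by rewrite /dot -!expr2 lerDl sqr_ge0.
- move=> a b em ep a0 b0 o hm hp; split.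
    move=> [l [sl pl nang]].
    have [q0 /interior_subset Aq0] := Omega_interior.
    have A0 : Omega !=set0 by exists q0.
    have [xi [s [t [bxi s1 t1 Y0 flat]]]] := flat_direction A0 o sl pl nang.
    have [u [G [uA uG]]] := flat_energy body (orthonormal_pairN s1 t1 o) a0 b0 bxi Y0 flat.
    have sq (x : R) : `|x| = 1 -> x ^+ 2 = 1.
      by move=> /norm1P[] ->; rewrite ?sqrrN expr1n.
    (* Energies are even in the direction, so the signs chosen by [flat_direction] disappear. *)
    have EZ e (x : R) : `|x| = 1 -> dir_energy Omega (x *: e) u = dir_energy Omega e u.
      move=> /sq x1; rewrite !(dir_energyE uG); congr Int; apply/funext => p.
      by rewrite -[RHS]mul1r -x1 /dot !vecE; ring.
    rewrite (EZ em s s1) (EZ ep t t1) -(Int_hess_eigen o hm hp uG).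
    exact: (not_local_min body f_continuous f_twice_diff uA uG).
  move=> _; split.
    exact: (large_ratio_not_local_min body f_continuous f_twice_diff a0 o hm hp).
  exact: (small_ratio_local_min body f_continuous f_twice_diff a0 b0 o hm hp).
Qed.
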